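(* Let $H_1:\mathbb{R}^2\to\mathbb{R}$ satisfy: $H_1\in C^{0,\alpha}$ for some $\alpha\in(0,1)$; $H_1(p+n)=H_1(p)$ for all $p\in\mathbb{R}^2$, $n\in\mathbb{Z}^2$; $\sup|H_1-[H_1]|<2\sqrt2$, where $[H_1]=\int_{[0,1]^2}H_1$. Let $H_2:\mathbb{R}^2\to\mathbb{R}$ satisfy: $H_2\in C^{0,\alpha'}$ for some $\alpha'\in(0,1)$; $H_2(p)\to H_2^\infty\in\mathbb{R}$ as $|p|\to\infty$; $|H_2-H_2^\infty|_{(2,1)}<(2/\pi)^{3/2}$; there exist nonempty open $\omega_+,\omega_-\subset\mathbb{S}^1$ with $\pm(H_2(sp)-H_2^\infty)<0$ for all $p\in\omega_\pm$, $s>0$. Assume moreover $$\frac{\sqrt2}{4}\sup|H_1-[H_1]|+\Big(\frac{\pi}{2}\Big)^{3/2}|H_2-H_2^\infty|_{(2,1)}<1.$$ Then for every $0<\tau_0<\tau_1$ there exists $\varepsilon_0\in(0,1]$ such that for every $\varepsilon\in(0,\varepsilon_0]$ and every $\tau$ with $|\tau|\in[\tau_0,\tau_1]$ there exists $(u,\lambda)\in C^2(\mathbb{R}/\mathbb{Z};\mathbb{R}^2)\times\mathbb{R}$ with $\mathcal{A}(u)=\tau$ and $\mathcal{K}(u)(t)=\varepsilon H_1(u(t))+H_2(u(t))-\lambda$ for all $t\in\mathbb{R}$.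
   Context: Identify $\mathbb{R}^2$ with $\mathbb{C}$: $ip$ is the counterclockwise rotation of $p$ by $\pi/2$. For $U\in C^2$ with $\dot U\neq0$, $\mathcal{K}(U)=\frac{i\dot U\cdot\ddot U}{|\dot U|^3}$; for a $1$-periodic $u$, $\mathcal{A}(u)=\frac12\int_0^1u\cdot i\dot u\,dt$. $C^2(\mathbb{R}/\mathbb{Z};\mathbb{R}^2)$ denotes $1$-periodic $C^2$ maps. $|f|_{(2,1)}=\int_0^\infty f^*(t)t^{-1/2}dt$ with $f^*$ the decreasing rearrangement of $|f|$. *)

(* Defs.v *)
From mathcomp Require Import all_boot all_order all_algebra.
From mathcomp Require Import all_classical all_reals all_analysis.
Set Implicit Arguments. Unset Strict Implicit. Unset Printing Implicit Defensive.
Import Order.TTheory GRing.Theory Num.Theory.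
Import numFieldNormedType.Exports.
Local Open Scope classical_set_scope.
Local Open Scope ring_scope.

Section Defs.
Variable R : realType.

Definition enorm (p : R * R) : R := Num.sqrt (p.1 ^+ 2 + p.2 ^+ 2).
Definition psub (p q : R * R) : R * R := (p.1 - q.1, p.2 - q.2).
Definition pscale (s : R) (p : R * R) : R * R := (s * p.1, s * p.2).

Definition leb2 := (@lebesgue_measure R \x @lebesgue_measure R)%E.

Definition holder_some (H : R * R -> R) : Prop :=
  (exists M : R, forall p, `|H p| <= M) /\
  exists alpha : R, 0 < alpha < 1 /\ exists C : R,
    forall p q, `|H p - H q| <= C * powR (enorm (psub p q)) alpha.

Definition Z2_periodic (H : R * R -> R) : Prop :=
  forall (m n : int) (p : R * R), H (p.1 + m%:~R, p.2 + n%:~R) = H p.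

Definition mean_square (H : R * R -> R) : R :=
  fine (\int[leb2]_(p in (`[0%R, 1%R]%classic `*` `[0%R, 1%R]%classic)) (H p)%:E)%E.

Definition sup_dev (H : R * R -> R) (c : R) : \bar R :=
  ereal_sup (range (fun p => (`|H p - c|)%:E)).

Definition distrib (f : R * R -> R) (s : R) : \bar R :=
  leb2 [set p | s < `|f p|].
Definition drearr (f : R * R -> R) (t : R) : \bar R :=
  ereal_inf [set s%:E | s in [set s : R | 0 <= s /\ (distrib f s <= t%:E)%E]].

Definition lorentz21 (f : R * R -> R) : \bar R :=
  (\int[@lebesgue_measure R]_(t in [set t : R | (0 < t)%R])
      (drearr f t * (powR t (- (1 / 2))%R)%:E))%E.

Definition tends_at_infty (H : R * R -> R) (Hinf : R) : Prop :=
  forall e : R, 0 < e -> exists M : R, forall p, M < enorm p -> `|H p - Hinf| < e.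

Definition circle : set (R * R) := [set p | enorm p = 1].

Definition open_arc (w : set (R * R)) : Prop :=
  w `<=` circle /\ w !=set0 /\
  forall p, w p -> exists d : R, 0 < d /\
    forall q, circle q -> enorm (psub q p) < d -> w q.

Definition C2 (f : R -> R) : Prop :=
  (forall t, derivable f t 1) /\ (forall t, derivable (derive1 f) t 1) /\
  continuous (derive1n 2 f).

Definition periodic1 (f : R -> R) : Prop := forall t, f (t + 1) = f t.

(* u = (x, y); i p = (-p.2, p.1). *)
(* K(u)(t) = (i u' . u'') / |u'|^3 *)
Definition curv (x y : R -> R) (t : R) : R :=
  ((- derive1 y t) * derive1n 2 x t + derive1 x t * derive1n 2 y t) /
  (enorm (derive1 x t, derive1 y t)) ^+ 3.

(* A(u) = 1/2 int_0^1 u . i u' dt *)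
Definition area (x y : R -> R) : R :=
  (1 / 2) * \int[@lebesgue_measure R]_(t in `[0%R, 1%R]%classic)
              (x t * (- derive1 y t) + y t * derive1 x t).

End Defs.

(* Main.v *)
(* With H = eps H1 + (H2 - H2inf), a curve of prescribed area solves K(u) =
   H(u) - lambda when it is critical for length plus the flux of a vector field
   with divergence H; the constant H2inf and the mean of H1 only shift lambda.

   Smoothing the kernel z/|z|^2 on a fine lattice produces fields Q of class
   C^{1,1} with div Q close to H on a large square, and the rearrangement bound
   for the Lorentz norm of H2 - H2inf gives |Q| <= 37/38 when eps is small.  So
   length plus flux is coercive, and for closed N-gons of fixed area its minimum
   in a large box exists by compactness.  A regular N-gon placed far out in the
   cone where H has the favourable sign beats the isoperimetric value by a fixed
   amount, which an N-gon reaching the boundary of the box cannot do, since H is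
   tiny there; the minimizer is therefore interior and satisfies a discrete
   Euler-Lagrange equation.  As N -> oo and div Q -> H, a limit along an
   ultrafilter satisfies x'' = - d (H - lambda) y', y'' = d (H - lambda) x' with
   constant speed d > 0, and the area passes to the limit. *)
Require Import Defs.
From mathcomp Require Import all_boot all_order all_algebra.
From mathcomp Require Import all_classical all_reals all_analysis.
From mathcomp Require Import measurable_realfun.
From mathcomp Require Import ring lra zify.
Set Implicit Arguments. Unset Strict Implicit. Unset Printing Implicit Defensive.
Import Order.TTheory GRing.Theory Num.Theory.
Import numFieldNormedType.Exports.
Local Open Scope classical_set_scope.
Local Open Scope ring_scope.

(** * Lorentz norm and rearrangement *)

(** Polygons make compactness finite-dimensional; regularity is recovered only in the limit, from
    bounds uniform in the number of vertices. The obstacle is that the second-order constant [C] of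
    the field blows up as its divergence is made closer to H. This dictates the order of choices:
    the box and the bound on eps come first and do not depend on the accuracy [zeta]; then the field
    and its [C]; the number N of vertices last, so that every error of size [C / N] is negligible.
    No bound that survives in the limit contains [C]. The gain of the competitor is compared with
    the isoperimetric value for N-gons themselves, which the regular N-gon attains, so that the
    length terms drop out of the comparison without any error. *)

Lemma ge0_le_integral_nonmeas d (T : measurableType d) (R : realType)
    (mu : {measure set T -> \bar R}) (D : set T) (f g : T -> \bar R) :
  (forall x, D x -> (0 <= f x)%E) -> (forall x, D x -> (f x <= g x)%E) ->
  (\int[mu]_(x in D) f x <= \int[mu]_(x in D) g x)%E.
Proof.
move=> f0 fg.
have g0 x : D x -> (0 <= g x)%E by move=> Dx; apply: le_trans (f0 x Dx) (fg x Dx).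
rewrite !ge0_integralE//; apply: ereal_sup_le => _ [k hk <-]; exists k => // x.
apply: le_trans (hk x) _; rewrite /patch; case: ifPn => // /set_mem Dx.
exact: fg.
Qed.

(** A lower Riemann sum: on the interval from [i h^2] to [(i+1) h^2] the factor [t^(-1/2)] is at
    least its value at the right end, and that value times the length [h^2] is [h / sqrt (i+1)]. *)
Lemma lorentz21_ge_sum (R : realType) (f : R * R -> R) (h : R) (n : nat)
    (a : nat -> R) : 0 < h -> (forall i, (i < n)%N -> 0 <= a i) ->
  (forall i t, (i < n)%N -> 0 < t -> t < i.+1%:R * h ^+ 2 ->
     ((a i)%:E <= drearr f t)%E) ->
  ((\sum_(i < n) a i * (h / Num.sqrt i.+1%:R))%:E <= lorentz21 f)%E.
Proof.
move=> h0 a0 ah.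
pose I i := `]i%:R * h ^+ 2, i.+1%:R * h ^+ 2[%classic : set R.
pose b i := a i / (h * Num.sqrt i.+1%:R).
have b0 i : (i < n)%N -> 0 <= b i.
  by move=> /a0 ai; rewrite /b divr_ge0// mulr_ge0 ?sqrtr_ge0// ltW.
have mI i : measurable (I i) by exact: measurable_itv.
have Ipos i t : I i t -> 0 < t.
  rewrite /I /= in_itv/= => /andP[+ _]; apply: le_lt_trans.
  by rewrite mulr_ge0// exprn_ge0// ltW.
have Iuniq i j t : I i t -> I j t -> i = j.
  rewrite /I /= !in_itv/= => /andP[i1 i2] /andP[j1 j2].
  have h2 : 0 < h ^+ 2 by rewrite exprn_gt0.
  have := lt_trans i1 j2; have := lt_trans j1 i2.
  rewrite !ltr_pM2r// !ltr_nat; lia.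
pose g (t : R) : \bar R := (\sum_(i < n) (b i * \1_(I i) t)%:E)%E.
have -> : (\sum_(i < n) a i * (h / Num.sqrt i.+1%:R))%:E =
    (\int[@lebesgue_measure R]_(t in [set t : R | (0 < t)%R]) g t)%E.
  rewrite /g ge0_integral_sum//; last 3 first.
  - by rewrite -set_itvoy; exact: measurable_itv.
  - move=> i; apply/measurable_EFinP; apply: measurable_funM => //.
    by apply: measurable_indic; apply: mI.
  - by move=> k t _; rewrite lee_fin mulr_ge0 ?b0// indicE.
  rewrite -sumEFin; apply: eq_bigr => i _.
  under eq_integral do rewrite EFinM.
  rewrite ge0_integralZl//; last 3 first.
  - by rewrite -set_itvoy; exact: measurable_itv.
  - by apply/measurable_EFinP; apply: measurable_indic; apply: mI.
  - by rewrite lee_fin b0.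
  rewrite integral_indic//; [|by rewrite -set_itvoy; exact: measurable_itv|exact: mI].
  rewrite setIidl; last by move=> t /Ipos.
  have hi : i%:R * h ^+ 2 < i.+1%:R * h ^+ 2.
    by rewrite ltr_pM2r ?exprn_gt0// ltr_nat.
  rewrite /I [X in (_ * X)%E]lebesgue_measure_itv/= lte_fin hi -EFinD -EFinM; congr EFin.
  rewrite /b -mulrBl -natr1 [_ + 1]addrC addrK mul1r.
  have s0 : Num.sqrt (i%:R + 1) != 0 :> R.
    by rewrite sqrtr_eq0 -ltNge ltr_wpDl.
  by field; rewrite [1 + _]addrC s0 gt_eqF.
(* The integral is a supremum over simple functions below the integrand, so the step function [g]
   can be compared with it without first showing [drearr f] measurable. *)
apply: ge0_le_integral_nonmeas.
  by move=> t _; apply: sume_ge0 => i _; rewrite lee_fin mulr_ge0 ?b0// indicE.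
move=> t /= t0.
have [[i0 [i0n Ii0]]|nI] := pselect (exists i, (i < n)%N /\ I i t).
  have -> : g t = (b i0)%:E.
    rewrite /g (bigD1 (Ordinal i0n))//= big1 ?adde0.
      by rewrite indicE mem_set// mulr1.
    move=> j ji; rewrite indicE memNset ?mulr0// => Ij.
    by move/eqP: ji; apply; apply: val_inj; exact: Iuniq Ij Ii0.
  have [i1 i2] : i0%:R * h ^+ 2 < t /\ t < i0.+1%:R * h ^+ 2.
    by move: Ii0; rewrite /I /= in_itv/= => /andP[].
  apply: (@le_trans _ _ ((a i0)%:E * (powR t (- (1 / 2)))%:E)%E); last first.
    by apply: lee_wpmul2r; [rewrite lee_fin powR_ge0|exact: ah].
  rewrite -EFinM lee_fin /b; apply: ler_wpM2l; first exact: a0.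
  rewrite powRN mul1r powR12_sqrt ?(ltW t0)//.
  rewrite lef_pV2 ?posrE ?mulr_gt0 ?sqrtr_gt0//.
  rewrite -(ler_pXn2r (n := 2)) ?nnegrE ?sqrtr_ge0 ?mulr_ge0 ?(ltW h0)//.
  by rewrite exprMn !sqr_sqrtr ?(ltW t0)// mulrC ltW.
have -> : g t = 0%E.
  rewrite /g big1// => i _; rewrite indicE memNset ?mulr0// => Ii.
  by apply: nI; exists i.
apply: mule_ge0; last by rewrite lee_fin powR_ge0.
by apply: le_ereal_inf_tmp => _ [s [s0 _] <-]; rewrite lee_fin.
Qed.

(** Half-open, so that the cells tile the plane and the areas of distinct cells add up exactly. *)
Definition cell (R : realType) (h : R) (c : int * int) : set (R * R) :=
  `[c.1%:~R * h, (c.1 + 1)%:~R * h[%classic `*`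
  `[c.2%:~R * h, (c.2 + 1)%:~R * h[%classic.

Definition unif_cont (R : realType) (f : R * R -> R) := forall e, 0 < e ->
  exists2 d, 0 < d & forall p q, `|p.1 - q.1| <= d -> `|p.2 - q.2| <= d ->
    `|f p - f q| <= e.

Lemma in_cell (R : realType) (h : R) (c : int * int) p : cell h c p ->
  [/\ c.1%:~R * h <= p.1, p.1 < c.1%:~R * h + h,
      c.2%:~R * h <= p.2 & p.2 < c.2%:~R * h + h].
Proof.
by rewrite /cell /= !in_itv/= !intrD !mulrDl !mul1r => -[/andP[? ?] /andP[? ?]].
Qed.

Lemma cell_inj (R : realType) (h : R) (c c' : int * int) p : 0 < h ->
  cell h c p -> cell h c' p -> c = c'.
Proof.
move=> h0; rewrite /cell /= !in_itv/=.
have aux (a b : int) (x : R) : a%:~R * h <= x < (a + 1)%:~R * h ->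
    b%:~R * h <= x < (b + 1)%:~R * h -> a = b.
  move=> /andP[a1 a2] /andP[b1 b2].
  have := le_lt_trans a1 b2; have := le_lt_trans b1 a2.
  rewrite !ltr_pM2r// !ltr_int; lia.
case: c c' => [i j] [i' j'] /= [/aux H1 /aux H2] [/H1 -> /H2 ->].
by [].
Qed.

Lemma ex_cell (R : realType) (h : R) p : 0 < h -> exists c, cell h c p.
Proof.
move=> h0; exists (Num.floor (p.1 / h), Num.floor (p.2 / h)).
have aux (x : R) : (Num.floor (x / h))%:~R * h <= x <
    (Num.floor (x / h) + 1)%:~R * h.
  rewrite -ler_pdivlMr// -ltr_pdivrMr//.
  by rewrite ge_floor ?num_real// floorD1_gt ?num_real.
by rewrite /cell /= !in_itv/=.
Qed.

Lemma measurable_cell (R : realType) (h : R) c : measurable (cell h c).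
Proof. by apply: measurableX; exact: measurable_itv. Qed.

Lemma leb2_cell (R : realType) (h : R) c : 0 < h ->
  leb2 (cell h c) = (h ^+ 2)%:E :> \bar R.
Proof.
move=> h0; rewrite /leb2 /cell product_measure1E; [|exact: measurable_itv..].
have side (a : int) : lebesgue_measure `[a%:~R * h, (a + 1)%:~R * h[%classic = h%:E :> \bar R.
  rewrite lebesgue_measure_itv/= lte_fin ltr_pM2r// ltr_int ifT; last by lia.
  by rewrite -EFinD intrD mulrDl mul1r addrC addKr.
by rewrite [X in (X * _)%E]side [X in (_ * X)%E]side -EFinM.
Qed.

Lemma leb2_cells (R : realType) (h : R) (s : seq (int * int)) : 0 < h -> uniq s ->
  measurable (\big[setU/set0]_(c <- s) cell h c) /\
  leb2 (\big[setU/set0]_(c <- s) cell h c) = ((size s)%:R * h ^+ 2)%:E :> \bar R.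
Proof.
move=> h0; elim: s => [_|c s IH /= /andP[cs us]].
  by rewrite big_nil /leb2 measure0 mul0r; split; [exact: measurable0|].
have [mU eU] := IH us; rewrite big_cons; split.
  by apply: measurableU => //; exact: measurable_cell.
rewrite /leb2 measureU//; last 2 first.
- exact: measurable_cell.
- rewrite -subset0 => p [cp]; rewrite -bigcup_seq => -[c' /= c's] c'p.
  by rewrite (cell_inj h0 cp c'p) c's in cs.
rewrite [X in (X + _)%E](leb2_cell c h0) [X in (_ + X)%E]eU -EFinD.
by rewrite -natr1 mulrDl mul1r addrC.
Qed.

(** By continuity the set is open, hence it is the union of the cells of side [1 / (n+1)] that it
    contains, a countable family. *)
Lemma measurable_gt_norm (R : realType) (f : R * R -> R) (a : R) :
  unif_cont f -> measurable [set p | a < `|f p|].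
Proof.
move=> uf; set U := [set p | _].
pose C n (c : int * int) : set (R * R) :=
  if `[< cell (n.+1%:R^-1) c `<=` U >] then cell (n.+1%:R^-1) c else set0.
have -> : U = \bigcup_n \bigcup_c C n c.
  apply/seteqP; split=> [p Up|p [n _ [c _]]]; last first.
    by rewrite /C; case: ifPn => // /asboolP; apply.
  have e0 : 0 < (`|f p| - a) / 2 by rewrite divr_gt0// subr_gt0.
  have [d d0 fd] := uf _ e0.
  have [n nd] : exists n : nat, n.+1%:R^-1 < d.
    exists (Num.truncn d^-1); rewrite invf_plt ?posrE//.
    exact: truncnS_gt.
  have n0 : 0 < (n.+1%:R : R)^-1 by rewrite invr_gt0.
  have [c cp] := ex_cell p n0.
  exists n => //; exists c => //; rewrite /C; case: ifPn => // /asboolP; case => q cq.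
  have [c1 c2 c3 c4] := in_cell cp; have [b1 b2 b3 b4] := in_cell cq.
  have H := fd p q.
  have {}H : `|f p - f q| <= (`|f p| - a) / 2.
    clear cq cp; move: (n.+1%:R^-1 : R) nd c1 c2 c3 c4 b1 b2 b3 b4 => {n n0} h.
    by move=> *; apply: H; rewrite ler_norml; apply/andP; split; lra.
  have := ler_normD (f p - f q) (f q); rewrite subrK.
  move: Up; rewrite /U /=; lra.
apply: bigcupT_measurable => n.
apply: countable_bigcupT_measurable => [|c]; first exact: countableP.
rewrite /C; case: ifPn => _.
  exact: measurable_cell.
exact: measurable0.
Qed.

(** If [distrib f r <= t] for some [r < a], the superlevel set at [r] would still contain all the
    cells, whose total area exceeds [t]. *)
Lemma drearr_ge (R : realType) (f : R * R -> R) (h a t : R) (s : seq (int * int)) :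
  unif_cont f -> 0 < h -> uniq s ->
  (forall c p, c \in s -> cell h c p -> a <= `|f p|) ->
  t < (size s)%:R * h ^+ 2 -> (a%:E <= drearr f t)%E.
Proof.
move=> uf h0 us sa ts; apply: le_ereal_inf_tmp => _ [r [r0 rt] <-].
rewrite lee_fin leNgt; apply/negP => ra.
have [mU eU] := leb2_cells h0 us.
suff : (((size s)%:R * h ^+ 2)%:E <= distrib f r)%E.
  by move=> /le_trans/(_ rt); rewrite lee_fin leNgt ts.
rewrite -eU /distrib /leb2; apply: le_measure; rewrite ?inE//.
  exact: measurable_gt_norm.
move=> p; rewrite -bigcup_seq => -[c /= cs cp] /=.
exact: lt_le_trans ra (sa _ _ cs cp).
Qed.

(** Summation by parts; the induction compares each partial sum with its last coefficient times the
    sum of the [d i]. *)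
Lemma abel_sum_ge0 (R : realType) (n : nat) (a d : nat -> R) :
  (forall i, (i < n)%N -> 0 <= a i) ->
  (forall i, (i.+1 < n)%N -> a i.+1 <= a i) ->
  (forall j, (j <= n)%N -> 0 <= \sum_(i < j) d i) ->
  0 <= \sum_(i < n) a i * d i.
Proof.
move=> a0 ad dn.
case: n a0 ad dn => [|n] a0 ad dn; first by rewrite big_ord0.
suff H k : (k <= n)%N -> a k * \sum_(i < k.+1) d i <= \sum_(i < k.+1) a i * d i.
  by apply: le_trans (H n (leqnn _)); rewrite mulr_ge0 ?a0 ?dn.
elim: k => [_|k IH kn]; first by rewrite !big_ord_recr !big_ord0/= !add0r.
rewrite big_ord_recr [leRHS]big_ord_recr/= mulrDr lerD2r.
apply: le_trans (IH (ltnW kn)); apply: ler_wpM2r; last exact: ad.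
by apply: dn; rewrite ltnS ltnW.
Qed.

(* Abel summation along the order of decreasing [a]. *)
Lemma sum_rearrangement (R : realType) (T : eqType) (x0 : T) (s : seq T)
    (a w : T -> R) (b : nat -> R) : uniq s -> (forall x, 0 <= a x) ->
  (forall t, uniq t -> {subset t <= s} -> \sum_(x <- t) w x <= \sum_(i < size t) b i) ->
  \sum_(x <- s) a x * w x <=
  \sum_(i < size s) a (nth x0 (sort (fun x y => a y <= a x) s) i) * b i.
Proof.
move=> us a0 wb; set s' := sort _ _.
have tot : total (fun x y => a y <= a x) by move=> x y; rewrite le_total.
have ps : perm_eq s s' by rewrite perm_sym; apply/permPl; exact: perm_sort.
have us' : uniq s' by rewrite sort_uniq.
have ss' : sorted (fun x y => a y <= a x) s' by exact: sort_sorted.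
rewrite (perm_big _ ps)/= (perm_size ps) (big_nth x0) big_mkord -subr_ge0 -sumrB.
under eq_bigr do rewrite -mulrBr.
apply: (@abel_sum_ge0 _ _ (fun i => a (nth x0 s' i)) (fun i => b i - w (nth x0 s' i))) => //.
- move=> i si; apply: (sortedP x0 ss') => //.
- move=> j js; rewrite sumrB subr_ge0.
  have -> : \sum_(i < j) w (nth x0 s' i) = \sum_(x <- take j s') w x.
    rewrite (big_nth x0) big_mkord size_takel//; apply: eq_bigr => i _.
    by rewrite nth_take.
  have := wb (take j s'); rewrite size_takel//; apply; first exact: take_uniq.
  by move=> x /mem_take; rewrite (perm_mem ps).
Qed.

(** A discrete Hardy-Littlewood inequality. With the cells listed by decreasing [a], the first [i+1]
    of them cover area [(i+1) h^2], where [|f|] is at least the value of [a] in position [i]; that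
    value therefore bounds [drearr f t] from below for [t < (i+1) h^2]. *)
Lemma cell_sum_lt_lorentz21 (R : realType) (f : R * R -> R) (h B : R)
    (s : seq (int * int)) (a w : int * int -> R) :
  unif_cont f -> 0 < h -> 0 < B -> uniq s -> (forall c, 0 <= a c) ->
  (forall c p, c \in s -> cell h c p -> a c <= `|f p|) ->
  (forall t, uniq t -> {subset t <= s} ->
     \sum_(c <- t) w c <= B * \sum_(i < size t) (h / Num.sqrt i.+1%:R)) ->
  ((\sum_(c <- s) a c * w c)%:E <= B%:E * lorentz21 f)%E.
Proof.
move=> uf h0 B0 us a0 sa wb.
set s' := sort (fun x y => a y <= a x) s.
have tr : transitive (fun x y => a y <= a x) by move=> y x z /[swap]; exact: le_trans.
have ss' : sorted (fun x y => a y <= a x) s'.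
  by apply: sort_sorted => x y; rewrite le_total.
apply: (@le_trans _ _ (B%:E * (\sum_(i < size s) a (nth (0, 0) s' i) * (h / Num.sqrt i.+1%:R))%:E)%E).
  rewrite -EFinM lee_fin mulr_sumr.
  under [leRHS]eq_bigr do rewrite mulrCA.
  apply: (@sum_rearrangement _ _ (0, 0) s a w (fun i => B * (h / Num.sqrt i.+1%:R))) => // t ut ts.
  by rewrite -mulr_sumr; exact: wb.
apply: lee_wpmul2l; first by rewrite lee_fin ltW.
apply: (@lorentz21_ge_sum _ f h (size s) (fun i => a (nth (0, 0) s' i))) => // i t si t0 th.
have is' : (i < size s')%N by rewrite size_sort.
apply: (@drearr_ge _ _ h _ _ (take i.+1 s')) => //.
- by rewrite take_uniq// sort_uniq.
- move=> c p cs cp; have cs' := mem_take cs.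
  apply: le_trans (sa c p _ cp); last by move: cs'; rewrite mem_sort.
  have /(nthP (0, 0)) [k kt <-] := cs.
  move: kt; rewrite size_takel// ltnS => ki; rewrite nth_take//.
  have := @sorted_leq_nth _ (fun x y => a y <= a x) tr _ (0,0) s' ss'.
  apply => //; rewrite ?inE//; last exact: leq_ltn_trans ki is'.
- by rewrite size_takel.
Qed.

(** An open interval of length [2 d] holds at most [K] integers, [K] being the ceiling of [2 d]; so
    the square holds at most [K^2] lattice points, and [K < 2 d + 1]. *)
Lemma lattice_count (R : realType) (x y d : R) (s : seq (int * int)) : uniq s ->
  0 <= d ->
  (forall c, c \in s -> `|x - c.1%:~R| < d /\ `|y - c.2%:~R| < d) ->
  Num.sqrt (size s)%:R < 2 * d + 1.
Proof.
move=> us d0 sd.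
pose K := `|Num.ceil (2 * d)|%N.
have cd : 0 <= Num.ceil (2 * d) by rewrite ceil_ge0 (lt_le_trans (@ltrN10 _))// mulr_ge0.
have KE : (K%:R : R) = (Num.ceil (2 * d))%:~R.
  by rewrite /K -[LHS]/(K%:~R) /K gez0_abs.
have K1 : (K%:R : R) < 2 * d + 1.
  by rewrite KE -ltrBlDr; have := gt_pred_ceil (2 * d); rewrite intrD; lra.
have K2 : 2 * d <= K%:R by rewrite KE ceil_ge ?num_real.
have aux (u : R) (n : int) : `|u - n%:~R| < d ->
    exists2 i, i \in iota 0 K & n = Num.floor (u - d) + 1 + i%:Z.
  rewrite ltr_norml => /andP[n1 n2].
  have nl : Num.floor (u - d) < n by rewrite floor_lt_int; lra.
  pose m : int := n - (Num.floor (u - d) + 1).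
  have m0 : 0 <= m by rewrite /m; lia.
  exists `|m|%N; last by rewrite gez0_abs// /m; lia.
  rewrite mem_iota add0n leq0n/= -(@ltr_nat R).
  apply: lt_le_trans K2.
  have := floorD1_gt (u - d); rewrite intrD => H.
  have -> : (`|m|%N%:R : R) = m%:~R by rewrite -[LHS]/(`|m|%N%:~R) gez0_abs.
  rewrite /m intrB intrD; lra.
pose g i j := (Num.floor (x - d) + 1 + i%:Z, Num.floor (y - d) + 1 + j%:Z) : int * int.
have : (size s <= size [seq g i j | i <- iota 0 K, j <- iota 0 K])%N.
  apply: uniq_leq_size => // -[c1 c2] /sd /= [/aux [i iK ->] /aux [j jK ->]].
  by apply/allpairsP; exists (i, j).
rewrite size_allpairs size_iota -(@ler_nat R) natrM -expr2 => sK.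
apply: le_lt_trans K1; rewrite -(@ler_pXn2r _ 2%N) ?nnegrE ?sqrtr_ge0//.
by rewrite sqr_sqrtr.
Qed.

(** [w] stands for the kernel times the cell area. Among [n+1] cells one is far enough from [(x, y)]
    for its weight to be below the last term on the right; removing that cell gives the
    induction. *)
Lemma lattice_kernel_sum (R : realType) (h eta x y : R) (w : int * int -> R)
    (s : seq (int * int)) : 0 < h -> 8 * h <= eta -> uniq s ->
  (forall c, w c <= 2 * h ^+ 2 / eta) ->
  (forall c r, 0 < r -> r <= `|x - c.1%:~R * h| \/ r <= `|y - c.2%:~R * h| ->
     w c <= h ^+ 2 / r) ->
  \sum_(c <- s) w c <= 9 / 4 * \sum_(i < size s) (h / Num.sqrt i.+1%:R).
Proof.
move=> h0 he us w1 w2; have e0 : 0 < eta by lra.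
have [n sn] : exists n, size s = n by exists (size s).
rewrite sn; elim: n s us sn => [|n IH] s us sn.
  by move/eqP: sn; rewrite size_eq0 => /eqP ->; rewrite big_nil big_ord0 mulr0.
suff [c cs wc] : exists2 c, c \in s & w c <= 9 / 4 * (h / Num.sqrt n.+1%:R).
  rewrite (perm_big _ (perm_to_rem cs))/= big_cons big_ord_recr/= mulrDr addrC.
  by apply: lerD => //; apply: IH; rewrite ?rem_uniq// size_rem// sn.
set q := Num.sqrt n.+1%:R.
have q0 : 0 < q by rewrite sqrtr_gt0.
case: s us sn => [//|c0 s] us sn.
(* For [q < 9] the uniform bound on [w] suffices, since [8 h <= eta] makes it at most [h / 4]. For
   [q >= 9] the count yields a cell at distance [h (q - 1) / 2], and [2 / (q - 1) <= (9/4) / q]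
   holds exactly from [q = 9] on. *)
have [q9|q9] := ltP q 9.
  exists c0; first by rewrite mem_head.
  apply: le_trans (w1 _) _; rewrite [leRHS]mulrA ler_pdivlMr// mulrAC ler_pdivrMr//.
  have : h ^+ 2 * q <= h ^+ 2 * 9 by rewrite ler_wpM2l ?sqr_ge0// ltW.
  have : h * (8 * h) <= h * eta by rewrite ler_pM2l.
  rewrite expr2; lra.
pose d := (q - 1) / 2.
have d0 : 0 < d by rewrite /d; lra.
have [[c cs cd]|nE] := pselect (exists2 c, c \in c0 :: s & h * d <= `|x - c.1%:~R * h| \/ h * d <= `|y - c.2%:~R * h|).
  exists c => //;
  have hd : 0 < h * d by exact: mulr_gt0.
  apply: le_trans (w2 c (h * d) hd cd) _.
  rewrite [leRHS]mulrA ler_pdivlMr// mulrAC ler_pdivrMr//.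
  have : (h * h) * q <= (h * h) * (9 / 4 * d) by rewrite ler_pM2l ?mulr_gt0// /d; lra.
  rewrite expr2; lra.
have : q < 2 * d + 1.
  rewrite /q -sn; apply: (@lattice_count _ (x / h) (y / h)) => //; first exact: ltW.
  move=> c cs.
  have aux (u v : R) : ~ (h * d <= `|u - v * h|) -> `|u / h - v| < d.
    move=> /negP; rewrite -ltNge => H.
    rewrite -(ltr_pM2l h0) -[X in X * `|_|](gtr0_norm h0) -normrM.
    by rewrite mulrBr mulrCA divff ?gt_eqF// mulr1 [h * v]mulrC.
  by split; apply: aux => H; apply: nE; exists c => //; [left|right].
by rewrite /d => H; exfalso; move: H; apply/negP; rewrite -leNgt; lra.
Qed.

(** * Fields with prescribed divergence *)

(** [1 / t], continued below [t = 1] by its tangent at 1 and hence of class [C^{1,1}];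
    [gam (|z|^2 / eta^2) / eta^2] is [1 / |z|^2] outside the disc of radius [eta]. *)
Definition gam (R : realType) (t : R) : R := if t <= 1 then 2 - t else t^-1.
Definition dgam (R : realType) (t : R) : R := if t <= 1 then -1 else - t ^- 2.

Lemma gam_taylor (R : realType) (t u : R) : 0 <= t -> 0 <= u ->
  `|gam u - gam t - dgam t * (u - t)| <= (u - t) ^+ 2.
Proof.
move=> t0 u0; rewrite /gam /dgam.
case: (leP t 1) => t1; case: (leP u 1) => u1.
- have -> : 2 - u - (2 - t) - -1 * (u - t) = 0 by ring.
  by rewrite normr0 sqr_ge0.
- have u00 : u != 0 by rewrite gt_eqF// (lt_trans ltr01).
  have -> : u^-1 - (2 - t) - -1 * (u - t) = (u - 1) ^+ 2 * u^-1 by field.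
  rewrite ger0_norm; last by rewrite mulr_ge0 ?sqr_ge0// invr_ge0.
  apply: (@le_trans _ _ ((u - 1) ^+ 2)).
    by rewrite ler_piMr ?sqr_ge0// invf_le1 ?(lt_trans ltr01)// ltW.
  by rewrite ler_pXn2r// ?nnegrE; lra.
- have t00 : t != 0 by rewrite gt_eqF// (lt_trans ltr01).
  have v1 : 0 < t^-1 <= 1 by rewrite invr_gt0 invf_le1 ?(lt_trans ltr01) ?(ltW t1).
  have -> : 2 - u - t^-1 - (- t ^- 2) * (u - t) = (1 - t^-1) * ((1 - t^-1) + (1 - u) * (1 + t^-1)).
    by field.
  have vt : 1 - t^-1 <= t - 1.
    rewrite -subr_ge0; have -> : t - 1 - (1 - t^-1) = (t - 1) ^+ 2 * t^-1 by field.
    by rewrite mulr_ge0 ?sqr_ge0//; lra.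
  move: v1 vt; move: (t^-1) => v /andP[v0 v1] vt.
  rewrite ger0_norm; last by rewrite mulr_ge0//; nra.
  apply: (@le_trans _ _ ((t - 1) * ((t - 1) + (1 - u) * 2))); last by rewrite expr2; nra.
  apply: ler_pM; nra.
- have t00 : t != 0 by rewrite gt_eqF// (lt_trans ltr01).
  have u00 : u != 0 by rewrite gt_eqF// (lt_trans ltr01).
  have -> : u^-1 - t^-1 - (- t ^- 2) * (u - t) = (u - t) ^+ 2 * (t^-1 ^+ 2 * u^-1).
    by field; rewrite u00.
  have v1 : 0 < t^-1 <= 1 by rewrite invr_gt0 invf_le1 ?(lt_trans ltr01) ?(ltW t1).
  have v2 : 0 < u^-1 <= 1 by rewrite invr_gt0 invf_le1 ?(lt_trans ltr01) ?(ltW u1).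
  move: v1 v2; move: (t^-1) (u^-1) => v w /andP[v0 v1] /andP[w0 w1].
  rewrite ger0_norm; last by rewrite mulr_ge0 ?sqr_ge0// mulr_ge0 ?sqr_ge0// ltW.
  rewrite ler_piMr ?sqr_ge0// mulr_ile1 ?sqr_ge0 ?(ltW w0)//.
  by rewrite expr_le1// ltW.
Qed.

Lemma gam_ge0 (R : realType) (t : R) : 0 <= gam t.
Proof. by rewrite /gam; case: (leP t 1) => t1; [lra|rewrite invr_ge0; lra]. Qed.

Lemma dgam_norm (R : realType) (t : R) : `|dgam t| <= 1.
Proof.
rewrite /dgam; case: (leP t 1) => t1; first by rewrite normrN1.
have t0 : 0 < t by exact: lt_trans t1.
rewrite normrN ger0_norm ?invr_ge0 ?exprn_ge0 ?(ltW t0)//.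
by rewrite invf_le1 ?exprn_gt0// expr_ge1 ?(ltW t0)// ltW.
Qed.

(* First component of the kernel z/|z|^2, made C^{1,1} inside the disc of radius
   [eta]; its divergence is [rho], an approximate identity up to normalization. *)
Definition kx (R : realType) (eta x y : R) : R :=
  x * gam ((x ^+ 2 + y ^+ 2) / eta ^+ 2) / eta ^+ 2.
Definition kxx (R : realType) (eta x y : R) : R :=
  (gam ((x ^+ 2 + y ^+ 2) / eta ^+ 2)
   + 2 * x ^+ 2 / eta ^+ 2 * dgam ((x ^+ 2 + y ^+ 2) / eta ^+ 2)) / eta ^+ 2.
Definition kxy (R : realType) (eta x y : R) : R :=
  2 * x * y / eta ^+ 2 * dgam ((x ^+ 2 + y ^+ 2) / eta ^+ 2) / eta ^+ 2.
Definition rho (R : realType) (eta x y : R) : R :=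
  4 / eta ^+ 2 * Num.max (1 - (x ^+ 2 + y ^+ 2) / eta ^+ 2) 0.

(* [fx], [fy] are the partial derivatives of [f], with a quadratic Taylor
   remainder on the square of half-side [B]. *)
Definition taylor2 (R : realType) (f fx fy : R -> R -> R) (B C : R) :=
  forall x y x' y', `|x| <= B -> `|y| <= B -> `|x'| <= B -> `|y'| <= B ->
  `|f x' y' - f x y - (fx x y * (x' - x) + fy x y * (y' - y))|
     <= C * ((x' - x) ^+ 2 + (y' - y) ^+ 2).
Definition c11 (R : realType) (f fx fy : R -> R -> R) (B : R) :=
  exists2 C, 0 <= C & taylor2 f fx fy B C.

Lemma kx_c11 (R : realType) (eta B : R) : 0 < eta -> 0 < B ->
  c11 (kx eta) (kxx eta) (kxy eta) B.
Proof.
move=> e0 B0.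
pose E := 2 * B / eta ^+ 2.
have e2 : 0 < eta ^+ 2 by rewrite exprn_gt0.
have E0 : 0 < E by rewrite divr_gt0// mulr_gt0.
exists ((2 * E * (1 + 4 * B * E) + 2 * B * E ^+ 2 + B / eta ^+ 2) / eta ^+ 2).
  rewrite divr_ge0 ?(ltW e2)//.
  have : 0 <= B / eta ^+ 2 by rewrite divr_ge0 ?ltW.
  by rewrite expr2; nra.
move=> x y x' y' xB yB xB' yB'.
set t := (x ^+ 2 + y ^+ 2) / eta ^+ 2.
set u := (x' ^+ 2 + y' ^+ 2) / eta ^+ 2.
set a := x' - x; set b := y' - y.
have t0 : 0 <= t by rewrite divr_ge0 ?addr_ge0 ?sqr_ge0 ?ltW.
have u0 : 0 <= u by rewrite divr_ge0 ?addr_ge0 ?sqr_ge0 ?ltW.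
(* The remainder splits into three pieces, each quadratic in [(a, b)]: a product of increments, the
   Taylor remainder of [gam], and the second-order part of [u - t]. *)
have -> : kx eta x' y' - kx eta x y - (kxx eta x y * a + kxy eta x y * b) =
    (a * (gam u - gam t) + x * (gam u - gam t - dgam t * (u - t))
     + x * dgam t * ((a ^+ 2 + b ^+ 2) / eta ^+ 2)) / eta ^+ 2.
  rewrite /kx /kxx /kxy -/t -/u.
  have -> : u - t = (2 * x * a + 2 * y * b + a ^+ 2 + b ^+ 2) / eta ^+ 2.
    by rewrite /u /t /a /b; field; rewrite gt_eqF.
  have -> : x' = x + a by rewrite /a; ring.
  by field; rewrite gt_eqF.
rewrite normrM [`|_^-1|]ger0_norm ?invr_ge0 ?(ltW e2)//.
rewrite [leRHS]mulrAC ler_pM2r ?invr_gt0//.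
have s1 : `|u - t| <= E * (`|a| + `|b|).
  have -> : u - t = ((x + x') * a + (y + y') * b) / eta ^+ 2.
    by rewrite /u /t /a /b; field; rewrite gt_eqF.
  rewrite normrM [`|_^-1|]ger0_norm ?invr_ge0 ?(ltW e2)//.
  rewrite /E mulrAC ler_pM2r ?invr_gt0//.
  apply: le_trans (ler_normD _ _) _; rewrite !normrM mulrDr.
  by apply: lerD; apply: ler_wpM2r => //; apply: le_trans (ler_normD _ _) _; lra.
have ab4 : `|a| + `|b| <= 4 * B.
  have := ler_normB x' x; have := ler_normB y' y; rewrite -/a -/b; lra.
have g2 := gam_taylor t0 u0.
have g1 : `|gam u - gam t| <= E * (1 + 4 * B * E) * (`|a| + `|b|).
  have -> : gam u - gam t = (gam u - gam t - dgam t * (u - t)) + dgam t * (u - t) by ring.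
  apply: le_trans (ler_normD _ _) _; rewrite normrM.
  have d1 : `|dgam t| * `|u - t| <= `|u - t| by rewrite ler_piMl ?dgam_norm.
  rewrite -[(u - t) ^+ 2]real_normK ?num_real// in g2.
  have : `|u - t| ^+ 2 <= (E * (`|a| + `|b|)) * (4 * B * E).
    rewrite expr2; apply: ler_pM => //; apply: le_trans s1 _.
    by rewrite [4 * B * E]mulrC ler_pM2l.
  lra.
have q1 : `|a| * (`|a| + `|b|) <= 2 * (a ^+ 2 + b ^+ 2).
  rewrite -[a ^+ 2]real_normK ?num_real// -[b ^+ 2]real_normK ?num_real//.
  have := sqr_ge0 (`|a| - `|b|); rewrite !expr2; nra.
have q2 : (`|a| + `|b|) ^+ 2 <= 2 * (a ^+ 2 + b ^+ 2).
  rewrite -[a ^+ 2]real_normK ?num_real// -[b ^+ 2]real_normK ?num_real//.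
  have := sqr_ge0 (`|a| - `|b|); rewrite !expr2; nra.
have r1 : `|a * (gam u - gam t)| <= 2 * E * (1 + 4 * B * E) * (a ^+ 2 + b ^+ 2).
  rewrite normrM; apply: le_trans (ler_wpM2l (normr_ge0 a) g1) _.
  have c0 : 0 <= E * (1 + 4 * B * E) by nra.
  have := ler_wpM2l c0 q1; lra.
have r2 : `|x * (gam u - gam t - dgam t * (u - t))| <= 2 * B * E ^+ 2 * (a ^+ 2 + b ^+ 2).
  rewrite normrM; apply: (@le_trans _ _ (B * (E * (`|a| + `|b|)) ^+ 2)).
    apply: ler_pM => //; apply: le_trans g2 _.
    by rewrite -[(u - t) ^+ 2]real_normK ?num_real// ler_pXn2r ?nnegrE// (le_trans _ s1).
  rewrite exprMn mulrA; have c0 : 0 <= B * E ^+ 2 by rewrite mulr_ge0 ?sqr_ge0 ?ltW.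
  have := ler_wpM2l c0 q2; lra.
have r3 : `|x * dgam t * ((a ^+ 2 + b ^+ 2) / eta ^+ 2)| <= B / eta ^+ 2 * (a ^+ 2 + b ^+ 2).
  have v0 : 0 <= (a ^+ 2 + b ^+ 2) / eta ^+ 2 by rewrite divr_ge0 ?addr_ge0 ?sqr_ge0 ?ltW.
  rewrite normrM [X in _ * X]ger0_norm// [leRHS]mulrAC -[leRHS]mulrA ler_wpM2r// normrM.
  by rewrite -[leRHS]mulr1; apply: ler_pM => //; exact: dgam_norm.
apply: le_trans (ler_normD _ _) _.
have := ler_normD (a * (gam u - gam t)) (x * (gam u - gam t - dgam t * (u - t))).
move: r1 r2 r3; move: (`|a * _|) (`|x * (_ - _)|) (`|x * _ * _|) (`|_ + _|) => n1 n2 n3 n4.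
lra.
Qed.

(** Outside the disc the kernel is the gradient of a harmonic function, so the divergence vanishes
    there; inside it equals [4 (1 - t) / eta^2]. *)
Lemma kxx_rho (R : realType) (eta x y : R) : 0 < eta ->
  kxx eta x y + kxx eta y x = rho eta x y.
Proof.
move=> e0; rewrite /kxx /rho [y ^+ 2 + x ^+ 2]addrC.
set t := (x ^+ 2 + y ^+ 2) / eta ^+ 2.
have -> : (gam t + 2 * x ^+ 2 / eta ^+ 2 * dgam t) / eta ^+ 2 +
   (gam t + 2 * y ^+ 2 / eta ^+ 2 * dgam t) / eta ^+ 2 =
   (2 * gam t + 2 * t * dgam t) / eta ^+ 2.
  by rewrite /t; field; rewrite gt_eqF.
rewrite /gam /dgam; case: (leP t 1) => t1.
  by rewrite max_l ?subr_ge0//; field; rewrite gt_eqF.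
rewrite max_r ?mulr0; last by rewrite subr_le0 ltW.
have t0 : t != 0 by rewrite gt_eqF// (lt_trans ltr01).
have -> : 2 / t + 2 * t * - t ^- 2 = 0 by field.
by rewrite mul0r.
Qed.

(** The Euclidean norm of the vector with components [kx eta x y] and [kx eta y x]. *)
Definition knorm (R : realType) (eta x y : R) : R :=
  enorm (x, y) * gam ((x ^+ 2 + y ^+ 2) / eta ^+ 2) / eta ^+ 2.

Lemma cauchy_schwarz2 (R : realType) (x y a b : R) :
  `|x * a + y * b| <= enorm (x, y) * enorm (a, b).
Proof.
rewrite /enorm /= -sqrtrM ?addr_ge0 ?sqr_ge0// -sqrtr_sqr ler_wsqrtr//.
have := sqr_ge0 (x * b - y * a); rewrite !expr2; lra.
Qed.

Lemma kx_bound (R : realType) (eta x y a b : R) : 0 < eta ->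
  `|kx eta x y * a + kx eta y x * b| <= knorm eta x y * enorm (a, b).
Proof.
move=> e0; rewrite /kx /knorm [y ^+ 2 + x ^+ 2]addrC; set t := (x ^+ 2 + y ^+ 2) / eta ^+ 2.
have -> : x * gam t / eta ^+ 2 * a + y * gam t / eta ^+ 2 * b =
  (x * a + y * b) * (gam t / eta ^+ 2) by ring.
have c0 : 0 <= gam t / eta ^+ 2 by rewrite divr_ge0 ?gam_ge0 ?sqr_ge0.
rewrite normrM (ger0_norm c0).
have := ler_wpM2r c0 (cauchy_schwarz2 x y a b); lra.
Qed.

Lemma enorm_ge0 (R : realType) (p : R * R) : 0 <= enorm p.
Proof. exact: sqrtr_ge0. Qed.

Lemma knorm_ge0 (R : realType) (eta x y : R) : 0 <= knorm eta x y.
Proof. by rewrite /knorm divr_ge0 ?sqr_ge0// mulr_ge0 ?gam_ge0 ?enorm_ge0. Qed.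

(** With [t = |z|^2 / eta^2] the norm is [t * gam t / |z|], and [t (2 - t) <= 1] inside the disc. *)
Lemma knorm_le_invr (R : realType) (eta x y r : R) : 0 < eta -> 0 < r ->
  r <= enorm (x, y) -> knorm eta x y <= r^-1.
Proof.
move=> e0 r0 rn; rewrite /knorm.
have n0 : 0 < enorm (x, y) by exact: lt_le_trans rn.
have -> : x ^+ 2 + y ^+ 2 = enorm (x, y) ^+ 2.
  by rewrite /enorm /= sqr_sqrtr// addr_ge0 ?sqr_ge0.
move: (enorm (x, y)) rn n0 => n rn n0; apply: (@le_trans _ _ n^-1); last first.
  by rewrite lef_pV2 ?posrE.
set t := n ^+ 2 / eta ^+ 2.
have -> : n * gam t / eta ^+ 2 = n^-1 * (t * gam t).
  by rewrite /t; field; rewrite !gt_eqF.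
rewrite ler_piMr ?invr_ge0 ?(ltW n0)// /gam; case: (leP t 1) => t1.
  by have := sqr_ge0 (1 - t); rewrite expr2; lra.
by rewrite mulfV// gt_eqF// (lt_trans ltr01).
Qed.

Lemma knorm_le (R : realType) (eta x y : R) : 0 < eta -> knorm eta x y <= 2 / eta.
Proof.
move=> e0; have [e1|e1] := leP eta (enorm (x, y)).
  apply: le_trans (knorm_le_invr e0 e0 e1) _.
  by rewrite ler_peMl ?invr_ge0 ?(ltW e0)// ler1n.
rewrite /knorm.
have g2 : gam ((x ^+ 2 + y ^+ 2) / eta ^+ 2) <= 2.
  rewrite /gam; case: (leP _ 1) => t1.
    by rewrite gerBl divr_ge0 ?addr_ge0 ?sqr_ge0.
  by apply: (@le_trans _ _ 1); rewrite ?ler1n// invf_le1 ?(ltW t1)// (lt_trans ltr01).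
have -> : 2 / eta = eta * 2 / eta ^+ 2 by field; rewrite gt_eqF.
rewrite ler_pM2r ?invr_gt0 ?exprn_gt0//.
by apply: ler_pM; rewrite ?enorm_ge0 ?gam_ge0// ltW.
Qed.

Lemma norm_le_enorm (R : realType) (x y : R) : `|x| <= enorm (x, y) /\ `|y| <= enorm (x, y).
Proof. by rewrite -!sqrtr_sqr /enorm; split; apply: ler_wsqrtr; rewrite /= ?lerDl ?lerDr sqr_ge0. Qed.

(** * Riemann sums of the kernel over a finite square grid *)

Definition grid (K : nat) : seq (int * int) :=
  [seq (i%:Z - K%:Z, j%:Z - K%:Z) | i <- iota 0 K.*2.+1, j <- iota 0 K.*2.+1].

Lemma mem_grid (K : nat) (c : int * int) :
  (c \in grid K) = (`|c.1| <= K)%N && (`|c.2| <= K)%N.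
Proof.
apply/allpairsP/andP => [[[i j] [+ + ->]]|[c1 c2]].
  by rewrite !mem_iota /= => i1 j1; split; lia.
exists (`|(c.1 + K%:Z)%R|%N, `|(c.2 + K%:Z)%R|%N); rewrite !mem_iota /=.
by case: c c1 c2 => a b /= c1 c2; split; [lia|lia|congr pair; lia].
Qed.

Lemma grid_uniq (K : nat) : uniq (grid K).
Proof.
apply: allpairs_uniq; rewrite ?iota_uniq// => -[i j] [i' j'] _ _ /= [].
by move=> ? ?; congr pair; lia.
Qed.

Lemma size_grid (K : nat) : size (grid K) = (K.*2.+1 ^ 2)%N.
Proof. by rewrite size_allpairs size_iota expnS expn1. Qed.

Lemma sum_grid (R : realType) (K : nat) (f : int -> int -> R) :
  \sum_(c <- grid K) f c.1 c.2 =
  \sum_(0 <= i < K.*2.+1) \sum_(0 <= j < K.*2.+1) f (i%:Z - K%:Z) (j%:Z - K%:Z).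
Proof. by rewrite /grid big_allpairs_dep /index_iota subn0. Qed.

Lemma sum_grid_const (R : realType) (K : nat) (v : R) :
  \sum_(c <- grid K) v = K.*2.+1%:R ^+ 2 * v.
Proof.
by rewrite big_const_seq count_predT iter_addr_0 size_grid -[in RHS]natrX mulr_natl.
Qed.

Lemma sum_subseq_le (R : realType) (T : eqType) (s s' : seq T) (f : T -> R) :
  uniq s -> uniq s' -> {subset s' <= s} -> (forall x, 0 <= f x) ->
  \sum_(x <- s') f x <= \sum_(x <- s) f x.
Proof.
move=> us us' ss f0.
have p : perm_eq s' [seq x <- s | x \in s'].
  apply: uniq_perm => //; first by rewrite filter_uniq.
  by move=> x; rewrite mem_filter; case: (boolP (x \in s')) => // /ss ->.
rewrite (perm_big _ p)/= big_filter [leRHS](bigID (mem s'))/= lerDl.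
by apply: sumr_ge0.
Qed.

(** A Riemann sum for the integral of [rho], which is [2 pi]. It normalizes the smoothed field; for
    this a lower bound and near constancy in [(x, y)] are enough. *)
Definition rho_sum (R : realType) (eta h : R) (K : nat) (x y : R) : R :=
  \sum_(c <- grid K) h ^+ 2 * rho eta (x - c.1%:~R * h) (y - c.2%:~R * h).

Lemma rhoC (R : realType) (eta x y : R) : rho eta x y = rho eta y x.
Proof. by rewrite /rho [y ^+ 2 + _]addrC. Qed.

Lemma rho_ge0 (R : realType) (eta x y : R) : 0 <= rho eta x y.
Proof. by rewrite /rho mulr_ge0// ?divr_ge0 ?sqr_ge0// le_max lexx orbT. Qed.

Lemma rho_eq0 (R : realType) (eta x y : R) : 0 < eta -> eta <= `|x| -> rho eta x y = 0.
Proof.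
move=> e0 ex; rewrite /rho max_r ?mulr0// subr_le0 ler_pdivlMr ?exprn_gt0// mul1r.
rewrite -[x ^+ 2]real_normK ?num_real//.
apply: (@le_trans _ _ (`|x| ^+ 2)); last by rewrite lerDl sqr_ge0.
by rewrite ler_pXn2r ?nnegrE// ltW.
Qed.

Lemma rho_sumC (R : realType) (eta h x y : R) (K : nat) :
  rho_sum eta h K x y = rho_sum eta h K y x.
Proof.
rewrite /rho_sum (sum_grid K (fun a b => h ^+ 2 * rho eta (x - a%:~R * h) (y - b%:~R * h))).
rewrite (sum_grid K (fun a b => h ^+ 2 * rho eta (y - a%:~R * h) (x - b%:~R * h))).
rewrite exchange_big/=; apply: eq_bigr => i _; apply: eq_bigr => j _.
by rewrite rhoC.
Qed.

(** A shift by one lattice step makes the sum over columns telescope; the two boundary columns left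
    over are at distance at least [eta] from the point, where [rho] vanishes. *)
Lemma rho_sum_shift (R : realType) (eta h x y : R) (K : nat) : 0 < eta -> 0 < h ->
  eta - h * K%:R <= x -> x + h + eta <= h * K%:R ->
  rho_sum eta h K (x + h) y = rho_sum eta h K x y.
Proof.
move=> e0 h0 x1 x2; apply/eqP; rewrite -subr_eq0; apply/eqP.
rewrite /rho_sum (sum_grid K (fun a b => h ^+ 2 * rho eta (x + h - a%:~R * h) (y - b%:~R * h))).
rewrite (sum_grid K (fun a b => h ^+ 2 * rho eta (x - a%:~R * h) (y - b%:~R * h))).
pose F (i : nat) := \sum_(0 <= j < K.*2.+1)
  h ^+ 2 * rho eta (x - (i%:R - K%:R - 1) * h) (y - (j%:Z - K%:Z)%:~R * h).
rewrite -sumrB -[RHS](_ : F 0%N - F K.*2.+1 = 0).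
  rewrite -(opprB (F K.*2.+1)) -telescope_sumr// -sumrN.
  apply: eq_bigr => i _; rewrite opprB /F; congr (_ - _); apply: eq_bigr => j _.
    by rewrite !intrB; congr (_ * rho _ _ _); ring.
  by rewrite !intrB; congr (_ * rho _ _ _); rewrite -natr1; ring.
rewrite /F !big1 ?subr0// => j _; rewrite rho_eq0 ?mulr0//.
  have -> : x - (K.*2.+1%:R - K%:R - 1) * h = - (h * K%:R - x).
    by rewrite -natr1 -muln2 natrM; ring.
  by rewrite normrN (le_trans _ (ler_norm _))//; lra.
have -> : x - (0%:R - K%:R - 1) * h = h * K%:R + x + h by ring.
by rewrite (le_trans _ (ler_norm _))//; lra.
Qed.

Lemma rho_sum_reduce (R : realType) (eta h x y : R) (K : nat) : 0 < eta -> 0 < h ->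
  `|x| + h + eta <= h * K%:R ->
  exists2 x', 0 <= x' < h & rho_sum eta h K x y = rho_sum eta h K x' y.
Proof.
move=> e0 h0 xK.
have H n : forall z, 0 <= z < h -> z + n%:R * h + h + eta <= h * K%:R ->
    rho_sum eta h K (z + n%:R * h) y = rho_sum eta h K z y.
  move=> z /andP[z0 zh]; elim: n => [|n IH] zn; first by rewrite mul0r addr0.
  rewrite -natr1 mulrDl mul1r addrA in zn *.
  have nh : 0 <= n%:R * h by rewrite mulr_ge0// ltW.
  rewrite rho_sum_shift//; [apply: IH|..]; lra.
have H' n : forall z, 0 <= z < h -> n%:R * h - z + h + eta <= h * K%:R ->
    rho_sum eta h K (z - n%:R * h) y = rho_sum eta h K z y.
  move=> z /andP[z0 zh]; elim: n => [|n IH] zn; first by rewrite mul0r subr0.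
  have nh : 0 <= n%:R * h by rewrite mulr_ge0// ltW.
  rewrite -natr1 mulrDl mul1r in zn *.
  rewrite -rho_sum_shift//; [|lra..].
  have -> : z - (n%:R * h + h) + h = z - n%:R * h by ring.
  by apply: IH; lra.
pose m := Num.floor (x / h); exists (x - m%:~R * h).
  have /andP[m1 m2] := floor_itv (x / h); rewrite -/m in m1 m2.
  rewrite intrD ltr_pdivrMr// mulrDl in m2; rewrite ler_pdivlMr// in m1.
  by apply/andP; split; lra.
have /andP[m1 m2] := floor_itv (x / h); rewrite -/m in m1 m2.
rewrite intrD ltr_pdivrMr// mulrDl mul1r in m2; rewrite ler_pdivlMr// in m1.
have zz : 0 <= x - m%:~R * h < h by apply/andP; split; lra.
have := ler_norm x; have := ler_norm (- x); rewrite normrN => x1 x2.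
have [m0|m0] := leP 0 m.
  have mE : m%:~R = `|m|%N%:R :> R by rewrite -[RHS]/(`|m|%N%:~R) gez0_abs.
  have := H `|m|%N (x - m%:~R * h) zz; rewrite -mE subrK; apply; lra.
have mE : m%:~R = - `|m|%N%:R :> R.
  by rewrite -[X in _ = - X]/(`|m|%N%:~R) ltz0_abs// rmorphN opprK.
have := H' `|m|%N (x - m%:~R * h) zz; rewrite mE mulNr opprK addrK; apply; lra.
Qed.

Lemma rho_lip (R : realType) (eta B x y x' y' : R) : 0 < eta ->
  `|x| <= B -> `|y| <= B -> `|x'| <= B -> `|y'| <= B ->
  `|rho eta x y - rho eta x' y'| <= 8 * B / eta ^+ 4 * (`|x - x'| + `|y - y'|).
Proof.
move=> e0 xB yB xB' yB'; rewrite /rho -mulrBr normrM ger0_norm ?divr_ge0 ?sqr_ge0//.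
set t := (x ^+ 2 + y ^+ 2) / eta ^+ 2; set u := (x' ^+ 2 + y' ^+ 2) / eta ^+ 2.
have e2 : 0 < eta ^+ 2 by rewrite exprn_gt0.
have H : `|Num.max (1 - t) 0 - Num.max (1 - u) 0| <= `|t - u|.
  have [t1|t1] := leP (1 - t) 0; have [u1|u1] := leP (1 - u) 0.
  - by rewrite subrr normr0.
  - by rewrite sub0r normrN !ger0_norm; lra.
  - by rewrite subr0 ger0_norm ?(ltW t1)// distrC ger0_norm; lra.
  - have -> : 1 - t - (1 - u) = u - t by ring.
    by rewrite distrC.
apply: (@le_trans _ _ (4 / eta ^+ 2 * `|t - u|)); first by rewrite ler_wpM2l// divr_ge0 ?sqr_ge0.
have -> : t - u = ((x + x') * (x - x') + (y + y') * (y - y')) / eta ^+ 2.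
  by rewrite /t /u; field; rewrite gt_eqF.
rewrite normrM [`|_^-1|]ger0_norm ?invr_ge0 ?(ltW e2)//.
have -> : 8 * B / eta ^+ 4 * (`|x - x'| + `|y - y'|) =
  4 / eta ^+ 2 * ((2 * B * `|x - x'| + 2 * B * `|y - y'|) / eta ^+ 2).
  by field; rewrite gt_eqF.
rewrite ler_wpM2l ?divr_ge0 ?sqr_ge0// ler_pM2r ?invr_gt0//.
apply: le_trans (ler_normD _ _) _; rewrite !normrM.
by apply: lerD; apply: ler_wpM2r => //; apply: le_trans (ler_normD _ _) _; lra.
Qed.

Lemma rho_sum_lip (R : realType) (eta h x y : R) (K : nat) : 0 < eta -> 0 < h ->
  0 <= x < h -> 0 <= y < h ->
  `|rho_sum eta h K x y - rho_sum eta h K 0 0| <=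
    (h * K.*2.+1%:R) ^+ 2 * (8 * (h * K.+1%:R) / eta ^+ 4 * (2 * h)).
Proof.
move=> e0 h0 /andP[x0 xh] /andP[y0 yh]; rewrite /rho_sum -sumrB.
apply: le_trans (ler_norm_sum _ _ _) _.
have -> : (h * K.*2.+1%:R) ^+ 2 * (8 * (h * K.+1%:R) / eta ^+ 4 * (2 * h)) =
    \sum_(c <- grid K) h ^+ 2 * (8 * (h * K.+1%:R) / eta ^+ 4 * (2 * h)).
  by rewrite sum_grid_const; ring.
rewrite !big_seq; apply: ler_sum => c; rewrite mem_grid => /andP[c1 c2].
rewrite -mulrBr normrM ger0_norm ?sqr_ge0// ler_wpM2l ?sqr_ge0//.
have aux (z : R) (k : int) : 0 <= z < h -> (`|k| <= K)%N -> `|z - k%:~R * h| <= h * K.+1%:R.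
  move=> /andP[z0 zh] kK; have : `|k%:~R| <= K%:R :> R.
    by rewrite -intr_norm -[leRHS]/(K%:~R) ler_int; lia.
  move=> kR; apply: le_trans (ler_normB _ _) _; rewrite normrM (gtr0_norm h0) (ger0_norm z0).
  by rewrite -natr1 mulrDr mulr1 addrC lerD ?(ltW zh)// mulrC ler_pM2l.
have z0 : 0 <= (0 : R) < h by rewrite lexx.
apply: le_trans (rho_lip e0 (B := h * K.+1%:R) _ _ _ _) _; rewrite ?aux ?x0 ?y0//.
rewrite ler_wpM2l//.
  by rewrite divr_ge0 ?exprn_ge0 ?mulr_ge0 ?(ltW h0) ?(ltW e0).
have -> : x - c.1%:~R * h - (0 - c.1%:~R * h) = x by ring.
have -> : y - c.2%:~R * h - (0 - c.2%:~R * h) = y by ring.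
rewrite !ger0_norm//; lra.
Qed.

(** With [q = (h / eta)^2] one has [q n^2 = 1/16]; the terms are at least [2 q] on the grid of
    half-width [2 n] and at least [7 q / 2] on that of half-width [n]. The total is at least
    [16 n^2 * 2 q + 4 n^2 * 3 q / 2], which is 19/8. *)
Lemma rho_sum_ge (R : realType) (eta h : R) (K n : nat) : 0 < h -> (0 < n)%N ->
  eta = h * (4 * n)%N%:R -> (2 * n <= K)%N -> 19 / 8 <= rho_sum eta h K 0 0.
Proof.
move=> h0 n0 eh nK.
have N0 : 0 < n%:R :> R by rewrite ltr0n.
have e0 : 0 < eta by rewrite eh mulr_gt0// ltr0n muln_gt0.
pose F (c : int * int) := h ^+ 2 * rho eta (0 - c.1%:~R * h) (0 - c.2%:~R * h).
have FE c : F c = 4 * (h / eta) ^+ 2 * Num.max (1 - (c.1%:~R ^+ 2 + c.2%:~R ^+ 2) * (h / eta) ^+ 2) 0.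
  rewrite /F /rho; have -> : ((0 - c.1%:~R * h) ^+ 2 + (0 - c.2%:~R * h) ^+ 2) / eta ^+ 2 =
    (c.1%:~R ^+ 2 + c.2%:~R ^+ 2) * (h / eta) ^+ 2 by field; rewrite gt_eqF.
  by rewrite [RHS]mulrC [LHS]mulrA [LHS]mulrC; congr (_ * _); field; rewrite gt_eqF.
have he : h / eta = (4 * n%:R)^-1.
  by rewrite eh natrM; field; rewrite !gt_eqF.
have F0 c : 0 <= F c by rewrite /F mulr_ge0 ?sqr_ge0 ?rho_ge0.
pose q := (h / eta) ^+ 2.
have q0 : 0 <= q by rewrite sqr_ge0.
have qn : q * n%:R ^+ 2 = 16^-1.
  by rewrite /q he; field; rewrite gt_eqF.
have FB c (k : nat) : (`|c.1| <= k)%N -> (`|c.2| <= k)%N ->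
    4 * q * (1 - 2 * k%:R ^+ 2 * q) <= F c.
  move=> c1 c2; rewrite FE -/q; apply: ler_wpM2l; first by rewrite mulr_ge0.
  rewrite le_max; apply/orP; left; rewrite lerD2l lerN2 ler_wpM2r//.
  have aux (m : int) : (`|m| <= k)%N -> m%:~R ^+ 2 <= k%:R ^+ 2 :> R.
    move=> mk; rewrite -[m%:~R ^+ 2]real_normK ?num_real// ler_pXn2r ?nnegrE//.
    by rewrite -intr_norm -[leRHS]/(k%:~R) ler_int; lia.
  have := aux _ c1; have := aux _ c2; lra.
rewrite /rho_sum -/(F _).
apply: (@le_trans _ _ (\sum_(c <- grid (2 * n)) F c)); last first.
  apply: sum_subseq_le; rewrite ?grid_uniq// => c; rewrite !mem_grid => /andP[c1 c2].
  by rewrite (leq_trans c1)// (leq_trans c2).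
have cst (k : nat) (v : R) : \sum_(c <- grid k) v = (2 * k%:R + 1) ^+ 2 * v.
  by rewrite sum_grid_const -natr1 -muln2 natrM [k%:R * _]mulrC.
pose G c := if c \in grid (2 * n) then F c - 2 * q else 0.
have -> : \sum_(c <- grid (2 * n)) F c = (2 * (2 * n)%N%:R + 1) ^+ 2 * (2 * q) + \sum_(c <- grid (2 * n)) G c.
  rewrite -cst -big_split/= !big_seq; apply: eq_bigr => c cg.
  by rewrite /G cg; ring.
have Ggrid (c : int * int) : c \in grid (2 * n) -> 2 * q <= F c.
  rewrite mem_grid => /andP[c1 c2]; apply: le_trans (FB _ _ c1 c2); rewrite natrM.
  have -> : 4 * q * (1 - 2 * (2%:R * n%:R) ^+ 2 * q) = 4 * q * (1 - 8 * (q * n%:R ^+ 2)) by ring.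
  by rewrite qn; lra.
have : \sum_(c <- grid n) G c <= \sum_(c <- grid (2 * n)) G c.
  apply: sum_subseq_le; rewrite ?grid_uniq//.
    by move=> c; rewrite !mem_grid => /andP[c1 c2]; apply/andP; split; lia.
  by move=> c; rewrite /G; case: ifPn => // /Ggrid; rewrite subr_ge0.
have : (2 * n%:R + 1) ^+ 2 * (3 / 2 * q) <= \sum_(c <- grid n) G c.
  rewrite -cst !big_seq; apply: ler_sum => c; rewrite mem_grid => /andP[c1 c2].
  rewrite /G ifT; last by rewrite mem_grid; apply/andP; split; lia.
  have := FB _ _ c1 c2.
  have -> : 4 * q * (1 - 2 * n%:R ^+ 2 * q) = 4 * q * (1 - 2 * (q * n%:R ^+ 2)) by ring.
  by rewrite qn; lra.
have E3 : (4 * n%:R) ^+ 2 * (2 * q) <= (2 * (2 * n)%N%:R + 1) ^+ 2 * (2 * q).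
  apply: ler_wpM2r; first by lra.
  by rewrite natrM ler_pXn2r ?nnegrE//; lra.
lra.
Qed.

Lemma c11_swap (R : realType) (f fx fy : R -> R -> R) (B : R) : c11 f fx fy B ->
  c11 (fun x y => f y x) (fun x y => fy y x) (fun x y => fx y x) B.
Proof.
move=> [C C0 H]; exists C => // x y x' y' xB yB xB' yB'.
by have := H _ _ _ _ yB xB yB' xB'; rewrite [fx _ _ * _ + _]addrC [_ ^+ 2 + _]addrC.
Qed.

Lemma c11_shift (R : realType) (f fx fy : R -> R -> R) (B B' a b : R) :
  c11 f fx fy B' -> `|a| + B <= B' -> `|b| + B <= B' ->
  c11 (fun x y => f (x - a) (y - b)) (fun x y => fx (x - a) (y - b))
      (fun x y => fy (x - a) (y - b)) B.
Proof.
move=> [C C0 H] aB bB; exists C => // x y x' y' xB yB xB' yB'.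
have aux (u v : R) : `|u| + B <= B' -> `|v| <= B -> `|v - u| <= B'.
  by move=> uB vB; apply: le_trans (ler_normB _ _) _; lra.
have := H _ _ _ _ (aux _ _ aB xB) (aux _ _ bB yB) (aux _ _ aB xB') (aux _ _ bB yB').
have E (u v w : R) : u - w - (v - w) = u - v by ring.
by rewrite !E.
Qed.

Lemma c11_scale (R : realType) (f fx fy : R -> R -> R) (B k : R) : c11 f fx fy B ->
  c11 (fun x y => k * f x y) (fun x y => k * fx x y) (fun x y => k * fy x y) B.
Proof.
move=> [C C0 H]; exists (`|k| * C) => [|x y x' y' xB yB xB' yB']; first exact: mulr_ge0.
have -> : k * f x' y' - k * f x y - (k * fx x y * (x' - x) + k * fy x y * (y' - y)) =
  k * (f x' y' - f x y - (fx x y * (x' - x) + fy x y * (y' - y))) by ring.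
by rewrite normrM -mulrA ler_wpM2l// H.
Qed.

Lemma c11_sum (R : realType) (T : eqType) (s : seq T) (f fx fy : T -> R -> R -> R) (B : R) :
  (forall t, t \in s -> c11 (f t) (fx t) (fy t) B) ->
  c11 (fun x y => \sum_(t <- s) f t x y) (fun x y => \sum_(t <- s) fx t x y)
      (fun x y => \sum_(t <- s) fy t x y) B.
Proof.
elim: s => [_|t s IH H].
  exists 0 => // x y x' y' _ _ _ _; rewrite !big_nil !mul0r !subr0 addr0 subr0.
  by rewrite normr0.
have [|C C0 HC] := IH; first by move=> u us; apply: H; rewrite inE us orbT.
have [D D0 HD] := H t (mem_head _ _).
exists (D + C) => [|x y x' y' xB yB xB' yB']; first exact: addr_ge0.
rewrite !big_cons.
have := HC _ _ _ _ xB yB xB' yB'; have := HD _ _ _ _ xB yB xB' yB'.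
set u := f t x' y' - _ - _; set v := _ - _ - _ => uD vC.
have -> : f t x' y' + \sum_(j <- s) f j x' y' - (f t x y + \sum_(j <- s) f j x y) -
  ((fx t x y + \sum_(j <- s) fx j x y) * (x' - x) + (fy t x y + \sum_(j <- s) fy j x y) * (y' - y))
  = u + v by rewrite /u /v; ring.
by apply: le_trans (ler_normD _ _) _; rewrite mulrDl; exact: lerD.
Qed.

Lemma sum_invsqrt_le (R : realType) (n : nat) :
  \sum_(i < n) (Num.sqrt i.+1%:R)^-1 <= 2 * Num.sqrt n%:R :> R.
Proof.
elim: n => [|n IH]; first by rewrite big_ord0 mulr_ge0// sqrtr_ge0.
rewrite big_ord_recr/=; apply: le_trans (lerD IH (lexx _)) _.
set a := Num.sqrt n%:R; set b := Num.sqrt n.+1%:R.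
have b0 : 0 < b by rewrite sqrtr_gt0.
have ab : b ^+ 2 = a ^+ 2 + 1 by rewrite !sqr_sqrtr// natr1.
rewrite -subr_ge0; have -> : 2 * b - (2 * a + b^-1) = (b - a) ^+ 2 / b.
  have -> : 2 * b - (2 * a + b^-1) = (2 * b ^+ 2 - 2 * a * b - 1) / b by field; rewrite gt_eqF.
  by congr (_ / b); move: ab; rewrite !expr2; lra.
by rewrite divr_ge0 ?sqr_ge0// ltW.
Qed.

Lemma ex_nat_ge (R : realType) (k : nat) (x : R) :
  exists n : nat, (k <= n)%N /\ x <= n%:R.
Proof.
exists (k + (Num.truncn x).+1)%N; split; first exact: leq_addr.
by apply: ltW; apply: lt_le_trans (truncnS_gt _) _; rewrite ler_nat leq_addl.
Qed.

(** [eta] divides [2 M] and [h] divides [eta], so the grid fills the square of half-side [2 M]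
    exactly and leaves a margin [M] around the points considered. The variation of [rho_sum] is at
    most [C h] with [C] depending on [eta], so [eta] is fixed first and [n] is taken large
    afterwards. *)
Lemma grid_scale (R : realType) (M d z : R) : 0 < M -> 0 < d -> 0 < z ->
  exists eta h (K : nat), [/\ 0 < h, 8 * h <= eta, eta <= d, h * K%:R = 2 * M &
   19 / 8 <= rho_sum eta h K 0 0 /\
   forall x y, `|x| <= M -> `|y| <= M ->
     `|rho_sum eta h K x y - rho_sum eta h K 0 0| <= z].
Proof.
move=> M0 d0 z0.
have [L [L4 Ld]] := ex_nat_ge 4 (2 * M / d).
have L0 : 0 < L%:R :> R by rewrite ltr0n (leq_trans _ L4).
have [eta etaE] : exists e, e = 2 * M / L%:R by eexists.
have eta0 : 0 < eta by rewrite etaE divr_gt0// mulr_gt0.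
have etad : eta <= d by rewrite etaE ler_pdivrMr// [leRHS]mulrC -ler_pdivrMr.
have etaL : eta * L%:R = 2 * M by rewrite etaE divfK// gt_eqF.
have etaM : eta <= M / 2.
  have L4R : 4 <= L%:R :> R by rewrite (ler_nat R 4).
  have := ler_wpM2l (ltW eta0) L4R; rewrite etaL; clear -M0; lra.
have [C [C0 CE]] : exists C, 0 <= C /\ C = (6 * M) ^+ 2 * (8 * (4 * M) / eta ^+ 4 * 2).
  eexists; split; last exact: erefl.
  by rewrite !mulr_ge0 ?invr_ge0 ?exprn_ge0// ltW.
have [n [n2 nk]] := ex_nat_ge 2 (C * eta / z).
have n0 : 0 < n%:R :> R by rewrite ltr0n (leq_trans _ n2).
have nn0 : 0 < (4 * n)%N%:R :> R by rewrite natrM mulr_gt0.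
have [h hE] : exists h, h = eta / (4 * n)%N%:R by eexists.
have h0 : 0 < h by rewrite hE divr_gt0.
have eh : eta = h * (4 * n)%N%:R by rewrite hE divfK// gt_eqF.
have h8 : 8 * h <= eta.
  by rewrite eh mulrC ler_pM2l// (ler_nat R 8) (leq_mul2l 4 2).
have hK : h * (4 * n * L)%N%:R = 2 * M by rewrite natrM mulrA -eh.
set K := (4 * n * L)%N in hK.
exists eta, h, K; split=> //; split.
  apply: (@rho_sum_ge _ _ _ _ n) => //; first exact: leq_trans n2.
  by rewrite /K -mulnA leq_mul//  leq_pmulr// (leq_trans _ L4).
have Cz : C * h <= z.
  rewrite ler_pdivrMr// in nk; rewrite -(ler_pM2r nn0) -mulrA -eh natrM.
  by apply: le_trans nk _; rewrite mulrC ler_pM2l// ler_peMl ?ler1n// ltW.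
have hK1 : h * K.+1%:R <= 4 * M by rewrite -natr1 mulrDr hK; clear -h8 etaM h0; lra.
have hK2 : h * K.*2.+1%:R <= 6 * M.
  by rewrite -natr1 mulrDr -muln2 natrM mulrA hK; clear -h8 etaM h0; lra.
have hM (x : R) : `|x| <= M -> `|x| + h + eta <= h * K%:R.
  by rewrite hK; clear -h8 etaM M0; lra.
move=> x y xM yM.
have [x' x'h ->] := @rho_sum_reduce _ eta h x y K eta0 h0 (hM _ xM).
rewrite rho_sumC.
have [y' y'h ->] := @rho_sum_reduce _ eta h y x' K eta0 h0 (hM _ yM).
apply: le_trans (rho_sum_lip K eta0 h0 y'h x'h) _; apply: le_trans Cz.
have e4 : 0 < eta ^+ 4 by rewrite exprn_gt0.
have -> : C * h = (6 * M) ^+ 2 * (8 * (4 * M) / eta ^+ 4 * (2 * h)) by rewrite CE; ring.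
apply: ler_pM; rewrite ?sqr_ge0//.
- by rewrite !mulr_ge0 ?invr_ge0// ltW.
- by rewrite ler_pXn2r ?nnegrE// mulr_ge0// ltW.
- by rewrite ler_wpM2r ?mulr_ge0 ?(ltW h0)// ler_wpM2r ?invr_ge0 ?(ltW e4)// ler_wpM2l.
Qed.

Lemma grid_pt_norm (R : realType) (h M : R) (K : nat) c : 0 < h -> h * K%:R = 2 * M ->
  c \in grid K -> `|c.1%:~R * h| <= 2 * M /\ `|c.2%:~R * h| <= 2 * M.
Proof.
move=> h0 hK; rewrite mem_grid => /andP[k1 k2].
rewrite -hK !normrM (gtr0_norm h0) ![_ * h]mulrC !ler_pM2l//.
have aux (a : int) : (`|a| <= K)%N -> `|a%:~R| <= K%:R :> R.
  by move=> aK; rewrite -intr_norm -[K%:R]/(K%:~R) ler_int; lia.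
by split; exact: aux.
Qed.

Lemma grid_field_bound (R : realType) (H1 H2 : R * R -> R) (B1 M eps om eta h x y : R)
    (K : nat) :
  unif_cont H2 -> (forall p, `|H1 p| <= B1) -> (lorentz21 H2 < 1%:E)%E -> 0 < M ->
  0 < h -> 8 * h <= eta -> eta <= M -> h * K%:R = 2 * M -> 0 <= eps -> 0 <= om ->
  (om + eps * B1) * (27 * M) <= 1 / 16 ->
  (forall p q, `|p.1 - q.1| <= eta -> `|p.2 - q.2| <= eta -> `|H2 p - H2 q| <= om) ->
  \sum_(c <- grid K) `|eps * H1 (c.1%:~R * h, c.2%:~R * h) + H2 (c.1%:~R * h, c.2%:~R * h)|
     * (h ^+ 2 * knorm eta (x - c.1%:~R * h) (y - c.2%:~R * h)) <= 37 / 16.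
Proof.
move=> u2 b1 lo M0 h0 h8 etaM hK ep0 om0 oe D2.
have B10 : 0 <= B1 by apply: le_trans (b1 (0, 0)).
have eta0 : 0 < eta by clear -h0 h8; lra.
have heta : h <= eta by clear -h0 h8; lra.
pose w c := h ^+ 2 * knorm eta (x - c.1%:~R * h) (y - c.2%:~R * h).
pose q (c : int * int) : R * R := (c.1%:~R * h, c.2%:~R * h).
have w0 c : 0 <= w c by rewrite mulr_ge0 ?sqr_ge0 ?knorm_ge0.
(* A lower bound for [|H2|] on the whole cell [c], as the Lorentz estimate requires. The loss [om]
   joins [eps * H1] in an error paid with the total weight of the grid. *)
pose A c := Num.max (`|H2 (q c)| - om) 0.
have A0 c : 0 <= A c by rewrite le_max lexx orbT.
have wsum t : uniq t -> \sum_(c <- t) w c <= 9 / 4 * \sum_(i < size t) (h / Num.sqrt i.+1%:R).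
  move=> ut; apply: (@lattice_kernel_sum _ h eta x y) => //.
    move=> c; rewrite /w; have := knorm_le (x - c.1%:~R * h) (y - c.2%:~R * h) eta0.
    move=> kn; apply: le_trans (ler_wpM2l (sqr_ge0 h) kn) _.
    by rewrite mulrA [h ^+ 2 * 2]mulrC.
  move=> c r r0 rc; rewrite /w ler_wpM2l ?sqr_ge0//; apply: knorm_le_invr => //.
  have [n1 n2] := norm_le_enorm (x - c.1%:~R * h) (y - c.2%:~R * h).
  by case: rc => rc; exact: le_trans rc _.
have lor : \sum_(c <- grid K) A c * w c <= 9 / 4.
  have : ((\sum_(c <- grid K) A c * w c)%:E <= (9 / 4)%:E * lorentz21 H2)%E.
    apply: (@cell_sum_lt_lorentz21 _ H2 h (9 / 4) (grid K)) => //; first exact: grid_uniq.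
      move=> c p _ cp; rewrite ge_max normr_ge0 andbT.
      have [p1 p2 p3 p4] := in_cell cp.
      have D : `|H2 (q c) - H2 p| <= om.
        apply: D2; rewrite /q /= distrC ger0_norm ?subr_ge0// lerBlDl;
          by apply: le_trans (ltW _) _; [eassumption|rewrite lerD2l].
      rewrite lerBlDl; apply: le_trans (lerD D (lexx _)).
      by rewrite -{1}[H2 (q c)](subrK (H2 p)) ler_normD.
    by move=> t ut _; exact: wsum.
  have := @lee_wpmul2l R (9 / 4)%:E ltac:(by rewrite lee_fin ltW) _ _ (ltW lo).
  by move=> H' /le_trans/(_ H'); rewrite -EFinM lee_fin mulr1.
(* The total weight is at most [(9/4) * 2 h (2 K + 1)], and [h (2 K + 1) = 4 M + h <= 5 M]. *)
have wK : \sum_(c <- grid K) w c <= 27 * M.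
  apply: le_trans (wsum _ (grid_uniq K)) _.
  rewrite -mulr_sumr size_grid.
  have := sum_invsqrt_le R (K.*2.+1 ^ 2)%N.
  rewrite [X in Num.sqrt X]natrX sqrtr_sqr ger0_norm// => s1.
  have hh : h * K.*2.+1%:R <= 5 * M.
    have -> : h * K.*2.+1%:R = 2 * (h * K%:R) + h by rewrite -natr1 -muln2 natrM; ring.
    by rewrite hK; clear -h8 etaM M0; lra.
  have := ler_wpM2l (ltW h0) s1; rewrite mulrCA.
  move: hh; move: (h * \sum_(_ < _) _) (h * K.*2.+1%:R) => a b.
  clear -M0; lra.
have -> : 37 / 16 = 9 / 4 + 1 / 16 :> R by clear; lra.
apply: (@le_trans _ _ (\sum_(c <- grid K) (A c * w c + (om + eps * B1) * w c))).
  apply: ler_sum => c _; rewrite -/(w c) -/(q c) -mulrDl ler_wpM2r//.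
  apply: le_trans (ler_normD _ _) _; rewrite normrM (ger0_norm ep0).
  have := ler_wpM2l ep0 (b1 (q c)); have : `|H2 (q c)| - om <= A c by rewrite le_max lexx.
  clear; lra.
have oe0 : 0 <= om + eps * B1 by rewrite addr_ge0 ?mulr_ge0.
rewrite big_split/= -mulr_sumr; apply: lerD => //; apply: le_trans oe.
exact: ler_wpM2l.
Qed.

Lemma grid_field_div (R : realType) (H : R * R -> R) (Bs z z1 c0 eta h x y : R) (K : nat) :
  0 < eta -> 19 / 8 <= c0 -> z1 <= 1 -> 0 <= z -> Bs * z1 <= z ->
  (forall p, `|H p| <= Bs) ->
  (forall p q, `|p.1 - q.1| <= eta -> `|p.2 - q.2| <= eta -> `|H q - H p| <= z / 4) ->
  `|rho_sum eta h K x y - c0| <= z1 ->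
  `|\sum_(c <- grid K) H (c.1%:~R * h, c.2%:~R * h) / c0
     * (h ^+ 2 * rho eta (x - c.1%:~R * h) (y - c.2%:~R * h)) - H (x, y)| <= z.
Proof.
move=> eta0 c0g z11 z0 Bz Hb Ho SE.
have c00 : 0 < c0 by clear -c0g; lra.
pose q (c : int * int) : R * R := (c.1%:~R * h, c.2%:~R * h).
set S := rho_sum eta h K x y in SE.
(* The error is the oscillation of [H] at distance [eta], beyond which [rho] vanishes, plus the
   defect of [S] from the normalizing constant [c0]. *)
have -> : \sum_(c <- grid K) H (c.1%:~R * h, c.2%:~R * h) / c0 * (h ^+ 2 * rho eta (x - c.1%:~R * h) (y - c.2%:~R * h)) - H (x, y) =
    \sum_(c <- grid K) (H (q c) - H (x, y)) / c0 * (h ^+ 2 * rho eta (x - c.1%:~R * h) (y - c.2%:~R * h))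
    + H (x, y) * (S - c0) / c0.
  have -> : H (x, y) * (S - c0) / c0 = \sum_(c <- grid K) H (x, y) / c0 * (h ^+ 2 * rho eta (x - c.1%:~R * h) (y - c.2%:~R * h)) - H (x, y).
    by rewrite -mulr_sumr -/(rho_sum eta h K x y) -/S; field; rewrite gt_eqF.
  rewrite addrA -big_split/=; congr (_ - _); apply: eq_bigr => c _.
  by rewrite /q; ring.
apply: le_trans (ler_normD _ _) _.
have -> : z = z / 2 + z / 2 by clear; lra.
have Sc : S <= 2 * c0 by have := ler_norm (S - c0); clear -SE z11 c0g; lra.
apply: lerD.
  apply: le_trans (ler_norm_sum _ _ _) _.
  apply: (@le_trans _ _ (z / 4 / c0 * S)).
    rewrite mulr_sumr; apply: ler_sum => c _.
    have r0 := rho_ge0 eta (x - c.1%:~R * h) (y - c.2%:~R * h).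
    rewrite normrM [X in _ * X]ger0_norm; last by rewrite mulr_ge0 ?sqr_ge0.
    rewrite normrM normfV (gtr0_norm c00).
    have [p1|p1] := leP eta `|x - c.1%:~R * h|; first by rewrite rho_eq0// !mulr0.
    have [p2|p2] := leP eta `|y - c.2%:~R * h|; first by rewrite rhoC rho_eq0// !mulr0.
    apply: ler_wpM2r; first by rewrite mulr_ge0 ?sqr_ge0.
    apply: ler_wpM2r; first by rewrite invr_ge0 ltW.
    by apply: Ho; rewrite /q /= ltW.
  rewrite mulrAC ler_pdivrMr//; have := ler_wpM2l z0 Sc; clear; lra.
rewrite !normrM normfV (gtr0_norm c00) ler_pdivrMr//.
apply: (@le_trans _ _ z).
  by apply: le_trans Bz; apply: ler_pM.
have := ler_wpM2l z0 c0g; clear -z0; lra.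
Qed.

(* Up to normalization the smoothed lattice kernel has mass at least 19/8 while its
   rearranged partial sums are at most 9/4 times those of the Lorentz weight;
   (9/4)/(19/8) = 36/38, and the remaining 1/38 pays for [eps * H1]. *)
Definition has_potential (R : realType) (H : R * R -> R) (B : R) :=
  forall zeta : R, 0 < zeta -> exists Q1 Q1x Q1y Q2 Q2x Q2y : R -> R -> R,
    [/\ c11 Q1 Q1x Q1y B, c11 Q2 Q2x Q2y B,
      forall x y a b, `|Q1 x y * a + Q2 x y * b| <= 37 / 38 * enorm (a, b) &
      forall x y, `|x| <= B -> `|y| <= B -> `|Q1x x y + Q2y x y - H (x, y)| <= zeta].

(** The threshold [eps1] depends on [B1] and [M] only and is fixed before [zeta]: refining the
    lattice preserves the bound 37/38 on the field. *)
Lemma field_approx (R : realType) (H1 H2 : R * R -> R) (B1 B2 M : R) :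
  unif_cont H1 -> unif_cont H2 -> (forall p, `|H1 p| <= B1) ->
  (forall p, `|H2 p| <= B2) -> (lorentz21 H2 < 1%:E)%E -> 0 < M ->
  exists2 eps1, 0 < eps1 & forall eps, 0 <= eps <= eps1 ->
    has_potential (fun p => eps * H1 p + H2 p) M.
Proof.
move=> u1 u2 b1 b2 lo M0.
have B10 : 0 <= B1 by apply: le_trans (b1 (0, 0)).
have B20 : 0 <= B2 by apply: le_trans (b2 (0, 0)).
(* [27 M] bounds the total kernel weight; [om] and [eps * B1] both stay below [k], so together they
   cost at most 2/32 = 1/16. *)
have [k [k0 kE]] : exists k, 0 < k /\ k * (27 * M) = 1 / 32.
  exists (1 / 32 / (27 * M)); split; last by rewrite divfK// gt_eqF// mulr_gt0.
  by rewrite divr_gt0// mulr_gt0.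
have B11 : 0 < B1 + 1 by rewrite ltr_wpDl.
have [eps1 [eps10 eps1E]] : exists e, 0 < e /\ e * (B1 + 1) = k.
  by exists (k / (B1 + 1)); rewrite divr_gt0// divfK// gt_eqF.
exists eps1 => // eps /andP[ep0 ep1] zeta z0.
have [om [om0 om1 om2]] : exists om, [/\ 0 < om, om <= k & om <= zeta / 8].
  exists (Num.min k (zeta / 8)); rewrite lt_min k0 divr_gt0//; split => //.
    by rewrite ge_min lexx.
  by rewrite ge_min lexx orbT.
have [e1 [e10 e1E]] : exists e, 0 < e /\ eps1 * e = zeta / 8.
  by exists (zeta / 8 / eps1); rewrite !divr_gt0// mulrC divfK// gt_eqF.
have [d1 d10 D1] := u1 _ e10.
have [d2 d20 D2] := u2 _ om0.
have [d [d0 dd1 dd2 dM]] : exists d, [/\ 0 < d, d <= d1, d <= d2 & d <= M].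
  exists (Num.min (Num.min d1 d2) M); rewrite !lt_min d10 d20 M0; split=> //.
  - by rewrite !ge_min lexx.
  - by rewrite !ge_min lexx orbT.
  - by rewrite !ge_min lexx orbT.
have [Bs [Bs0 BsE]] : exists B, 0 <= B /\ B = eps1 * B1 + B2.
  by eexists; split; last exact: erefl; rewrite addr_ge0// mulr_ge0// ltW.
have [z1 [z10 z11 z1E]] : exists z1, [/\ 0 < z1, z1 <= 1 & Bs * z1 <= zeta].
  have Bs1 : 0 < Bs + 1 by rewrite ltr_wpDl.
  exists (Num.min 1 (zeta / (Bs + 1))); rewrite lt_min ltr01 divr_gt0//; split=> //.
    by rewrite ge_min lexx.
  apply: (@le_trans _ _ (Bs * (zeta / (Bs + 1)))).
    by rewrite ler_wpM2l// ge_min lexx orbT.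
  by rewrite mulrA ler_pdivrMr// mulrC ler_pM2l// lerDl.
have [eta [h [K [h0 h8 etad hK [c0g S1]]]]] := grid_scale M0 d0 z10.
set c0 := rho_sum eta h K 0 0 in c0g S1.
have eta0 : 0 < eta by clear -h0 h8; lra.
have c00 : 0 < c0 by clear -c0g; lra.
pose H p := eps * H1 p + H2 p.
have Hb p : `|H p| <= Bs.
  apply: le_trans (ler_normD _ _) _; rewrite normrM ger0_norm// BsE.
  by apply: lerD => //; apply: ler_pM.
have D2' p q : `|p.1 - q.1| <= eta -> `|p.2 - q.2| <= eta -> `|H2 p - H2 q| <= om.
  by move=> p1 p2; apply: D2; [apply: le_trans p1 _|apply: le_trans p2 _]; apply: le_trans dd2.
have Ho p q : `|p.1 - q.1| <= eta -> `|p.2 - q.2| <= eta -> `|H q - H p| <= zeta / 4.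
  move=> p1 p2.
  have q1 : `|H1 p - H1 q| <= e1.
    by apply: D1; [apply: le_trans p1 _|apply: le_trans p2 _]; apply: le_trans dd1.
  have q2 := D2' _ _ p1 p2.
  have -> : H q - H p = - (eps * (H1 p - H1 q)) - (H2 p - H2 q) by rewrite /H; ring.
  apply: le_trans (ler_normB _ _) _; rewrite normrN normrM (ger0_norm ep0).
  have : eps * `|H1 p - H1 q| <= eps1 * e1 by apply: ler_pM.
  by rewrite e1E; clear -q2 om2; lra.
pose q (c : int * int) : R * R := (c.1%:~R * h, c.2%:~R * h).
pose W c := h ^+ 2 * H (q c) / c0.
have M3 : 0 < 3 * M by rewrite mulr_gt0.
have kc := kx_c11 eta0 M3.
have qM c : c \in grid K -> `|(q c).1| + M <= 3 * M /\ `|(q c).2| + M <= 3 * M.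
  by move=> /(grid_pt_norm h0 hK) [c1 c2]; rewrite /q /=; split; clear -c1 c2; lra.
exists (fun x y => \sum_(c <- grid K) W c * kx eta (x - (q c).1) (y - (q c).2)).
exists (fun x y => \sum_(c <- grid K) W c * kxx eta (x - (q c).1) (y - (q c).2)).
exists (fun x y => \sum_(c <- grid K) W c * kxy eta (x - (q c).1) (y - (q c).2)).
exists (fun x y => \sum_(c <- grid K) W c * kx eta (y - (q c).2) (x - (q c).1)).
exists (fun x y => \sum_(c <- grid K) W c * kxy eta (y - (q c).2) (x - (q c).1)).
exists (fun x y => \sum_(c <- grid K) W c * kxx eta (y - (q c).2) (x - (q c).1)).
split.
- by apply: c11_sum => c /qM[c1 c2]; exact: (c11_scale (W c) (c11_shift kc c1 c2)).
- apply: c11_sum => c /qM[c1 c2].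
  exact: (c11_scale (W c) (c11_shift (c11_swap kc) c1 c2)).
- move=> x y a b.
  rewrite !mulr_suml -big_split/=.
  apply: le_trans (ler_norm_sum _ _ _) _.
  apply: (@le_trans _ _ (\sum_(c <- grid K) (`|H (q c)| * (h ^+ 2 * knorm eta (x - c.1%:~R * h) (y - c.2%:~R * h)) * (enorm (a, b) / c0)))).
    apply: ler_sum => c _.
    have -> : W c * kx eta (x - (q c).1) (y - (q c).2) * a +
        W c * kx eta (y - (q c).2) (x - (q c).1) * b =
      W c * (kx eta (x - (q c).1) (y - (q c).2) * a + kx eta (y - (q c).2) (x - (q c).1) * b) by ring.
    rewrite normrM; apply: le_trans (ler_wpM2l (normr_ge0 _) (kx_bound _ _ a b eta0)) _.
    have -> : `|W c| = h ^+ 2 / c0 * `|H (q c)|.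
      rewrite /W mulrAC normrM ger0_norm// divr_ge0 ?sqr_ge0//; exact: ltW.
    rewrite /q /= le_eqVlt; apply/orP; left; apply/eqP; ring.
  rewrite -mulr_suml.
  have bd : \sum_(c <- grid K) `|H (q c)| * (h ^+ 2 * knorm eta (x - c.1%:~R * h) (y - c.2%:~R * h)) <= 37 / 16.
    apply: (@grid_field_bound _ H1 H2 B1 M eps om) => //; [exact: le_trans etad dM|exact: ltW|].
    have : (om + eps * B1) * (27 * M) <= (k + k) * (27 * M).
      apply: ler_wpM2r; first exact: ltW (mulr_gt0 _ M0).
      apply: lerD => //; rewrite -eps1E; apply: ler_pM => //.
      by rewrite lerDl.
    by rewrite [X in _ <= X -> _]mulrDl kE => /le_trans; apply; clear; lra.
  have ec : 0 <= enorm (a, b) / c0 by rewrite divr_ge0 ?enorm_ge0// ltW.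
  apply: le_trans (ler_wpM2r ec bd) _; rewrite mulrA ler_pdivrMr//.
  have := ler_wpM2r (enorm_ge0 (a, b)) c0g; clear; lra.
- move=> x y xM yM; rewrite -big_split/=.
  have -> : \sum_(c <- grid K) (W c * kxx eta (x - (q c).1) (y - (q c).2) +
      W c * kxx eta (y - (q c).2) (x - (q c).1)) =
    \sum_(c <- grid K) (H (q c) / c0) * (h ^+ 2 * rho eta (x - c.1%:~R * h) (y - c.2%:~R * h)).
    by apply: eq_bigr => c _; rewrite -mulrDr kxx_rho// /W /q/=; ring.
  apply: (@grid_field_div _ H Bs zeta z1) => //; first exact: ltW.
  exact: S1.
Qed.

(** * Ultrafilter limits *)

Lemma ultra_nat : exists2 U : set_system nat, UltraFilter U & \oo `<=` U.
Proof. by have [U [UU Uoo]] := @ultraFilterLemma nat \oo _; exists U. Qed.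

Lemma ultra_fmap (S T : Type) (f : S -> T) (F : set_system S) :
  UltraFilter F -> UltraFilter (f @ F).
Proof.
move=> FU; split; first exact: fmap_proper_filter.
move=> G PG sG; apply/seteqP; split=> // A GA.
have [//|FnA] := in_ultra_setVsetC (f @^-1` A) FU.
have /sG GnA : (f @ F) (~` A) by [].
have := @filterI _ G _ _ _ GA GnA; rewrite setICr => G0.
exfalso; apply: (@filter_not_empty _ G PG); apply: G0; exact: filter_filter'.
Qed.

(** A single ultrafilter gives limits to all bounded sequences at once and so replaces diagonal
    extraction, even for families indexed by all real [t]. *)
Lemma ultra_cvg_bounded (R : realType) (U : set_system nat) (UU : UltraFilter U)
    (u : nat -> R) (B : R) : U [set n | `|u n| <= B] -> exists l : R, u @ U --> l.
Proof.
move=> uB; have UF : UltraFilter (u @ U) by exact: ultra_fmap.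
have cB := @segment_compact R (- B) B.
rewrite compact_ultra in cB.
have [|l []] := cB (u @ U) UF; last by exists l.
  by rewrite /fmap /=; apply: filterS uB => n; rewrite /= in_itv/= ler_norml.
Qed.

Lemma is_derive_of_small_o (R : realType) (f : R -> R) (t l : R) :
  (forall e, 0 < e -> exists2 d, 0 < d & forall s, `|s| <= d ->
     `|f (t + s) - f t - l * s| <= e * `|s|) -> is_derive t 1 f l.
Proof.
move=> H.
have C : h^-1 *: (f (h *: 1 + t) - f t) @[h --> 0^'] --> l.
  apply/cvgrPdist_le => e e0; have [d d0 Hd] := H e e0.
  near=> h.
  have h0 : h != 0 by near: h; exact: nbhs_dnbhs_neq.
  have hd : `|h| <= d by near: h; apply: dnbhs0_le.
  rewrite /GRing.scale /= mulr1 distrC [h + t]addrC.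
  have -> : h^-1 * (f (t + h) - f t) - l = h^-1 * (f (t + h) - f t - l * h).
    by field.
  rewrite normrM normfV mulrC ler_pdivrMr ?normr_gt0//.
  exact: Hd.
apply: DeriveDef; first by apply/cvg_ex; exists l.
by apply/cvg_lim.
Unshelve. all: by end_near.
Qed.

(** * Closed polygons and the isoperimetric inequality *)

(* By Cauchy-Schwarz, [dirichlet] is at least the squared length of the polygon. *)
Definition dirichlet (R : realType) (N : nat) (x y : nat -> R) : R :=
  N%:R * \sum_(i < N) ((x i.+1 - x i) ^+ 2 + (y i.+1 - y i) ^+ 2).
Definition nperiodic (T : Type) (N : nat) (x : nat -> T) := forall i, x (i + N)%N = x i.
Definition darea (R : realType) (N : nat) (x y : nat -> R) : R :=
  1 / 2 * \sum_(i < N) (y i * x i.+1 - x i * y i.+1).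

Definition admissible (R : realType) (N : nat) (M tau : R) (x y : nat -> R) :=
  [/\ nperiodic N x /\ nperiodic N y, forall i, `|x i| <= M, forall i, `|y i| <= M &
      darea N x y = tau].

Lemma sum_telescope (R : realType) (n : nat) (g : nat -> R) :
  \sum_(i < n) (g i.+1 - g i) = g n - g 0%N.
Proof. by rewrite -(big_mkord xpredT (fun i => g i.+1 - g i)) telescope_sumr. Qed.

Lemma sin_natmul_gt0 (R : realType) (m j : nat) : (0 < j < m)%N ->
  0 < sin (j%:R * (pi / m%:R)) :> R.
Proof.
move=> /andP[j0 jm]; have m0 : 0 < m%:R :> R by rewrite ltr0n (leq_trans _ jm).
apply: sin_gt0_pi; rewrite mulrCA mulr_gt0 ?pi_gt0 ?divr_gt0 ?ltr0n//=.
  by rewrite gtr_pMr ?pi_gt0// ltr_pdivrMr// mul1r ltr_nat.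
exact: leq_trans jm.
Qed.

(* The equality case is a sampled half period of the sine. *)
Lemma discrete_wirtinger (R : realType) (m : nat) (a : nat -> R) : (1 < m)%N ->
  a 0%N = 0 -> a m = 0 ->
  tan (pi / m.*2%:R) ^+ 2 * \sum_(j < m) (a j + a j.+1) ^+ 2 <=
    \sum_(j < m) (a j.+1 - a j) ^+ 2.
Proof.
move=> m1 a0 am; set phi := pi / m.*2%:R; pose b : R := pi / m%:R.
have m0 : 0 < m%:R :> R by rewrite ltr0n ltnW.
have b2 : b = phi *+ 2.
  by rewrite /b /phi -mul2n natrM -[X in _ = X]mulr_natl; field; rewrite gt_eqF.
have pp : 0 < phi < pi / 2.
  rewrite /phi -mul2n natrM invfM mulrA; apply/andP; split.
    by rewrite mulr_gt0 ?invr_gt0// divr_gt0// pi_gt0.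
  by rewrite gtr_pMr ?divr_gt0 ?pi_gt0// invf_lt1// ltr1n.
have c0 : 0 < cos phi.
  by apply: cos_gt0_pihalf; case/andP: pp => p1 p2; rewrite p2 andbT (lt_trans _ p1)// oppr_lt0 divr_gt0// pi_gt0.
pose s (j : nat) : R := sin (j%:R * b).
(* A Picone substitution: the quadratic form minus the increment of [g] is a perfect square divided
   by [s j * s j.+1]. At both ends [s] vanishes, but so does [a], so [g] is 0 there and telescopes
   to nothing. *)
pose g (j : nat) : R := sin b * (cos (j%:R * b) / s j) * a j ^+ 2.
have sp j : (0 < j < m)%N -> 0 < s j by exact: sin_natmul_gt0.
have sS j : s j.+1 = s j * cos b + cos (j%:R * b) * sin b.
  by rewrite /s -natr1 mulrDl mul1r sinD.
have cS j : cos (j.+1%:R * b) = cos (j%:R * b) * cos b - s j * sin b.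
  by rewrite -natr1 mulrDl mul1r cosD.
have sb : 0 < sin b by have := sp 1%N; rewrite /s mul1r; apply; rewrite m1.
have key j : (j < m)%N -> g j.+1 - g j <= cos b * (a j ^+ 2 + a j.+1 ^+ 2) - 2 * a j * a j.+1.
  move=> jm; have [j0|j0] := posnP j.
    rewrite j0 a0 /g a0 /s mul1r; have : cos b = sin b * (cos b / sin b) by field; rewrite gt_eqF.
    by move=> E; rewrite -E; lra.
  have [jm1|jm1] := eqVneq j.+1 m.
    have sj : 0 < s j by apply: sp; rewrite j0.
    have E : s j * cos b = - (cos (j%:R * b) * sin b).
      have : s j.+1 = 0 by rewrite /s jm1 /b mulrC divfK ?gt_eqF// sinpi.
      by rewrite sS => /eqP; rewrite addr_eq0 => /eqP.
    rewrite /g jm1 am; have -> : cos b = - (sin b * (cos (j%:R * b) / s j)).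
      by apply: (mulfI (lt0r_neq0 sj)); rewrite E; field; rewrite gt_eqF.
    lra.
  have sj : 0 < s j by apply: sp; rewrite j0.
  have sj1 : 0 < s j.+1 by apply: sp => /=; lia.
  rewrite -subr_ge0.
  have -> : cos b * (a j ^+ 2 + a j.+1 ^+ 2) - 2 * a j * a j.+1 - (g j.+1 - g j) =
     (s j.+1 * a j - s j * a j.+1) ^+ 2 / (s j * s j.+1).
    have E1 : sin b * cos (j.+1%:R * b) = cos b * s j.+1 - s j.
      rewrite cS sS; have := cos2Dsin2 b; nra.
    have E2 : sin b * cos (j%:R * b) = s j.+1 - cos b * s j by rewrite sS; ring.
    rewrite /g mulrA E1 [sin b * (cos (j%:R * b) / _)]mulrA E2; field.
    by rewrite !gt_eqF.
  by rewrite divr_ge0 ?sqr_ge0// mulr_ge0// ltW.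
have H : 0 <= \sum_(j < m) (cos b * (a j ^+ 2 + a j.+1 ^+ 2) - 2 * a j * a j.+1).
  apply: le_trans (ler_sum _ (fun (j : 'I_m) _ => key j (ltn_ord j))).
  by rewrite sum_telescope /g a0 am !expr0n /= !mulr0 subr0.
rewrite -subr_ge0 mulr_sumr -sumrB.
have -> : \sum_(j < m) ((a j.+1 - a j) ^+ 2 - tan phi ^+ 2 * (a j + a j.+1) ^+ 2) =
   (cos phi ^+ 2)^-1 * \sum_(j < m) (cos b * (a j ^+ 2 + a j.+1 ^+ 2) - 2 * a j * a j.+1).
  rewrite mulr_sumr; apply: eq_bigr => j _.
  by rewrite b2 cos_mulr2n /tan expr_div_n sin2cos2 -[_ *+ 2]mulr_natl; field; rewrite gt_eqF.
by rewrite mulr_ge0// invr_ge0 sqr_ge0.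
Qed.

(** The sum on the left is twice the area between the arc and the axis. The inequality
    [2 t u v <= u^2 + t^2 v^2] separates its factors, and the Wirtinger inequality turns the second
    square back into increments of [y]. *)
Lemma half_isoperimetric (R : realType) (m : nat) (x y : nat -> R) : (1 < m)%N ->
  y 0%N = 0 -> y m = 0 ->
  2 * tan (pi / m.*2%:R) * `|\sum_(j < m) (y j + y j.+1) * (x j.+1 - x j)| <=
   \sum_(j < m) ((x j.+1 - x j) ^+ 2 + (y j.+1 - y j) ^+ 2).
Proof.
move=> m1 y0 ym; have := discrete_wirtinger m1 y0 ym; set t := tan _ => W.
rewrite big_split/=; apply: le_trans (lerD (lexx _) W).
rewrite mulr_sumr -big_split/=.
have H (e : R) : e ^+ 2 = 1 -> e * (2 * t * \sum_(j < m) (y j + y j.+1) * (x j.+1 - x j)) <=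
    \sum_(j < m) ((x j.+1 - x j) ^+ 2 + t ^+ 2 * (y j + y j.+1) ^+ 2).
  move=> e1; rewrite mulrA mulr_sumr; apply: ler_sum => j _; rewrite -subr_ge0.
  have -> : (x j.+1 - x j) ^+ 2 + t ^+ 2 * (y j + y j.+1) ^+ 2 -
      e * (2 * t) * ((y j + y j.+1) * (x j.+1 - x j)) =
      ((x j.+1 - x j) - e * t * (y j + y j.+1)) ^+ 2.
    have -> : t ^+ 2 * (y j + y j.+1) ^+ 2 = e ^+ 2 * (t ^+ 2 * (y j + y j.+1) ^+ 2) by rewrite e1 mul1r.
    ring.
  exact: sqr_ge0.
set S := \sum_(j < m) (y j + y j.+1) * _ in H *.
have := H 1 (expr1n _ _); have := H (-1) ltac:(by rewrite sqrrN expr1n).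
case: (ger0P S); lra.
Qed.

Lemma tan_pi_div_ge0 (R : realType) (n : nat) : (2 <= n)%N -> 0 <= tan (pi / n%:R) :> R.
Proof.
move=> n2; have p0 : 0 <= pi / n%:R :> R by rewrite divr_ge0// pi_ge0.
have p2 : pi / n%:R <= pi / 2 :> R.
  rewrite ler_pM2l ?pi_gt0// lef_pV2 ?posrE ?ltr0n ?(ltnW n2)//.
  by rewrite (ler_nat R 2).
rewrite /tan divr_ge0//.
  apply: sin_ge0_pi; rewrite p0 (le_trans p2)// ler_pdivrMr// ler_peMr ?pi_ge0//.
  by rewrite (ler_nat R 1).
by apply: cos_ge0_pihalf; rewrite p2 andbT (le_trans _ p0)// oppr_le0 divr_ge0// pi_ge0.
Qed.

(** The chord from vertex 0 to vertex [m] is rotated onto the first axis; both halves of the polygon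
    then have their ends on that axis, and [half_isoperimetric] applies to each. *)
Lemma isoperimetric (R : realType) (m : nat) (x y : nat -> R) : (1 < m)%N ->
  (forall i, x (i + m.*2)%N = x i) -> (forall i, y (i + m.*2)%N = y i) ->
  4 * m.*2%:R * tan (pi / m.*2%:R) * `|darea m.*2 x y| <= dirichlet m.*2 x y.
Proof.
move=> m1 px py; set t := tan _.
have [[a b] /= [ab abm]] : exists ab : R * R, ab.1 ^+ 2 + ab.2 ^+ 2 = 1 /\
    - ab.2 * (x m - x 0%N) + ab.1 * (y m - y 0%N) = 0.
  pose n := Num.sqrt ((x m - x 0%N) ^+ 2 + (y m - y 0%N) ^+ 2).
  have n2 : n ^+ 2 = (x m - x 0%N) ^+ 2 + (y m - y 0%N) ^+ 2.
    by rewrite sqr_sqrtr// addr_ge0 ?sqr_ge0.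
  have [n0|n0] := eqVneq n 0.
    exists (1, 0) => /=; split; first by rewrite expr1n expr0n addr0.
    have : y m - y 0%N = 0.
      apply/eqP; rewrite -sqrf_eq0; apply/eqP; apply/le_anti; rewrite sqr_ge0 andbT.
      by move: n2 (sqr_ge0 (x m - x 0%N)); rewrite n0 expr0n/= => E; clear -E; lra.
    by move=> ->; rewrite oppr0 mul0r mulr0 addr0.
  exists ((x m - x 0%N) / n, (y m - y 0%N) / n) => /=; split.
    by rewrite !expr_div_n -mulrDl -n2 divff// sqrf_eq0.
  by ring.
pose X i := a * (x i - x 0%N) + b * (y i - y 0%N).
pose Y i := - b * (x i - x 0%N) + a * (y i - y 0%N).
have Y0 : Y 0%N = 0 by rewrite /Y; ring.
have dE i : (x i.+1 - x i) ^+ 2 + (y i.+1 - y i) ^+ 2 =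
    (X i.+1 - X i) ^+ 2 + (Y i.+1 - Y i) ^+ 2.
  by rewrite -[LHS]mul1r -ab /X /Y; ring.
have h1 := @half_isoperimetric R m X Y m1 Y0 abm.
have h2 := @half_isoperimetric R m (fun i => X (m + i)%N) (fun i => Y (m + i)%N) m1.
rewrite addn0 addnn -/t in h1 h2.
have Y2 : Y m.*2 = 0 by rewrite /Y -[m.*2]add0n px py; ring.
have {}h2 := h2 abm Y2.
pose F i := (Y i + Y i.+1) * (X i.+1 - X i).
pose D i := (X i.+1 - X i) ^+ 2 + (Y i.+1 - Y i) ^+ 2.
have split2 (f : nat -> R) : \sum_(i < m.*2) f i = \sum_(i < m) f i + \sum_(i < m) f (m + i)%N.
  by rewrite -addnn big_split_ord.
have AE : 2 * darea m.*2 x y = \sum_(i < m) F i + \sum_(i < m) F (m + i)%N.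
  rewrite -split2 /darea mulrA [2 * _]mulrC divfK// mul1r.
  (* The trapezoid sum and the cross-product sum differ by a telescoping term; [G] also absorbs the
     translation to vertex 0. *)
  pose G i := X i * Y i - y 0%N * x i + x 0%N * y i.
  have -> : \sum_(i < m.*2) F i = \sum_(i < m.*2) ((y i * x i.+1 - x i * y i.+1) + (G i.+1 - G i)).
    apply: eq_bigr => i _.
    have -> : F i = (a ^+ 2 + b ^+ 2) * ((y i - y 0%N) * (x i.+1 - x 0%N) -
        (x i - x 0%N) * (y i.+1 - y 0%N)) + (X i.+1 * Y i.+1 - X i * Y i).
      by rewrite /F /X /Y; ring.
    by rewrite ab /G; ring.
  rewrite [RHS]big_split/= (sum_telescope _ G) /G.
  have -> : X m.*2 = X 0%N by rewrite /X -[m.*2]add0n px py.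
  by rewrite Y2 Y0 -[m.*2]add0n px py !mulr0; ring.
have -> : dirichlet m.*2 x y = m.*2%:R * (\sum_(i < m) D i + \sum_(i < m) D (m + i)%N).
  by rewrite -split2 /dirichlet; congr (_ * _); apply: eq_bigr => i _; rewrite dE.
have t0 : 0 <= t by apply: tan_pi_div_ge0; lia.
set S1 := \sum_(i < m) F i in AE; set S2 := \sum_(i < m) F (m + i)%N in AE.
have {}h1 : 2 * t * `|S1| <= \sum_(i < m) D i by exact: h1.
have {}h2 : 2 * t * `|S2| <= \sum_(i < m) D (m + i)%N.
  move: h2; rewrite /S2 /F /D.
  under eq_bigr do rewrite !addnS.
  by under [X in _ <= X -> _]eq_bigr do rewrite !addnS.
have -> : 4 * m.*2%:R * t * `|darea m.*2 x y| = m.*2%:R * (2 * t * `|2 * darea m.*2 x y|).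
  by rewrite [`|2 * _|]normrM [`|2|]ger0_norm//; ring.
rewrite ler_wpM2l// AE; apply: le_trans (lerD h1 h2).
rewrite -[leRHS]mulrDr; apply: ler_wpM2l; [exact: mulr_ge0|exact: ler_normD].
Qed.

(** * The flux of a field through a polygon *)

(** Differentiability at [t] with a quadratic remainder, the one-variable counterpart of [c11]. The
    notion passes through composition with [c11] functions, so that no two-variable differentials
    are needed. *)
Definition qdiff (R : realType) (f : R -> R) (t l : R) := exists C d,
  [/\ 0 <= C, 0 < d & forall s, `|s| <= d -> `|f (t + s) - f t - l * s| <= C * s ^+ 2].

Lemma qdiff_cst (R : realType) (k t : R) : qdiff (fun=> k) t 0.
Proof.
exists 0, 1; split=> // s _.
have -> : k - k - 0 * s = 0 by ring.
by rewrite normr0 mul0r.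
Qed.

Lemma qdiff_id (R : realType) (t : R) : qdiff id t 1.
Proof.
exists 0, 1; split=> // s _; have -> : t + s - t - 1 * s = 0 by ring.
by rewrite normr0 mul0r.
Qed.

Lemma qdiffD (R : realType) (f g : R -> R) (t l m : R) : qdiff f t l -> qdiff g t m ->
  qdiff (fun s => f s + g s) t (l + m).
Proof.
move=> [C [d [C0 d0 H]]] [C' [d' [C0' d0' H']]].
exists (C + C'), (Num.min d d'); split; rewrite ?addr_ge0 ?lt_min ?d0//.
move=> s; rewrite le_min => /andP[/H h /H' h'].
have -> : f (t + s) + g (t + s) - (f t + g t) - (l + m) * s =
  (f (t + s) - f t - l * s) + (g (t + s) - g t - m * s) by ring.
by apply: le_trans (ler_normD _ _) _; rewrite mulrDl lerD.
Qed.

Lemma qdiffM (R : realType) (f g : R -> R) (t l m : R) : qdiff f t l -> qdiff g t m ->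
  qdiff (fun s => f s * g s) t (l * g t + f t * m).
Proof.
move=> [C [d [C0 d0 H]]] [C' [d' [C0' d0' H']]].
exists (`|l * m| + C * `|g t| + `|f t| * C' + `|l| * C' + `|m| * C + C * C').
exists (Num.min (Num.min d d') 1); split.
- by rewrite !addr_ge0 ?mulr_ge0.
- by rewrite !lt_min d0 d0' ltr01.
move=> s; rewrite !le_min => /andP[/andP[/H h /H' h'] s1].
set rf := f (t + s) - f t - l * s in h; set rg := g (t + s) - g t - m * s in h'.
have -> : f (t + s) * g (t + s) - f t * g t - (l * g t + f t * m) * s =
   l * m * s ^+ 2 + rf * g t + f t * rg + l * s * rg + m * s * rf + rf * rg.
  by rewrite /rf /rg; ring.
have s2 : 0 <= s ^+ 2 by exact: sqr_ge0.
have s21 : s ^+ 2 <= 1 by rewrite -[s ^+ 2]real_normK ?num_real// expr_le1.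
have t1 : `|l * m * s ^+ 2| <= `|l * m| * s ^+ 2 by rewrite normrM (ger0_norm s2).
have t2 : `|rf * g t| <= C * `|g t| * s ^+ 2 by rewrite normrM mulrAC ler_wpM2r.
have t3 : `|f t * rg| <= `|f t| * C' * s ^+ 2 by rewrite normrM -mulrA ler_wpM2l.
have t4 : `|l * s * rg| <= `|l| * C' * s ^+ 2.
  rewrite !normrM -!mulrA ler_wpM2l//; apply: le_trans (ler_wpM2r (normr_ge0 _) s1) _.
  by rewrite mul1r.
have t5 : `|m * s * rf| <= `|m| * C * s ^+ 2.
  rewrite !normrM -!mulrA ler_wpM2l//; apply: le_trans (ler_wpM2r (normr_ge0 _) s1) _.
  by rewrite mul1r.
have t6 : `|rf * rg| <= C * C' * s ^+ 2.
  rewrite normrM; apply: le_trans (ler_pM (normr_ge0 _) (normr_ge0 _) h h') _.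
  rewrite mulrACA; apply: ler_wpM2l; first exact: mulr_ge0.
  by rewrite ler_piMr.
clear H H'; clearbody rf rg; rewrite !mulrDl.
do 5 (apply: le_trans (ler_normD _ _) _; apply: lerD => //).
Qed.

Lemma qdiffZ (R : realType) (f : R -> R) (k t l : R) : qdiff f t l ->
  qdiff (fun s => k * f s) t (k * l).
Proof.
move=> H; have := qdiffM (qdiff_cst k t) H.
by rewrite mul0r add0r.
Qed.

Lemma qdiffB (R : realType) (f g : R -> R) (t l m : R) : qdiff f t l -> qdiff g t m ->
  qdiff (fun s => f s - g s) t (l - m).
Proof.
move=> H H'; have := qdiffD H (qdiffZ (-1) H').
rewrite mulN1r; congr qdiff.
by apply/funext => s; rewrite mulN1r.
Qed.

Lemma qdiff_sum (R : realType) (n : nat) (f : nat -> R -> R) (l : nat -> R) (t : R) :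
  (forall i, qdiff (f i) t (l i)) ->
  qdiff (fun s => \sum_(i < n) f i s) t (\sum_(i < n) l i).
Proof.
move=> H; elim: n => [|n IH].
  rewrite big_ord0; have -> : (fun s => \sum_(i < 0) f i s) = (fun=> 0).
    by apply/funext => s; rewrite big_ord0.
  exact: qdiff_cst.
rewrite big_ord_recr/=; have := qdiffD IH (H n); congr qdiff.
by apply/funext => s; rewrite big_ord_recr.
Qed.

Lemma qdiff_lip (R : realType) (f : R -> R) (t l : R) : qdiff f t l ->
  exists C d, [/\ 0 <= C, 0 < d, d <= 1 & forall s, `|s| <= d -> `|f (t + s) - f t| <= C * `|s|].
Proof.
move=> [C [d [C0 d0 H]]]; exists (`|l| + C), (Num.min d 1); split.
- exact: addr_ge0.
- by rewrite lt_min d0 ltr01.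
- by rewrite ge_min lexx orbT.
move=> s; rewrite le_min => /andP[/H h s1].
have -> : f (t + s) - f t = l * s + (f (t + s) - f t - l * s) by ring.
apply: le_trans (ler_normD _ _) _; rewrite mulrDl normrM lerD2l.
apply: le_trans h _; rewrite -[s ^+ 2]real_normK ?num_real// ler_wpM2l//.
by rewrite expr2 ler_piMl.
Qed.

Lemma qdiff_near (R : realType) (f : R -> R) (t l B : R) : qdiff f t l -> `|f t| < B ->
  exists2 d, 0 < d & forall s, `|s| <= d -> `|f (t + s)| <= B.
Proof.
move=> /qdiff_lip [C [d [C0 d0 _ H]]] fB.
have C1 : 0 < C + 1 by rewrite ltr_wpDl.
exists (Num.min d ((B - `|f t|) / (C + 1))).
  by rewrite lt_min d0 divr_gt0// subr_gt0.
move=> s; rewrite le_min ler_pdivlMr// => /andP[/H h s1].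
have -> : f (t + s) = f t + (f (t + s) - f t) by ring.
apply: le_trans (ler_normD _ _) _; have := normr_ge0 s; move: h s1; clear; lra.
Qed.

Lemma qdiff_inv (R : realType) (f : R -> R) (t l : R) : qdiff f t l -> f t != 0 ->
  qdiff (fun s => (f s)^-1) t (- l / f t ^+ 2).
Proof.
move=> qf f0; have n0 : 0 < `|f t| by rewrite normr_gt0.
have [C [d [C0 d0 H]]] := qf.
have [C' [d' [C0' d0' _ H']]] := qdiff_lip qf.
have C1 : 0 < C' + 1 by rewrite ltr_wpDl.
exists ((2 * C / `|f t| ^+ 2 + 2 * `|l| * C' / `|f t| ^+ 3)).
exists (Num.min (Num.min d d') (`|f t| / 2 / (C' + 1))); split.
- by rewrite addr_ge0// divr_ge0 ?exprn_ge0// !mulr_ge0.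
- by rewrite !lt_min d0 d0' !divr_gt0.
move=> s; rewrite !le_min ler_pdivlMr// => /andP[/andP[/H h /H' h'] s1].
have s0 := normr_ge0 s.
have n1 : `|f t| / 2 <= `|f (t + s)|.
  have := ler_normB (f (t + s)) (f (t + s) - f t); rewrite subKr => k.
  by move: k h' s1 s0; clear; lra.
have n2 : 0 < `|f (t + s)| by apply: lt_le_trans n1; rewrite divr_gt0.
have f1 : f (t + s) != 0 by rewrite -normr_gt0.
have -> : (f (t + s))^-1 - (f t)^-1 - - l / f t ^+ 2 * s =
  - (f (t + s) - f t - l * s) / (f t * f (t + s)) +
  l * s * (f (t + s) - f t) / (f t ^+ 2 * f (t + s)).
  by field; rewrite f0 f1.
have i1 : `|f (t + s)|^-1 <= 2 / `|f t|.
  by rewrite -[2 / _]invf_div lef_pV2 ?posrE ?divr_gt0.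
apply: le_trans (ler_normD _ _) _; rewrite mulrDl; apply: lerD.
  rewrite normrM normrN normfV normrM invfM.
  have -> : 2 * C / `|f t| ^+ 2 * s ^+ 2 = (C * s ^+ 2) * (`|f t|^-1 * (2 / `|f t|)).
    by field; rewrite gt_eqF.
  by apply: ler_pM; rewrite ?mulr_ge0 ?invr_ge0// ler_wpM2l// invr_ge0.
rewrite normrM normfV !normrM invfM -expr2.
have -> : 2 * `|l| * C' / `|f t| ^+ 3 * s ^+ 2 =
   (`|l| * `|s| * (C' * `|s|)) * (`|f t| ^- 2 * (2 / `|f t|)).
  by rewrite -[s ^+ 2]real_normK ?num_real//; field; rewrite gt_eqF.
apply: ler_pM; rewrite ?mulr_ge0 ?invr_ge0 ?exprn_ge0//.
  by rewrite ler_wpM2l ?mulr_ge0.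
by rewrite ler_wpM2l ?invr_ge0 ?exprn_ge0.
Qed.

Lemma qdiff_c11 (R : realType) (f fx fy : R -> R -> R) (B : R) (x y : R -> R) (t l m : R) :
  c11 f fx fy B -> qdiff x t l -> qdiff y t m -> `|x t| < B -> `|y t| < B ->
  qdiff (fun s => f (x s) (y s)) t (fx (x t) (y t) * l + fy (x t) (y t) * m).
Proof.
move=> [C C0 H] qx qy xB yB.
have [d1 d10 x1] := qdiff_near qx xB; have [d2 d20 y1] := qdiff_near qy yB.
have [Cx [d3 [Cx0 d30 _ x2]]] := qdiff_lip qx.
have [Cy [d4 [Cy0 d40 _ y2]]] := qdiff_lip qy.
have [Dx [d5 [Dx0 d50 x3]]] := qx; have [Dy [d6 [Dy0 d60 y3]]] := qy.
set a := fx (x t) (y t); set b := fy (x t) (y t).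
exists (C * (Cx ^+ 2 + Cy ^+ 2) + `|a| * Dx + `|b| * Dy).
exists (Num.min (Num.min (Num.min d1 d2) (Num.min d3 d4)) (Num.min d5 d6)); split.
- by rewrite !addr_ge0 ?mulr_ge0 ?addr_ge0 ?sqr_ge0.
- by rewrite !lt_min d10 d20 d30 d40 d50 d60.
move=> s; rewrite !le_min => /andP[/andP[/andP[/x1 {}x1 /y1 {}y1] /andP[/x2 {}x2 /y2 {}y2]] /andP[/x3 {}x3 /y3 {}y3]].
have := H _ _ _ _ (ltW xB) (ltW yB) x1 y1; rewrite -/a -/b => h.
have -> : f (x (t + s)) (y (t + s)) - f (x t) (y t) - (a * l + b * m) * s =
  (f (x (t + s)) (y (t + s)) - f (x t) (y t) - (a * (x (t + s) - x t) + b * (y (t + s) - y t)))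
  + a * (x (t + s) - x t - l * s) + b * (y (t + s) - y t - m * s) by ring.
apply: le_trans (ler_normD _ _) _; rewrite !mulrDl; apply: lerD; last first.
  by rewrite normrM -mulrA ler_wpM2l.
apply: le_trans (ler_normD _ _) _; apply: lerD; last first.
  by rewrite normrM -mulrA ler_wpM2l.
apply: le_trans h _; rewrite -mulrA ler_wpM2l// mulrDl.
by apply: lerD; rewrite -[leLHS]real_normK ?num_real// -[s ^+ 2]real_normK ?num_real//
   -exprMn ler_pXn2r ?nnegrE ?mulr_ge0.
Qed.

Lemma qdiff_min (R : realType) (f : R -> R) (t l d : R) : qdiff f t l -> 0 < d ->
  (forall s, `|s| <= d -> f t <= f (t + s)) -> l = 0.
Proof.
move=> [C [d' [C0 d0' H]]] d0 fm.
have C1 : 0 < C + 1 by rewrite ltr_wpDl.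
apply/eqP; rewrite -normr_eq0 eq_le normr_ge0 andbT leNgt; apply/negP => l0.
pose e := Num.min (Num.min d d') (`|l| / (2 * (C + 1))).
have e0 : 0 < e by rewrite !lt_min d0 d0' divr_gt0// mulr_gt0.
have e1 : e <= `|l| / (2 * (C + 1)) by rewrite ge_min lexx orbT.
pose s := - Num.sg l * e.
have s2 : s ^+ 2 = e ^+ 2.
  by rewrite /s exprMn sqrrN sqr_sg -normr_gt0 l0 mul1r.
have sn : `|s| = e.
  by rewrite /s normrM normrN normr_sg -normr_gt0 l0 mul1r gtr0_norm.
have := H s; have := fm s; rewrite sn s2 => f1 f2.
have {}f1 := f1 ltac:(by rewrite !ge_min lexx).
have {}f2 := f2 ltac:(by rewrite !ge_min lexx orbT).
have ls : l * s = - (`|l| * e) by rewrite /s normrEsg; ring.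
rewrite ls in f2; have := ler_norm (f (t + s) - f t - - (`|l| * e)).
move: e1; rewrite ler_pdivlMr ?mulr_gt0// => e1.
have : C * e ^+ 2 < `|l| * e.
  by rewrite expr2 mulrA ltr_pM2r//; have := ltr_wpDl; move: e1 l0 e0 C0; clear; nra.
move: f1 f2; clear; lra.
Qed.

Lemma qdiff_nincr01 (R : realType) (f l : R -> R) :
  (forall t, 0 <= t <= 1 -> qdiff f t (l t)) -> (forall t, 0 <= t <= 1 -> l t <= 0) ->
  f 1 <= f 0.
Proof.
move=> H l0.
have D (t : R) : 0 <= t <= 1 -> is_derive t 1 f (l t).
  move=> /H [C [d [C0 d0 h]]]; apply: is_derive_of_small_o => e e0.
  have C1 : 0 < C + 1 by rewrite ltr_wpDl.
  exists (Num.min d (e / (C + 1))); first by rewrite lt_min d0 divr_gt0.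
  move=> s; rewrite le_min ler_pdivlMr// => /andP[/h {}h se]; apply: le_trans h _.
  rewrite -[s ^+ 2]real_normK ?num_real// expr2 mulrA ler_wpM2r//.
  by have := normr_ge0 s; move: se; clear; lra.
have [||c] := @MVT_segment R f l 0 1 ler01.
- by move=> c; rewrite in_itv/= => /andP[c0 c1]; apply: D; rewrite !ltW.
- apply: derivable_within_continuous => c; rewrite in_itv/= => c01.
  by have [] := D c c01.
rewrite in_itv/= => c01 fE; rewrite -subr_le0 fE subr0 mulr1; exact: l0.
Qed.

(* [wfun] discretizes the flux of [Q] through the polygon with central differences;
   [wgx], [wgy] are twice its partial derivatives in the vertex of index [i.+1]. *)
Definition wfun (R : realType) (Q1 Q2 : R -> R -> R) (N : nat) (x y : nat -> R) : R :=
  1 / 2 * \sum_(i < N) (Q2 (x i.+1) (y i.+1) * (x i.+2 - x i)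
                        - Q1 (x i.+1) (y i.+1) * (y i.+2 - y i)).
Definition wgx (R : realType) (Q1x Q2 Q2x : R -> R -> R) (x y : nat -> R) (i : nat) : R :=
  Q2x (x i.+1) (y i.+1) * (x i.+2 - x i) - Q1x (x i.+1) (y i.+1) * (y i.+2 - y i)
  - (Q2 (x i.+2) (y i.+2) - Q2 (x i) (y i)).
Definition wgy (R : realType) (Q1 Q1y Q2y : R -> R -> R) (x y : nat -> R) (i : nat) : R :=
  Q2y (x i.+1) (y i.+1) * (x i.+2 - x i) - Q1y (x i.+1) (y i.+1) * (y i.+2 - y i)
  + (Q1 (x i.+2) (y i.+2) - Q1 (x i) (y i)).
Definition esq (R : realType) (x y : nat -> R) (i : nat) : R :=
  (x i.+1 - x i) ^+ 2 + (y i.+1 - y i) ^+ 2.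

Lemma sum_shift (R : realType) (N : nat) (f : nat -> R) : nperiodic N f ->
  \sum_(i < N) f i.+1 = \sum_(i < N) f i.
Proof.
move=> pf; apply/eqP; rewrite -subr_eq0 -sumrB sum_telescope.
by rewrite -[N]add0n pf subrr.
Qed.

Lemma wfun_qdiff (R : realType) (Q1 Q1x Q1y Q2 Q2x Q2y : R -> R -> R) (B t : R) (N : nat)
    (x y : nat -> R -> R) (lx ly : nat -> R) :
  c11 Q1 Q1x Q1y B -> c11 Q2 Q2x Q2y B ->
  nperiodic N x -> nperiodic N y ->
  nperiodic N lx -> nperiodic N ly ->
  (forall i, qdiff (x i) t (lx i)) -> (forall i, qdiff (y i) t (ly i)) ->
  (forall i, `|x i t| < B) -> (forall i, `|y i t| < B) ->
  qdiff (fun s => wfun Q1 Q2 N (fun i => x i s) (fun i => y i s)) t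
   (1 / 2 * \sum_(i < N) (lx i.+1 * wgx Q1x Q2 Q2x (fun i => x i t) (fun i => y i t) i +
                          ly i.+1 * wgy Q1 Q1y Q2y (fun i => x i t) (fun i => y i t) i)).
Proof.
move=> cQ1 cQ2 px py plx ply qx qy xB yB; apply: qdiffZ.
pose q1 i := Q1 (x i t) (y i t); pose q2 i := Q2 (x i t) (y i t).
have pq1 i : q1 (i + N)%N = q1 i by rewrite /q1 px py.
have pq2 i : q2 (i + N)%N = q2 i by rewrite /q2 px py.
pose l i := (Q2x (x i.+1 t) (y i.+1 t) * lx i.+1 + Q2y (x i.+1 t) (y i.+1 t) * ly i.+1)
   * (x i.+2 t - x i t) + q2 i.+1 * (lx i.+2 - lx i)
   - ((Q1x (x i.+1 t) (y i.+1 t) * lx i.+1 + Q1y (x i.+1 t) (y i.+1 t) * ly i.+1)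
   * (y i.+2 t - y i t) + q1 i.+1 * (ly i.+2 - ly i)).
have -> : \sum_(i < N) (lx i.+1 * wgx Q1x Q2 Q2x (fun i => x i t) (fun i => y i t) i +
    ly i.+1 * wgy Q1 Q1y Q2y (fun i => x i t) (fun i => y i t) i) = \sum_(i < N) l i.
  (* Summation by parts: the variation of the chord [x i.+2 - x i] is moved onto the neighbouring
     values of the field, so that each term carries the variation of the single vertex [i.+1]. *)
  have s2 : \sum_(i < N) (q2 i.+1 * lx i.+2 + q2 i.+2 * lx i.+1) =
      \sum_(i < N) (q2 i * lx i.+1 + q2 i.+1 * lx i).
    apply: (sum_shift (f := fun i => q2 i * lx i.+1 + q2 i.+1 * lx i)) => i.
    by rewrite -!addSn !pq2 !plx.
  have s1 : \sum_(i < N) (q1 i.+1 * ly i.+2 + q1 i.+2 * ly i.+1) =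
      \sum_(i < N) (q1 i * ly i.+1 + q1 i.+1 * ly i).
    apply: (sum_shift (f := fun i => q1 i * ly i.+1 + q1 i.+1 * ly i)) => i.
    by rewrite -!addSn !pq1 !ply.
  apply/eqP; rewrite -subr_eq0 -sumrB.
  apply/eqP; transitivity (\sum_(i < N) (q2 i * lx i.+1 + q2 i.+1 * lx i) -
     \sum_(i < N) (q2 i.+1 * lx i.+2 + q2 i.+2 * lx i.+1) -
     (\sum_(i < N) (q1 i * ly i.+1 + q1 i.+1 * ly i) -
     \sum_(i < N) (q1 i.+1 * ly i.+2 + q1 i.+2 * ly i.+1))); last first.
    by rewrite s1 s2 !subrr.
  rewrite -!sumrB; apply: eq_bigr => i _.
  by rewrite /l /wgx /wgy /= -/(q1 _) -/(q1 _) -/(q2 _) -/(q2 _) /q1 /q2; ring.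
apply: (@qdiff_sum R N (fun i s => Q2 (x i.+1 s) (y i.+1 s) * (x i.+2 s - x i s)
                        - Q1 (x i.+1 s) (y i.+1 s) * (y i.+2 s - y i s)) l t) => i.
apply: qdiffB; apply: qdiffM.
- exact: qdiff_c11 cQ2 (qx _) (qy _) (xB _) (yB _).
- exact: qdiffB.
- exact: qdiff_c11 cQ1 (qx _) (qy _) (xB _) (yB _).
- exact: qdiffB.
Qed.

(** Taylor expansion at the middle vertex turns the central difference of [Q2] into its gradient
    times the chord; the [Q2x] terms cancel and only the divergence remains. *)
Lemma wgx_bound (R : realType) (Q1x Q2 Q2x Q2y : R -> R -> R) (B C : R) (x y : nat -> R) i :
  taylor2 Q2 Q2x Q2y B C -> (forall i, `|x i| <= B) -> (forall i, `|y i| <= B) ->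
  `|wgx Q1x Q2 Q2x x y i + (Q1x (x i.+1) (y i.+1) + Q2y (x i.+1) (y i.+1)) * (y i.+2 - y i)|
    <= C * (esq x y i + esq x y i.+1).
Proof.
move=> T xB yB.
have h1 := T _ _ _ _ (xB i.+1) (yB i.+1) (xB i.+2) (yB i.+2).
have h2 := T _ _ _ _ (xB i.+1) (yB i.+1) (xB i) (yB i).
rewrite -[leLHS]normrN /wgx.
set a := Q2 _ _ - _ - _ in h1; set b := Q2 _ _ - _ - _ in h2.
have -> : - (Q2x (x i.+1) (y i.+1) * (x i.+2 - x i) - Q1x (x i.+1) (y i.+1) * (y i.+2 - y i)
  - (Q2 (x i.+2) (y i.+2) - Q2 (x i) (y i)) +
  (Q1x (x i.+1) (y i.+1) + Q2y (x i.+1) (y i.+1)) * (y i.+2 - y i)) = a - b.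
  by rewrite /a /b; ring.
apply: le_trans (ler_normB _ _) _; rewrite addrC mulrDr [esq x y i]/esq.
rewrite -[(x i.+1 - x i) ^+ 2]sqrrN -[(y i.+1 - y i) ^+ 2]sqrrN !opprB.
exact: lerD.
Qed.

Lemma wgy_bound (R : realType) (Q1 Q1x Q1y Q2y : R -> R -> R) (B C : R) (x y : nat -> R) i :
  taylor2 Q1 Q1x Q1y B C -> (forall i, `|x i| <= B) -> (forall i, `|y i| <= B) ->
  `|wgy Q1 Q1y Q2y x y i - (Q1x (x i.+1) (y i.+1) + Q2y (x i.+1) (y i.+1)) * (x i.+2 - x i)|
    <= C * (esq x y i + esq x y i.+1).
Proof.
move=> T xB yB.
have h1 := T _ _ _ _ (xB i.+1) (yB i.+1) (xB i.+2) (yB i.+2).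
have h2 := T _ _ _ _ (xB i.+1) (yB i.+1) (xB i) (yB i).
rewrite /wgy.
set a := Q1 _ _ - _ - _ in h1; set b := Q1 _ _ - _ - _ in h2.
have -> : Q2y (x i.+1) (y i.+1) * (x i.+2 - x i) - Q1y (x i.+1) (y i.+1) * (y i.+2 - y i)
  + (Q1 (x i.+2) (y i.+2) - Q1 (x i) (y i)) -
  (Q1x (x i.+1) (y i.+1) + Q2y (x i.+1) (y i.+1)) * (x i.+2 - x i) = a - b.
  by rewrite /a /b; ring.
apply: le_trans (ler_normB _ _) _; rewrite addrC mulrDr [esq x y i]/esq.
rewrite -[(x i.+1 - x i) ^+ 2]sqrrN -[(y i.+1 - y i) ^+ 2]sqrrN !opprB.
exact: lerD.
Qed.

Lemma sum_sqr_cauchy (R : realType) (N : nat) (a : nat -> R) :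
  (\sum_(i < N) a i) ^+ 2 <= N%:R * \sum_(i < N) a i ^+ 2.
Proof.
elim: N => [|n IH]; first by rewrite !big_ord0 expr0n mul0r.
rewrite !big_ord_recr/=; move: IH; set S := \sum_(i < n) a i; set T := \sum_(i < n) _ => IH.
have [n0|n0] := posnP n.
  by rewrite /S /T n0 !big_ord0 !add0r mul1r.
have n0R : 0 < n%:R :> R by rewrite ltr0n.
have : 2 * S * a n <= T + n%:R * a n ^+ 2.
  rewrite -(ler_pM2l n0R); have := sqr_ge0 (S - n%:R * a n); move: IH.
  rewrite !expr2; clear; lra.
rewrite -natr1 !expr2 in IH *; move: IH; clear; lra.
Qed.

Lemma enorm_triangle (R : realType) (a b c d : R) :
  enorm (a + c, b + d) <= enorm (a, b) + enorm (c, d).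
Proof.
rewrite -(@ler_pXn2r _ 2%N) ?nnegrE ?addr_ge0 ?enorm_ge0// sqrrD.
have sq (u v : R) : enorm (u, v) ^+ 2 = u ^+ 2 + v ^+ 2.
  by rewrite sqr_sqrtr// addr_ge0 ?sqr_ge0.
have := le_trans (ler_norm _) (cauchy_schwarz2 a b c d).
rewrite !sq -[_ *+ 2]mulr_natl !expr2; clear; lra.
Qed.

Lemma sum_le_dirichlet (R : realType) (N : nat) (x y : nat -> R) (d : R) (a : nat -> R) :
  0 <= d -> dirichlet N x y = d ^+ 2 -> (forall i, a i ^+ 2 <= esq x y i) ->
  \sum_(i < N) a i <= d.
Proof.
move=> d0 dE ae; have [S0|S0] := ltP (\sum_(i < N) a i) 0; first exact: ltW (lt_le_trans S0 d0).
rewrite -(@ler_pXn2r _ 2%N) ?nnegrE// -dE.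
by apply: le_trans (sum_sqr_cauchy _ _) _; rewrite ler_wpM2l// ler_sum.
Qed.

Lemma sum_enorm_le (R : realType) (N : nat) (x y : nat -> R) (d : R) : 0 <= d -> dirichlet N x y = d ^+ 2 ->
  \sum_(i < N) enorm (x i.+1 - x i, y i.+1 - y i) <= d.
Proof.
move=> d0 dE; apply: (@sum_le_dirichlet R N x y d (fun i => enorm (x i.+1 - x i, y i.+1 - y i))) => // i;
  by rewrite sqr_sqrtr// addr_ge0 ?sqr_ge0.
Qed.

Lemma sum_dx_le (R : realType) (N : nat) (x y : nat -> R) (d : R) : 0 <= d -> dirichlet N x y = d ^+ 2 ->
  \sum_(i < N) `|x i.+1 - x i| <= d.
Proof.
move=> d0 dE; apply: (@sum_le_dirichlet R N x y d (fun i => `|x i.+1 - x i|)) => // i.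
by rewrite real_normK ?num_real// lerDl sqr_ge0.
Qed.

Lemma sum_dy_le (R : realType) (N : nat) (x y : nat -> R) (d : R) : 0 <= d -> dirichlet N x y = d ^+ 2 ->
  \sum_(i < N) `|y i.+1 - y i| <= d.
Proof.
move=> d0 dE; apply: (@sum_le_dirichlet R N x y d (fun i => `|y i.+1 - y i|)) => // i.
by rewrite real_normK ?num_real// lerDr sqr_ge0.
Qed.

(** Each chord is at most two consecutive edges, and the factor 1/2 in [wfun] makes up for counting
    every edge twice. *)
Lemma wfun_bound (R : realType) (N : nat) (x y : nat -> R) (d : R) (Q1 Q2 : R -> R -> R) (k : R) :
  0 <= d -> dirichlet N x y = d ^+ 2 -> nperiodic N x -> nperiodic N y -> 0 <= k ->
  (forall u v a b, `|Q1 u v * a + Q2 u v * b| <= k * enorm (a, b)) ->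
  `|wfun Q1 Q2 N x y| <= k * d.
Proof.
move=> d0 dE px py k0 Qk; pose e i := enorm (x i.+1 - x i, y i.+1 - y i).
have H : \sum_(i < N) `|Q2 (x i.+1) (y i.+1) * (x i.+2 - x i) - Q1 (x i.+1) (y i.+1) * (y i.+2 - y i)|
   <= \sum_(i < N) k * (e i + e i.+1).
  apply: ler_sum => i _; rewrite addrC -mulrN; apply: le_trans (Qk _ _ _ _) _.
  rewrite ler_wpM2l//.
  have -> : enorm (- (y i.+2 - y i), x i.+2 - x i) =
     enorm ((x i.+1 - x i) + (x i.+2 - x i.+1), (y i.+1 - y i) + (y i.+2 - y i.+1)).
    by rewrite /enorm /=; congr Num.sqrt; ring.
  exact: enorm_triangle.
rewrite /wfun normrM ger0_norm//.
apply: le_trans (ler_wpM2l _ (le_trans (ler_norm_sum _ _ _) H)) _ => //.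
rewrite -mulr_sumr big_split/= (sum_shift (f := e)); last first.
  by move=> i; rewrite /e -!addSn !px !py.
have := ler_wpM2l k0 (sum_enorm_le d0 dE); clear; lra.
Qed.

Lemma nperiodic_mod (T : Type) (N : nat) (x : nat -> T) : nperiodic N x ->
  forall i, x i = x (i %% N)%N.
Proof.
move=> px i; rewrite {1}(divn_eq i N); elim: (i %/ N)%N => [|k IH]; first by rewrite mul0n add0n.
by rewrite mulSn -addnA addnC px.
Qed.

Lemma periodic_diam (R : realType) (N : nat) (x : nat -> R) (S : R) : (0 < N)%N ->
  nperiodic N x -> \sum_(i < N) `|x i.+1 - x i| <= S ->
  forall i j, `|x i - x j| <= S.
Proof.
move=> N0 px H.
have pm := nperiodic_mod px.
have aux i j : (i <= j < N)%N -> `|x i - x j| <= S.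
  move=> /andP[ij jN]; rewrite distrC; apply: le_trans H.
  rewrite -(subnK ij) addnC -telescope_sumr ?leq_addr//.
  apply: le_trans (ler_norm_sum _ _ _) _.
  rewrite subnKC// -(big_mkord xpredT (fun i => `|x i.+1 - x i|)).
  rewrite (big_cat_nat (n := i) (p := N))//= ?(leq_trans ij (ltnW jN))//.
  rewrite (big_cat_nat (n := j) (m := i) (p := N))//= ?(ltnW jN)//.
  by rewrite addrCA lerDl addr_ge0// sumr_ge0.
move=> i j; rewrite pm [x j]pm; have := ltn_pmod i N0; have := ltn_pmod j N0.
by case: (leqP (i %% N) (j %% N)) => [ij jN _|ji jN iN]; last rewrite distrC;
  apply: aux; rewrite ?ij ?jN// ltnW.
Qed.

(** Around a closed polygon these numbers add up to 4 times [darea], whatever the centre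
    [(c1, c2)]. *)
Definition moment (R : realType) (c1 c2 : R) (x y : nat -> R) (i : nat) : R :=
  (y i.+1 - c2) * (x i.+2 - x i) - (x i.+1 - c1) * (y i.+2 - y i).

Lemma sum_esq2 (R : realType) (N : nat) (x y : nat -> R) :
  nperiodic N x -> nperiodic N y -> (0 < N)%N ->
  \sum_(i < N) (esq x y i + esq x y i.+1) = 2 * dirichlet N x y / N%:R.
Proof.
move=> px py N0; rewrite big_split/= (sum_shift (f := esq x y)); last first.
  by move=> i; rewrite /esq -!addSn !px !py.
rewrite /dirichlet -/(esq _ _ _) mulrCA mulrAC divff ?mul1r ?pnatr_eq0 -?lt0n//.
by rewrite mulr2n mulrDl mul1r.
Qed.

(* Contracts the polygon to [(c1, c2)], where [wfun] vanishes; the derivative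
   along the way is the divergence integrated against the moments. *)
Lemma wfun_homotopy (R : realType) (Q1 Q1x Q1y Q2 Q2x Q2y : R -> R -> R)
    (B C c1 c2 L d e A : R) (N : nat) (x y mu : nat -> R) :
  (0 < N)%N -> 0 <= C -> taylor2 Q1 Q1x Q1y B C -> taylor2 Q2 Q2x Q2y B C ->
  nperiodic N x -> nperiodic N y ->
  (forall i, `|x i| < B) -> (forall i, `|y i| < B) -> `|c1| < B -> `|c2| < B ->
  (forall i, `|x i - c1| <= L) -> (forall i, `|y i - c2| <= L) ->
  dirichlet N x y = d ^+ 2 -> `|e| <= 1 ->
  (forall i s, 0 <= s <= 1 ->
    e * (Q1x (c1 + s * (x i.+1 - c1)) (c2 + s * (y i.+1 - c2)) +
         Q2y (c1 + s * (x i.+1 - c1)) (c2 + s * (y i.+1 - c2))) * moment c1 c2 x y i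
      <= mu i) ->
  1 / 2 * \sum_(i < N) mu i <= A ->
  e * wfun Q1 Q2 N x y <= A / 2 + 2 * L * C * d ^+ 2 / N%:R.
Proof.
move=> N0 C0 T1 T2 px py xB yB cB1 cB2 xL yL dE e1 Hmu HA.
pose X i s := c1 + s * (x i - c1); pose Y i s := c2 + s * (y i - c2).
have inB (c u s : R) : `|c| < B -> `|u| < B -> 0 <= s <= 1 -> `|c + s * (u - c)| < B.
  move=> cB uB /andP[s0 s1]; have -> : c + s * (u - c) = (1 - s) * c + s * u by ring.
  apply: le_lt_trans (ler_normD _ _) _; rewrite !normrM (ger0_norm s0) ger0_norm ?subr_ge0//.
  have [->|s00] := eqVneq s 0; first by rewrite mul0r addr0 subr0 mul1r.
  have : s * `|u| < s * B by rewrite ltr_pM2l// lt0r s00.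
  have : (1 - s) * `|c| <= (1 - s) * B by rewrite ler_wpM2l ?subr_ge0// ltW.
  clear; lra.
pose l s := 1 / 2 * \sum_(i < N) ((x i.+1 - c1) * wgx Q1x Q2 Q2x (fun i => X i s) (fun i => Y i s) i
   + (y i.+1 - c2) * wgy Q1 Q1y Q2y (fun i => X i s) (fun i => Y i s) i).
have qa (a c t : R) : qdiff (fun s => c + s * a) t a.
  have := qdiffD (qdiff_cst c t) (qdiffM (qdiff_id t) (qdiff_cst a t)).
  by rewrite mul1r mulr0 addr0 add0r.
have ql t : 0 <= t <= 1 ->
    qdiff (fun s => wfun Q1 Q2 N (fun i => X i s) (fun i => Y i s)) t (l t).
  move=> t01; apply: (@wfun_qdiff R Q1 Q1x Q1y Q2 Q2x Q2y B t N X Y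
     (fun i => x i - c1) (fun i => y i - c2)).
  - by exists C.
  - by exists C.
  - by move=> i; rewrite /X px.
  - by move=> i; rewrite /Y py.
  - by move=> i; rewrite px.
  - by move=> i; rewrite py.
  - by move=> i; exact: qa.
  - by move=> i; exact: qa.
  - by move=> i; exact: inB.
  - by move=> i; exact: inB.
pose E := 2 * L * C * d ^+ 2 / N%:R.
(* At parameter [t] the chords have shrunk by the factor [t], so the divergence term is [t] times
   the one with the original moments; [E] collects the Taylor errors. *)
have le t : 0 <= t <= 1 -> e * l t <= t * A + E.
  move=> t01; have /andP[t0 t1] := t01.
  have -> : t * A + E = t * A + 1 / 2 * \sum_(i < N) (2 * L * (C * (esq x y i + esq x y i.+1))).
    congr (_ + _); rewrite -!mulr_sumr sum_esq2// dE /E.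
    by field; rewrite pnatr_eq0 -lt0n.
  have : t * (1 / 2 * \sum_(i < N) mu i) <= t * A by rewrite ler_wpM2l.
  suff : e * l t <= t * (1 / 2 * \sum_(i < N) mu i) +
     1 / 2 * \sum_(i < N) (2 * L * (C * (esq x y i + esq x y i.+1))).
    by clear; lra.
  rewrite /l mulrCA [t * _]mulrCA -mulrDr ler_wpM2l// !mulr_sumr -big_split/=.
  apply: ler_sum => i _.
  have bx := @wgx_bound R Q1x Q2 Q2x Q2y B C (fun i => X i t) (fun i => Y i t) i T2
    (fun i => ltW (inB _ _ _ cB1 (xB i) t01)) (fun i => ltW (inB _ _ _ cB2 (yB i) t01)).
  have by' := @wgy_bound R Q1 Q1x Q1y Q2y B C (fun i => X i t) (fun i => Y i t) i T1
    (fun i => ltW (inB _ _ _ cB1 (xB i) t01)) (fun i => ltW (inB _ _ _ cB2 (yB i) t01)).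
  have eE j : esq (fun i => X i t) (fun i => Y i t) j <= esq x y j.
    have -> : esq (fun i => X i t) (fun i => Y i t) j = t ^+ 2 * esq x y j.
      by rewrite /esq /X /Y; ring.
    by rewrite ler_piMl ?expr_le1// /esq addr_ge0 ?sqr_ge0.
  have eC := ler_wpM2l C0 (lerD (eE i) (eE i.+1)).
  have {eC}bx := le_trans bx eC; have {}by' := le_trans by' (ler_wpM2l C0 (lerD (eE i) (eE i.+1))).
  set K := C * (esq x y i + _) in bx by' *.
  move: bx by'; set gx := wgx _ _ _ _ _ _; set gy := wgy _ _ _ _ _ _.
  set D := Q1x (X i.+1 t) (Y i.+1 t) + Q2y (X i.+1 t) (Y i.+1 t) => bx by'.
  have Hm := Hmu i t t01; rewrite -/(X i.+1 t) -/(Y i.+1 t) -/D in Hm.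
  have -> : e * ((x i.+1 - c1) * gx + (y i.+1 - c2) * gy) =
    t * (e * D * moment c1 c2 x y i) +
    (e * ((x i.+1 - c1) * (gx + D * (Y i.+2 t - Y i t))) +
     e * ((y i.+1 - c2) * (gy - D * (X i.+2 t - X i t)))).
    by rewrite /moment /X /Y; ring.
  apply: lerD; first by rewrite ler_wpM2l.
  have bd (u v : R) : `|u| <= L -> `|v| <= K -> e * (u * v) <= L * K.
    move=> uL vK; apply: le_trans (ler_norm _) _; rewrite !normrM.
    by rewrite -[leRHS]mul1r; apply: ler_pM; rewrite ?mulr_ge0//; exact: ler_pM.
  have := bd _ _ (xL i.+1) bx; have := bd _ _ (yL i.+1) by'.
  by clear; lra.
have w0 : wfun Q1 Q2 N (fun i => X i 0) (fun i => Y i 0) = 0.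
  by rewrite /wfun big1 ?mulr0// => i _; rewrite /X /Y !mul0r !addr0 !subrr !mulr0 subrr.
have w1 : wfun Q1 Q2 N (fun i => X i 1) (fun i => Y i 1) = wfun Q1 Q2 N x y.
  by congr wfun; apply/funext => i; rewrite /X /Y; ring.
(* A primitive of [t * A + E] is subtracted; integrating the factor [t] is what turns [A] into
   [A / 2]. *)
pose F s := e * wfun Q1 Q2 N (fun i => X i s) (fun i => Y i s) - (A / 2 * (s * s) + E * s).
have : F 1 <= F 0.
  apply: (@qdiff_nincr01 R F (fun s => e * l s - (A / 2 * (1 * s + s * 1) + E * 1))).
    move=> t t01; apply: qdiffB; first by apply: qdiffZ; exact: ql.
    by apply: qdiffD; apply: qdiffZ; [apply: qdiffM; exact: qdiff_id|exact: qdiff_id].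
  by move=> t t01; have := le t t01; clear; lra.
by rewrite /F w0 w1 !mulr0 !mulr1 addr0 subrr subr_le0.
Qed.

Lemma sin_le_id (R : realType) (x : R) : 0 <= x -> sin x <= x.
Proof.
move=> x0.
have [|c _] := @MVT_segment R sin cos 0 x x0 (fun t _ => is_derive_sin t).
  by apply: continuous_subspaceT; exact: continuous_sin.
rewrite sin0 !subr0 => ->; rewrite ler_piMl// cos_le1.
Qed.

(** Used with [k t = pi / 2], where it reads [1 <= k |sin t|]. *)
Lemma sin_natmul_le (R : realType) (t : R) (k : nat) : 0 <= t -> `|sin (k%:R * t)| <= k%:R * `|sin t|.
Proof.
move=> t0; elim: k => [|k IH]; first by rewrite !mul0r sin0 normr0.
rewrite -natr1 mulrDl mul1r sinD mulrDl mul1r.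
apply: le_trans (ler_normD _ _) _; rewrite !normrM; apply: lerD.
  by apply: le_trans IH; rewrite ler_piMr// cos_max.
by rewrite ler_piMl// cos_max.
Qed.

(* [sg] is the orientation; [darea] is minus the enclosed area. *)
Definition regx (R : realType) (N : nat) (c1 r : R) (i : nat) : R :=
  c1 + r * cos (i%:R * (2 * pi / N%:R)).
Definition regy (R : realType) (N : nat) (c2 r sg : R) (i : nat) : R :=
  c2 - sg * (r * sin (i%:R * (2 * pi / N%:R))).

(** With [4 k] vertices a quarter turn is [k] steps, whence [4 <= N sin th] and a radius below
    [sqrt |tau|]. By symmetry the moments about the centre are all equal, and [dirichlet] takes the
    value of equality in [isoperimetric]. *)
Lemma regular_polygon (R : realType) (k : nat) (tau c1 c2 : R) : (0 < k)%N -> tau != 0 ->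
  let N := (4 * k)%N in
  exists x y : nat -> R,
  [/\ nperiodic N x /\ nperiodic N y,
      darea N x y = tau,
      (forall i, moment c1 c2 x y i = 4 * tau / N%:R) /\
      (forall i, (x i - c1) ^+ 2 + (y i - c2) ^+ 2 <= `|tau|),
      dirichlet N x y = 4 * N%:R * tan (pi / N%:R) * `|tau| &
      8 * `|tau| <= dirichlet N x y <= 32 * `|tau|].
Proof.
move=> k0 tau0 N.
have N0 : 0 < N%:R :> R by rewrite ltr0n muln_gt0.
have NE : N%:R = 4 * k%:R :> R by rewrite natrM.
have k00 : 0 < k%:R :> R by rewrite ltr0n.
have k1 : 1 <= k%:R :> R by rewrite (ler_nat R 1).
have t0 : 0 < `|tau| by rewrite normr_gt0.
pose th : R := 2 * pi / N%:R; pose phi : R := pi / N%:R.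
have pi0 := @pi_gt0 R.
have th0 : 0 < th by rewrite divr_gt0// mulr_gt0.
have thN : N%:R * th = pi *+ 2 by rewrite mulrC divfK ?gt_eqF// mulr_natl.
have thp : th <= pi / 2.
  by rewrite /th NE ler_pdivrMr ?mulr_gt0//; have := ler_wpM2l (ltW pi0) k1; clear; lra.
have ph2 : th = phi *+ 2 by rewrite /th /phi -[RHS]mulr_natl mulrA.
have s0 : 0 < sin th.
  by apply: sin_gt0_pi; rewrite th0 (le_lt_trans thp)// ltr_pdivrMr// ltr_pMr// ltr1n.
have c0 : 0 <= cos th.
  by apply: cos_ge0_pihalf; rewrite thp andbT (le_trans _ (ltW th0))// oppr_le0 divr_ge0// ltW.
have Ns4 : 4 <= N%:R * sin th.
  have := sin_natmul_le k (ltW th0).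
  have -> : k%:R * th = pi / 2 by rewrite /th NE; field; rewrite gt_eqF.
  by rewrite sin_pihalf normr1 gtr0_norm// NE; clear; lra.
have Ns8 : N%:R * sin th <= 8.
  have := ler_wpM2l (ltW N0) (sin_le_id (ltW th0)); rewrite thN.
  by have := @pihalf_lt2 R; rewrite -mulr_natl; clear; lra.
(* Chosen so that the enclosed area [N r^2 sin th / 2] equals [|tau|]. *)
pose r := Num.sqrt (2 * `|tau| / (N%:R * sin th)).
have Ns0 : 0 < N%:R * sin th by rewrite mulr_gt0.
have r2 : r ^+ 2 = 2 * `|tau| / (N%:R * sin th).
  by rewrite sqr_sqrtr// divr_ge0 ?mulr_ge0// ltW.
pose sg := Num.sg tau.
have sg2 : sg ^+ 2 = 1 by rewrite sqr_sg tau0.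
have sgt : sg * `|tau| = tau by rewrite -numEsg.
pose x := regx N c1 r; pose y := regy N c2 r sg.
pose a i := cos (i%:R * th); pose b i := sin (i%:R * th).
have ab i : a i ^+ 2 + b i ^+ 2 = 1 by exact: cos2Dsin2.
have aS i : a i.+1 = a i * cos th - b i * sin th.
  by rewrite /a -natr1 mulrDl mul1r cosD.
have bS i : b i.+1 = b i * cos th + a i * sin th.
  by rewrite /b -natr1 mulrDl mul1r sinD.
have cs : cos th ^+ 2 + sin th ^+ 2 = 1 by exact: cos2Dsin2.
have xE i : x i = c1 + r * a i by [].
have yE i : y i = c2 - sg * (r * b i) by [].
have px i : x (i + N)%N = x i.
  by rewrite /x /regx natrD mulrDl -/th thN cosD2pi.
have py i : y (i + N)%N = y i.
  by rewrite /y /regy natrD mulrDl -/th thN sinD2pi.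
have dE : dirichlet N x y = N%:R ^+ 2 * (r ^+ 2 * (2 * (1 - cos th))).
  rewrite /dirichlet (eq_bigr (fun=> r ^+ 2 * (2 * (1 - cos th)))).
    by rewrite sumr_const card_ord; set v := r ^+ 2 * _; rewrite -[v *+ N]mulr_natl expr2 mulrA.
  move=> i _; rewrite !xE !yE aS bS.
  have -> : (c1 + r * (a i * cos th - b i * sin th) - (c1 + r * a i)) ^+ 2 +
    (c2 - sg * (r * (b i * cos th + a i * sin th)) - (c2 - sg * (r * b i))) ^+ 2 =
    r ^+ 2 * ((a i * cos th - b i * sin th - a i) ^+ 2 +
       sg ^+ 2 * (b i * cos th + a i * sin th - b i) ^+ 2) by ring.
  rewrite sg2 mul1r; congr (_ * _).
  have -> : (a i * cos th - b i * sin th - a i) ^+ 2 + (b i * cos th + a i * sin th - b i) ^+ 2 =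
     (a i ^+ 2 + b i ^+ 2) * ((cos th ^+ 2 + sin th ^+ 2) + 1 - 2 * cos th) by ring.
  by rewrite ab cs; ring.
exists x, y; split => //.
- rewrite /darea (eq_bigr (fun i : 'I_N => sg * r ^+ 2 * sin th +
     ((c2 * x i.+1 - c1 * y i.+1) - (c2 * x i - c1 * y i)))); last first.
    move=> i _; rewrite !xE !yE aS bS.
    have -> : sg * r ^+ 2 * sin th = sg * r ^+ 2 * sin th * (a i ^+ 2 + b i ^+ 2).
      by rewrite ab mulr1.
    by ring.
  rewrite big_split/= (sum_telescope N (fun i => c2 * x i - c1 * y i)).
  rewrite -[N in x N]add0n -[N in y N]add0n px py subrr addr0 sumr_const card_ord.
  set v := _ * sin th; rewrite -[v *+ N]mulr_natl /v r2 -[RHS]sgt; field.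
  by rewrite !gt_eqF// ltr0n.
- split=> i.
    rewrite /moment !xE !yE !(aS, bS).
    have -> : (c2 - sg * (r * (b i * cos th + a i * sin th)) - c2) *
       (c1 + r * ((a i * cos th - b i * sin th) * cos th - (b i * cos th + a i * sin th) * sin th) - (c1 + r * a i))
       - (c1 + r * (a i * cos th - b i * sin th) - c1) *
       (c2 - sg * (r * ((b i * cos th + a i * sin th) * cos th + (a i * cos th - b i * sin th) * sin th)) - (c2 - sg * (r * b i)))
      = sg * r ^+ 2 * sin th * ((a i ^+ 2 + b i ^+ 2) * ((cos th ^+ 2 + sin th ^+ 2) + 1)).
      by ring.
    rewrite ab cs r2 -[in RHS]sgt; field.
    by rewrite !gt_eqF.
  rewrite xE yE; have -> : (c1 + r * a i - c1) ^+ 2 + (c2 - sg * (r * b i) - c2) ^+ 2 =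
    r ^+ 2 * (a i ^+ 2 + sg ^+ 2 * b i ^+ 2) by ring.
  rewrite sg2 mul1r ab mulr1 r2 ler_pdivrMr//.
  by have := ler_wpM2l (ltW t0) Ns4; clear -t0; lra.
- rewrite dE r2 /tan -/phi.
  have -> : 1 - cos th = 2 * sin phi ^+ 2.
    by rewrite ph2 cos_mulr2n sin2cos2 -mulr_natl; ring.
  have st : sin th = 2 * (cos phi * sin phi) by rewrite ph2 sin_mulr2n -mulr_natl.
  have cp0 : cos phi != 0 by apply/eqP => E; move: s0; rewrite st E mul0r mulr0 ltxx.
  have sp0 : sin phi != 0 by apply/eqP => E; move: s0; rewrite st E !mulr0 ltxx.
  by rewrite st; field; rewrite cp0 sp0 gt_eqF.
- rewrite dE r2.
  have c1' : 0 <= 1 - cos th by rewrite subr_ge0 cos_le1.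
  have ss : sin th ^+ 2 = (1 - cos th) * (1 + cos th) by rewrite sin2cos2; ring.
  have -> : N%:R ^+ 2 * (2 * `|tau| / (N%:R * sin th) * (2 * (1 - cos th))) =
     (4 * `|tau|) * (N%:R * (1 - cos th) / sin th) by field; rewrite !gt_eqF.
  have lo : 2 <= N%:R * (1 - cos th) / sin th.
    rewrite ler_pdivlMr//.
    have : N%:R * (sin th ^+ 2) <= N%:R * ((1 - cos th) * 2).
      by rewrite ler_wpM2l ?(ltW N0)// ss ler_wpM2l//; have := cos_le1 th; clear; lra.
    have := ler_wpM2r (ltW s0) Ns4; rewrite expr2; clear; lra.
  have hi : N%:R * (1 - cos th) / sin th <= 8.
    rewrite ler_pdivrMr//.
    have : N%:R * (1 - cos th) <= N%:R * sin th ^+ 2.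
      by rewrite ler_wpM2l ?(ltW N0)// ss ler_peMr// lerDl.
    have := ler_wpM2r (ltW s0) Ns8; rewrite expr2; clear; lra.
  have := ler_wpM2l (ltW t0) lo; have := ler_wpM2l (ltW t0) hi.
  by move=> h1 h2; apply/andP; split; move: h1 h2; clear; lra.
Qed.

(** * Minimizing polygons *)

Lemma cvg_real_unique (R : realType) (U : set_system nat) (FU : ProperFilter U)
    (u : nat -> R) (a b : R) : u @ U --> a -> u @ U --> b -> a = b.
Proof. by move=> ua ub; exact: (cvg_unique (@Rhausdorff R) ua ub). Qed.

Lemma cvg_sum_ord (R : realType) (U : set_system nat) (FU : Filter U) (n : nat)
    (u : nat -> nat -> R) (l : nat -> R) : (forall i, u i @ U --> l i) ->
  (fun j => \sum_(i < n) u i j) @ U --> \sum_(i < n) l i.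
Proof.
move=> H; elim: n => [|n IH].
  rewrite big_ord0; under eq_fun do rewrite big_ord0; exact: cvg_cst.
rewrite big_ord_recr/=; under eq_fun do rewrite big_ord_recr/=.
exact: cvgD.
Qed.

Lemma c11_cvg (R : realType) (U : set_system nat) (FU : Filter U)
    (f fx fy : R -> R -> R) (B a b : R) (x y : nat -> R) : c11 f fx fy B ->
  x @ U --> a -> y @ U --> b -> (forall j, `|x j| <= B) -> (forall j, `|y j| <= B) ->
  `|a| <= B -> `|b| <= B -> (fun j => f (x j) (y j)) @ U --> f a b.
Proof.
move=> [C C0 T] xa yb xB yB aB bB.
pose g j := fx a b * (x j - a) + fy a b * (y j - b).
pose r j := C * ((x j - a) * (x j - a) + (y j - b) * (y j - b)).
have x0 : (fun j => x j - a) @ U --> (0 : R).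
  by rewrite -(subrr a); apply: cvgB => //; exact: cvg_cst.
have y0 : (fun j => y j - b) @ U --> (0 : R).
  by rewrite -(subrr b); apply: cvgB => //; exact: cvg_cst.
have g0 : g @ U --> (0 : R).
  have -> : 0 = fx a b * 0 + fy a b * 0 :> R by rewrite !mulr0 addr0.
  by apply: cvgD; apply: cvgM => //; exact: cvg_cst.
have r0 : r @ U --> (0 : R).
  have -> : 0 = C * (0 * 0 + 0 * 0) :> R by rewrite !mulr0 addr0 mulr0.
  by apply: cvgM; [exact: cvg_cst|apply: cvgD; exact: cvgM].
have -> : (fun j => f (x j) (y j)) = (fun j => f a b + g j + (f (x j) (y j) - f a b - g j)).
  by apply/funext => j; ring.
rewrite -[f a b in X in _ --> X]addr0 -[f a b + 0 in X in _ --> X]addr0.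
apply: cvgD; first by apply: cvgD => //; exact: cvg_cst.
apply/cvgrPdist_le => e e0; move/cvgrPdist_le: r0 => /(_ e e0).
apply: filterS => j; rewrite !sub0r !normrN => H; apply: le_trans H.
apply: le_trans (ler_norm _); have := T _ _ _ _ aB bB (xB j) (yB j).
by rewrite /r /g !expr2.
Qed.

(** The direct method: the flux is at most [k] times the square root of [dirichlet], so [k <= 1]
    makes the energy nonnegative, and all the constraints pass to limits of vertices in the box. *)
Lemma discrete_minimizer (R : realType) (Q1 Q1x Q1y Q2 Q2x Q2y : R -> R -> R)
    (B M tau k : R) (N : nat) (x0 y0 : nat -> R) :
  c11 Q1 Q1x Q1y B -> c11 Q2 Q2x Q2y B -> M <= B -> 0 <= k <= 1 ->
  (forall u v a b, `|Q1 u v * a + Q2 u v * b| <= k * enorm (a, b)) ->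
  let adm := admissible N M tau in
  let E x y := Num.sqrt (dirichlet N x y) + wfun Q1 Q2 N x y in
  adm x0 y0 ->
  exists x y, adm x y /\ forall x' y', adm x' y' -> E x y <= E x' y'.
Proof.
move=> c1 c2 MB /andP[k0 k1] Qk adm E adm0.
have E0 x y : adm x y -> 0 <= E x y.
  move=> [[px py] xM yM _].
  have d0 : 0 <= dirichlet N x y.
    by rewrite mulr_ge0// sumr_ge0// => i _; rewrite addr_ge0 ?sqr_ge0.
  have := wfun_bound (sqrtr_ge0 _) (esym (sqr_sqrtr d0)) px py k0 Qk.
  have := sqrtr_ge0 (dirichlet N x y); rewrite /E.
  set d := Num.sqrt _ => dd; have := ler_wpM2r dd k1.
  by rewrite ler_norml; clear; lra.
pose S := [set e | exists x y, adm x y /\ e = E x y].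
have S0 : S !=set0 by exists (E x0 y0), x0, y0.
have Sb : has_inf S by split => //; exists 0 => _ [x [y [/E0 H ->]]].
have H j : exists xy : (nat -> R) * (nat -> R), adm xy.1 xy.2 /\ E xy.1 xy.2 < inf S + j.+1%:R^-1.
  have [|e [x [y [xy ->]]] He] := @inf_adherent R S j.+1%:R^-1 _ Sb.
    by rewrite invr_gt0.
  by exists (x, y).
have [p Hp] := choice H.
have [U UU Uoo] := ultra_nat.
have FU : ProperFilter U by exact: ultra_proper.
have X i : exists l : R, (fun j => (p j).1 i) @ U --> l.
  apply: (@ultra_cvg_bounded R U UU _ M); apply: filterS filterT => j _ /=.
  by have [[_ + _ _] _] := Hp j; apply.
have Y i : exists l : R, (fun j => (p j).2 i) @ U --> l.
  apply: (@ultra_cvg_bounded R U UU _ M); apply: filterS filterT => j _ /=.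
  by have [[_ _ + _] _] := Hp j; apply.
have [x Hx] := choice X; have [y Hy] := choice Y.
have xM i : `|x i| <= M.
  apply: (cvgr_to_le (cvg_norm (Hx i))); apply: nearW => j /=.
  by have [[_ + _ _] _] := Hp j; apply.
have yM i : `|y i| <= M.
  apply: (cvgr_to_le (cvg_norm (Hy i))); apply: nearW => j /=.
  by have [[_ _ + _] _] := Hp j; apply.
have px i : x (i + N)%N = x i.
  have := Hx (i + N)%N; have -> : (fun j => (p j).1 (i + N)%N) = (fun j => (p j).1 i).
    by apply/funext => j; have [[[+ _] _ _ _] _] := Hp j; apply.
  by move=> H'; exact: (cvg_real_unique FU H' (Hx i)).
have py i : y (i + N)%N = y i.
  have := Hy (i + N)%N; have -> : (fun j => (p j).2 (i + N)%N) = (fun j => (p j).2 i).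
    by apply/funext => j; have [[[_ +] _ _ _] _] := Hp j; apply.
  by move=> H'; exact: (cvg_real_unique FU H' (Hy i)).
have ca : (fun j => darea N (p j).1 (p j).2) @ U --> darea N x y.
  apply: cvgM; first exact: cvg_cst.
  apply: (@cvg_sum_ord R U _ N (fun i j => (p j).2 i * (p j).1 i.+1 - (p j).1 i * (p j).2 i.+1)
    (fun i => y i * x i.+1 - x i * y i.+1)) => i.
  by apply: cvgB; apply: cvgM.
have cd : (fun j => dirichlet N (p j).1 (p j).2) @ U --> dirichlet N x y.
  apply: cvgM; first exact: cvg_cst.
  apply: (@cvg_sum_ord R U _ N (fun i j => ((p j).1 i.+1 - (p j).1 i) ^+ 2 + ((p j).2 i.+1 - (p j).2 i) ^+ 2)
    (fun i => (x i.+1 - x i) ^+ 2 + (y i.+1 - y i) ^+ 2)) => i.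
  by apply: cvgD; apply: cvgM; exact: cvgB.
have cw : (fun j => wfun Q1 Q2 N (p j).1 (p j).2) @ U --> wfun Q1 Q2 N x y.
  apply: cvgM; first exact: cvg_cst.
  apply: (@cvg_sum_ord R U _ N (fun i j => Q2 ((p j).1 i.+1) ((p j).2 i.+1) * ((p j).1 i.+2 - (p j).1 i)
                        - Q1 ((p j).1 i.+1) ((p j).2 i.+1) * ((p j).2 i.+2 - (p j).2 i))
    (fun i => Q2 (x i.+1) (y i.+1) * (x i.+2 - x i) - Q1 (x i.+1) (y i.+1) * (y i.+2 - y i))) => i.
  have b1 j : `|(p j).1 i.+1| <= B by apply: le_trans MB; have [[_ + _ _] _] := Hp j; apply.
  have b2 j : `|(p j).2 i.+1| <= B by apply: le_trans MB; have [[_ _ + _] _] := Hp j; apply.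
  have b3 := le_trans (xM i.+1) MB; have b4 := le_trans (yM i.+1) MB.
  apply: cvgB; apply: cvgM; try exact: cvgB.
    exact: (@c11_cvg R U _ Q2 Q2x Q2y B _ _ (fun j => (p j).1 i.+1) (fun j => (p j).2 i.+1) c2 (Hx i.+1) (Hy i.+1) b1 b2 b3 b4).
  exact: (@c11_cvg R U _ Q1 Q1x Q1y B _ _ (fun j => (p j).1 i.+1) (fun j => (p j).2 i.+1) c1 (Hx i.+1) (Hy i.+1) b1 b2 b3 b4).
have cE : (fun j => E (p j).1 (p j).2) @ U --> E x y.
  apply: cvgD => //.
  exact: (cvg_comp _ _ cd (@sqrt_continuous R _)).
exists x, y; split.
  split=> //; have -> : tau = darea N x y; last by [].
  have : (fun j => darea N (p j).1 (p j).2) = (fun=> tau).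
    by apply/funext => j; have [[_ _ _ +] _] := Hp j.
  move=> e; rewrite e in ca.
  by apply: (cvg_real_unique FU _ ca); exact: cvg_cst.
move=> x' y' adm'.
have m' : inf S <= E x' y' by apply: ge_inf; [exact: Sb.2|exists x', y'].
apply: le_trans m'.
have ch : (fun j : nat => inf S + j.+1%:R^-1 : R) @ U --> inf S.
  rewrite -[X in _ --> X]addr0; apply: cvgD; first exact: cvg_cst.
  apply: cvg_trans (@cvg_harmonic R); exact: cvg_app.
apply: (ler_cvg_to cE ch); apply: nearW => j.
by apply: ltW; have [_] := Hp j.
Qed.

Lemma qdiff_dirichlet (R : realType) (N : nat) (t : R) (x y : nat -> R -> R) (lx ly : nat -> R) :
  nperiodic N x -> nperiodic N y ->
  nperiodic N lx -> nperiodic N ly ->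
  (forall i, qdiff (x i) t (lx i)) -> (forall i, qdiff (y i) t (ly i)) ->
  qdiff (fun s => dirichlet N (fun i => x i s) (fun i => y i s)) t
    (2 * N%:R * \sum_(i < N) (lx i.+1 * (2 * x i.+1 t - x i t - x i.+2 t)
                            + ly i.+1 * (2 * y i.+1 t - y i t - y i.+2 t))).
Proof.
move=> px py plx ply qx qy.
have -> : 2 * N%:R * \sum_(i < N) (lx i.+1 * (2 * x i.+1 t - x i t - x i.+2 t)
                            + ly i.+1 * (2 * y i.+1 t - y i t - y i.+2 t)) =
  N%:R * \sum_(i < N) (2 * (lx i.+1 - lx i) * (x i.+1 t - x i t) +
                       2 * (ly i.+1 - ly i) * (y i.+1 t - y i t)).
  rewrite mulrAC mulrC; congr (_ * _); rewrite mulr_sumr.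
  pose g i := 2 * (lx i * (x i.+1 t - x i t) + ly i * (y i.+1 t - y i t)).
  apply/eqP; rewrite -subr_eq0 -sumrB.
  rewrite (eq_bigr (fun i : 'I_N => - (g i.+1 - g i))); last by move=> i _; rewrite /g; ring.
  rewrite sumrN sum_telescope oppr_eq0 -[N]add0n; apply/eqP.
  by rewrite /g -!addSn plx px px ply py py subrr.
apply: qdiffZ.
apply: (@qdiff_sum R N (fun i s => (x i.+1 s - x i s) ^+ 2 + (y i.+1 s - y i s) ^+ 2)
  (fun i => 2 * (lx i.+1 - lx i) * (x i.+1 t - x i t) + 2 * (ly i.+1 - ly i) * (y i.+1 t - y i t))) => i.
have h (f g : R -> R) (l m : R) : qdiff f t l -> qdiff g t m ->
    qdiff (fun s => (f s - g s) ^+ 2) t (2 * (l - m) * (f t - g t)).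
  move=> qf qg; have qh := qdiffB qf qg; have := qdiffM qh qh.
  by congr qdiff; ring.
by apply: qdiffD; exact: h.
Qed.

Lemma qdiff_darea (R : realType) (N : nat) (t : R) (x y : nat -> R -> R) (lx ly : nat -> R) :
  nperiodic N x -> nperiodic N y ->
  nperiodic N lx -> nperiodic N ly ->
  (forall i, qdiff (x i) t (lx i)) -> (forall i, qdiff (y i) t (ly i)) ->
  qdiff (fun s => darea N (fun i => x i s) (fun i => y i s)) t
    (1 / 2 * \sum_(i < N) (ly i.+1 * (x i.+2 t - x i t) - lx i.+1 * (y i.+2 t - y i t))).
Proof.
move=> px py plx ply qx qy.
have -> : \sum_(i < N) (ly i.+1 * (x i.+2 t - x i t) - lx i.+1 * (y i.+2 t - y i t)) =
  \sum_(i < N) (ly i * x i.+1 t + y i t * lx i.+1 - (lx i * y i.+1 t + x i t * ly i.+1)).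
  pose g i := ly i * x i.+1 t - lx i * y i.+1 t.
  apply/eqP; rewrite -subr_eq0 -sumrB.
  rewrite (eq_bigr (fun i : 'I_N => (g i.+1 - g i))); last by move=> i _; rewrite /g; ring.
  rewrite sum_telescope -[N]add0n; apply/eqP.
  by rewrite /g -!addSn plx px ply py subrr.
apply: qdiffZ.
apply: (@qdiff_sum R N (fun i s => y i s * x i.+1 s - x i s * y i.+1 s)
  (fun i => ly i * x i.+1 t + y i t * lx i.+1 - (lx i * y i.+1 t + x i t * ly i.+1))) => i.
by apply: qdiffB; exact: qdiffM.
Qed.

Lemma darea_scalex (R : realType) (N : nat) (c : R) (x y : nat -> R) :
  darea N (fun i => c * x i) y = c * darea N x y.
Proof.
rewrite /darea mulrCA; congr (_ * _); rewrite mulr_sumr; apply: eq_bigr => i _; ring.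
Qed.

Lemma qdiff_near_periodic (R : realType) (N : nat) (t B : R) (x : nat -> R -> R) (lx : nat -> R) :
  (0 < N)%N -> nperiodic N x -> (forall i, qdiff (x i) t (lx i)) ->
  (forall i, `|x i t| < B) ->
  exists2 d, 0 < d & forall i s, `|s| <= d -> `|x i (t + s)| <= B.
Proof.
move=> N0 px qx xB.
have H n : exists2 d, 0 < d & forall i s, (i < n)%N -> `|s| <= d -> `|x i (t + s)| <= B.
  elim: n => [|n [d d0 Hd]]; first by exists 1.
  have [d' d0' H'] := qdiff_near (qx n) (xB n).
  exists (Num.min d d'); first by rewrite lt_min d0.
  move=> i s; rewrite ltnS leq_eqVlt le_min => /orP[/eqP ->|lin] /andP[s1 s2]; first exact: H'.
  exact: Hd.
have [d d0 Hd] := H N; exists d => // i s sd.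
by rewrite (nperiodic_mod px) Hd// ltn_pmod.
Qed.

(* The area constraint is restored by rescaling the [x]-coordinate; the test
   variation is the constrained gradient itself. *)
Lemma discrete_euler_lagrange (R : realType) (Q1 Q1x Q1y Q2 Q2x Q2y : R -> R -> R)
    (B M tau d : R) (N : nat) (x y : nat -> R) :
  c11 Q1 Q1x Q1y B -> c11 Q2 Q2x Q2y B -> M <= B -> tau != 0 -> 0 < d -> (0 < N)%N ->
  nperiodic N x -> nperiodic N y ->
  (forall i, `|x i| < M) -> (forall i, `|y i| < M) ->
  darea N x y = tau -> dirichlet N x y = d ^+ 2 ->
  (forall x' y', admissible N M tau x' y' ->
    d + wfun Q1 Q2 N x y <= Num.sqrt (dirichlet N x' y') + wfun Q1 Q2 N x' y') ->
  let Gx i := N%:R / d * (2 * x i.+1 - x i - x i.+2) + 1 / 2 * wgx Q1x Q2 Q2x x y i in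
  let Gy i := N%:R / d * (2 * y i.+1 - y i - y i.+2) + 1 / 2 * wgy Q1 Q1y Q2y x y i in
  exists2 lam, lam * tau = \sum_(i < N) x i.+1 * Gx i &
    forall i, Gx i + lam / 2 * (y i.+2 - y i) = 0 /\ Gy i - lam / 2 * (x i.+2 - x i) = 0.
Proof.
move=> c1 c2 MB tau0 d0 N0 px py xM yM ar dE Hmin Gx Gy.
pose lam := (\sum_(i < N) x i.+1 * Gx i) / tau.
have lamE : lam * tau = \sum_(i < N) x i.+1 * Gx i by rewrite /lam divfK.
exists lam => //.
pose gx i := Gx i + lam / 2 * (y i.+2 - y i).
pose gy i := Gy i - lam / 2 * (x i.+2 - x i).
have pGx i : Gx (i + N)%N = Gx i by rewrite /Gx /wgx -!addSn !px !py.
have pGy i : Gy (i + N)%N = Gy i by rewrite /Gy /wgy -!addSn !px !py.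
have pgx i : gx (i + N)%N = gx i by rewrite /gx pGx -!addSn !py.
have pgy i : gy (i + N)%N = gy i by rewrite /gy pGy -!addSn !px.
(* The gradient at index [i] belongs to vertex [i.+1]; adding [N.-1] realizes the shift by minus one
   through periodicity. *)
pose fx i := gx (i + N.-1)%N; pose fy i := gy (i + N.-1)%N.
have fxS i : fx i.+1 = gx i by rewrite /fx addSnnS prednK// pgx.
have fyS i : fy i.+1 = gy i by rewrite /fy addSnnS prednK// pgy.
have pfx i : fx (i + N)%N = fx i by rewrite /fx addnAC pgx.
have pfy i : fy (i + N)%N = fy i by rewrite /fy addnAC pgy.
have qlin (a b : R) : qdiff (fun s => a + s * b) 0 b.
  have := qdiffD (qdiff_cst a 0) (qdiffM (qdiff_id 0) (qdiff_cst b 0)).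
  by rewrite /= mulr0 addr0 add0r mul1r.
pose D s := darea N (fun i => x i + s * fx i) (fun i => y i + s * fy i).
pose dD := 1 / 2 * \sum_(i < N) (fy i.+1 * (x i.+2 - x i) - fx i.+1 * (y i.+2 - y i)).
have qD : qdiff D 0 dD.
  have := @qdiff_darea R N 0 (fun i s => x i + s * fx i) (fun i s => y i + s * fy i) fx fy.
  move=> H; have := H _ _ pfx pfy (fun i => qlin _ _) (fun i => qlin _ _) => {}H.
  have -> : dD = 1 / 2 * \sum_(i < N) (fy i.+1 * (x i.+2 + 0 * fx i.+2 - (x i + 0 * fx i)) -
           fx i.+1 * (y i.+2 + 0 * fy i.+2 - (y i + 0 * fy i))).
    by congr (_ * _); apply: eq_bigr => i _; rewrite !mul0r !addr0.
  by apply: H => i; apply/funext => s; rewrite ?px ?py ?pfx ?pfy.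
have D0 : D 0 = tau.
  rewrite /D -ar; congr darea; apply/funext => i; by rewrite mul0r addr0.
(* Scaling [x] by [c s] multiplies the area by [c s], so the perturbed polygon has area [tau] as
   long as [D s] is nonzero. *)
pose c s := tau * (D s)^-1.
have c00 : c 0 = 1 by rewrite /c D0 divff.
have qc : qdiff c 0 (- dD / tau).
  have := qdiffZ tau (qdiff_inv qD _); rewrite D0 => /(_ tau0); congr qdiff.
  by field.
pose X i s := c s * (x i + s * fx i); pose Y i s := y i + s * fy i.
pose lx i := - dD / tau * x i + fx i.
have qX i : qdiff (X i) 0 (lx i).
  have := qdiffM qc (qlin (x i) (fx i)).
  by rewrite mul0r addr0 c00 mul1r.
have qY i : qdiff (Y i) 0 (fy i) by exact: qlin.
have pX i : X (i + N)%N = X i by apply/funext => s; rewrite /X px pfx.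
have pY i : Y (i + N)%N = Y i by apply/funext => s; rewrite /Y py pfy.
have plx i : lx (i + N)%N = lx i by rewrite /lx px pfx.
have X0 i : X i 0 = x i by rewrite /X c00 mul1r mul0r addr0.
have Y0 i : Y i 0 = y i by rewrite /Y mul0r addr0.
have X0' : (fun i => X i 0) = x by apply/funext.
have Y0' : (fun i => Y i 0) = y by apply/funext.
have xB i : `|X i 0| < B by rewrite X0; exact: lt_le_trans (xM i) MB.
have yB i : `|Y i 0| < B by rewrite Y0; exact: lt_le_trans (yM i) MB.
have qW := wfun_qdiff c1 c2 pX pY plx pfy qX qY xB yB.
have qE := qdiff_dirichlet pX pY plx pfy qX qY.
have qF := qdiffD (qdiffZ ((2 * d)^-1) qE) qW.
have [e1 e10 He1] := qdiff_near_periodic N0 pX qX (fun i => eq_ind_r (fun z => `|z| < M) (xM i) (X0 i)).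
have [e2 e20 He2] := qdiff_near_periodic N0 pY qY (fun i => eq_ind_r (fun z => `|z| < M) (yM i) (Y0 i)).
have [C [e3 [C0 e30 e31 He3]]] := qdiff_lip qD.
have C1 : 0 < C + 1 by rewrite ltr_wpDl.
pose e4 := `|tau| / 2 / (C + 1).
have t0 : 0 < `|tau| by rewrite normr_gt0.
have e40 : 0 < e4 by rewrite !divr_gt0.
pose e := Num.min (Num.min e1 e2) (Num.min e3 e4).
have e0 : 0 < e by rewrite !lt_min e10 e20 e30 e40.
have D00 : 0 < 2 * d by rewrite mulr_gt0.
have := qdiff_min qF e0; rewrite X0' Y0' dE => Hq.
have {}Hq := Hq _.
have fmin s : `|s| <= e ->
   (2 * d)^-1 * d ^+ 2 + wfun Q1 Q2 N x y <=
   (2 * d)^-1 * dirichlet N (fun i => X i (0 + s)) (fun i => Y i (0 + s)) +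
        wfun Q1 Q2 N (fun i => X i (0 + s)) (fun i => Y i (0 + s)).
  rewrite !le_min => /andP[/andP[s1 s2] /andP[s3 s4]].
  have DS : D (0 + s) != 0.
    have := He3 _ s3; rewrite D0 => h; apply/eqP => z.
    rewrite z sub0r normrN in h.
    move: s4; rewrite /e4 ler_pdivlMr// => s4; have := normr_ge0 s; move: h s4 t0; clear; lra.
  have ar' : darea N (fun i => X i (0 + s)) (fun i => Y i (0 + s)) = tau.
    rewrite (darea_scalex N (c (0 + s)) (fun i => x i + (0 + s) * fx i)) -/(D _) /c divfK//.
  have := Hmin (fun i => X i (0 + s)) (fun i => Y i (0 + s)).
  set Dr := dirichlet _ _ _; set W := wfun _ _ _ _ _; set W' := wfun _ _ _ _ _.
  have Dr0 : 0 <= Dr by rewrite mulr_ge0// sumr_ge0// => i _; rewrite addr_ge0 ?sqr_ge0.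
  (* The square root lies below an affine function of [Dr] that touches it at [d ^+ 2]; the polygon
     thus also minimizes, locally, a functional to which the [qdiff] calculus applies. *)
  have amgm : Num.sqrt Dr <= (2 * d)^-1 * Dr + d / 2.
    rewrite -(ler_pM2l D00) mulrDr mulVKf ?gt_eqF//.
    have := sqr_ge0 (Num.sqrt Dr - d); rewrite sqrrB sqr_sqrtr// !expr2.
    have -> : 2 * d * (d / 2) = d * d by field.
    rewrite -mulr_natl; lra.
  have -> : (2 * d)^-1 * d ^+ 2 = d / 2 by field; rewrite gt_eqF.
  move=> h.
  suff : d + W <= Num.sqrt Dr + W' by move: amgm; clear; lra.
  by apply: h; split=> // [|i|i]; [split=> i; rewrite ?pX ?pY|exact: He1|exact: He2].
have {}Hq := Hq fmin.
(* Along this variation the derivative is the sum of squares of the constrained gradient: by the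
   choice of [lam], the rescaling contributes [- lam * dD], which is the multiplier term. *)
have S0 : \sum_(i < N) (gx i ^+ 2 + gy i ^+ 2) = 0.
  have S1 : \sum_(i < N) (lx i.+1 * Gx i + fy i.+1 * Gy i) = 0.
    rewrite -[RHS]Hq !mulr_sumr -big_split/=; apply: eq_bigr => i _.
    rewrite !X0 !Y0 /Gx /Gy; field; rewrite gt_eqF//.
  rewrite -[RHS]S1 [RHS](eq_bigr (fun i : 'I_N => - dD / tau * (x i.+1 * Gx i) + (fx i.+1 * Gx i + fy i.+1 * Gy i))); last first.
    move=> i _; rewrite /lx; ring.
  rewrite [RHS]big_split/= -mulr_sumr -lamE.
  have -> : - dD / tau * (lam * tau) = - lam * dD by field.
  rewrite /dD mulrA mulr_sumr -big_split/=; apply: eq_bigr => i _.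
  by rewrite fxS fyS /gx /gy; ring.
move=> i.
have gi : gx (i %% N)%N ^+ 2 + gy (i %% N)%N ^+ 2 = 0.
  have /psumr_eq0P := S0; move=> /(_ (fun i _ => addr_ge0 (sqr_ge0 _) (sqr_ge0 _))).
  by move=> /(_ (Ordinal (ltn_pmod i N0)) isT).
move: gi; rewrite -(nperiodic_mod pgx) -(nperiodic_mod pgy) => /eqP; rewrite paddr_eq0 ?sqr_ge0//.
by rewrite !sqrf_eq0 => /andP[/eqP h1 /eqP h2].
Qed.

(* A regular polygon in the region where [tau * H] is negative has energy below
   the isoperimetric value, while far away [H] is too small to compensate the
   isoperimetric deficit; hence minimizers stay away from the box boundary. *)
Lemma minimizer_interior (R : realType) (Q1 Q1x Q1y Q2 Q2x Q2y : R -> R -> R)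
    (H : R * R -> R) (B C M L K0 c1 c2 tau del del1 zeta : R) (k : nat) :
  taylor2 Q1 Q1x Q1y B C -> taylor2 Q2 Q2x Q2y B C -> 0 <= C ->
  (forall u v a b, `|Q1 u v * a + Q2 u v * b| <= 37 / 38 * enorm (a, b)) ->
  (forall u v, `|u| <= B -> `|v| <= B -> `|Q1x u v + Q2y u v - H (u, v)| <= zeta) ->
  tau != 0 -> 38 * (6 * Num.sqrt `|tau|) <= L -> 0 < del -> 0 <= zeta -> 0 <= del1 ->
  (forall u v, (u - c1) ^+ 2 + (v - c2) ^+ 2 <= `|tau| -> tau * H (u, v) <= - (`|tau| * del)) ->
  (forall u v, K0 <= `|u| \/ K0 <= `|v| -> `|H (u, v)| <= del1) ->
  K0 + L <= M -> `|c1| + Num.sqrt `|tau| <= M -> `|c2| + Num.sqrt `|tau| <= M -> M < B ->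
  zeta <= del / 4 -> L ^+ 2 * del1 <= `|tau| * del / 8 -> L ^+ 2 * zeta <= `|tau| * del / 8 ->
  (0 < k)%N -> let N := (4 * k)%N in 2 * L * C * L ^+ 2 / N%:R <= `|tau| * del / 8 ->
  exists x y d,
   [/\ nperiodic N x /\ nperiodic N y,
       (forall i, `|x i| < M) /\ (forall i, `|y i| < M),
       darea N x y = tau /\ dirichlet N x y = d ^+ 2,
       2 * Num.sqrt `|tau| <= d <= L &
       forall x' y', admissible N M tau x' y' ->
        d + wfun Q1 Q2 N x y <= Num.sqrt (dirichlet N x' y') + wfun Q1 Q2 N x' y'].
Proof.
move=> T1 T2 C0 Qk Hdiv tau0 sL del0 z0 del10 Hdisc Hfar KL cM1 cM2 MB zd Ld Lz k0 N NL.
set s := Num.sqrt `|tau| in sL cM1 cM2 *.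
have t0 : 0 < `|tau| by rewrite normr_gt0.
have s0 : 0 < s by rewrite sqrtr_gt0.
have ss : s ^+ 2 = `|tau| by rewrite sqr_sqrtr.
have L0 : 0 < L by apply: lt_le_trans sL; rewrite !mulr_gt0.
have s_le_L : s <= L by move: sL s0; clear; lra.
have N0 : (0 < N)%N by rewrite muln_gt0.
have N0R : 0 < N%:R :> R by rewrite ltr0n.
have [x0 [y0 [[px0 py0] ar0 [mom0 r0] dE0 /andP[dl du]]]] := regular_polygon c1 c2 k0 tau0.
rewrite -/N in px0 py0 ar0 mom0 dE0 dl du.
pose m := Num.sqrt (dirichlet N x0 y0).
have D0 : 0 <= dirichlet N x0 y0 by apply: le_trans dl; rewrite mulr_ge0.
have mE : dirichlet N x0 y0 = m ^+ 2 by rewrite sqr_sqrtr.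
have m0 : 0 <= m by exact: sqrtr_ge0.
have m6 : m <= 6 * s.
  rewrite -(@ler_pXn2r _ 2%N) ?nnegrE ?mulr_ge0 ?(ltW s0)// -mE exprMn ss.
  apply: le_trans du _; rewrite ler_pM2r// expr2; clear; lra.
have mL : m ^+ 2 <= L ^+ 2.
  rewrite ler_pXn2r ?nnegrE// ?(ltW L0)//; move: m6 sL s0; clear; lra.
have coord a b c : (a - c) ^+ 2 + b ^+ 2 <= `|tau| -> `|a - c| <= s.
  move=> h; rewrite -(@ler_pXn2r _ 2%N) ?nnegrE// ?(ltW s0)// ss real_normK ?num_real//.
  by apply: le_trans h; rewrite lerDl sqr_ge0.
have xs i : `|x0 i - c1| <= s by exact: coord (r0 i).
have ys i : `|y0 i - c2| <= s.
  by apply: (coord _ (x0 i - c1)); rewrite addrC.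
have xM0 i : `|x0 i| <= M.
  apply: le_trans cM1; rewrite -[x0 i](subrK c1) addrC; apply: le_trans (ler_normD _ _) _.
  by rewrite lerD2l.
have yM0 i : `|y0 i| <= M.
  apply: le_trans cM2; rewrite -[y0 i](subrK c2) addrC; apply: le_trans (ler_normD _ _) _.
  by rewrite lerD2l.
have c1B : `|c1| < B by apply: le_lt_trans MB; apply: le_trans cM1; rewrite lerDl ltW.
have c2B : `|c2| < B by apply: le_lt_trans MB; apply: le_trans cM2; rewrite lerDl ltW.
have err (a : R) : 0 <= a <= L ^+ 2 -> 2 * L * C * a / N%:R <= `|tau| * del / 8.
  move=> /andP[a0 aL]; apply: le_trans NL; rewrite ler_pM2r ?invr_gt0//.
  by apply: ler_wpM2l => //; rewrite !mulr_ge0// ltW.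
(* Contraction to the centre stays in the disc where [tau * H <= - |tau| del]. The flux is at most
   [- |tau| (del - zeta)] plus an error [|tau| del / 8], and [zeta <= del / 4] leaves 1 - 1/4 - 1/8
   = 5/8. *)
have W0 : wfun Q1 Q2 N x0 y0 <= - (5 / 8 * (`|tau| * del)).
  have := @wfun_homotopy R Q1 Q1x Q1y Q2 Q2x Q2y B C c1 c2 L m 1
    (- (2 * (`|tau| * (del - zeta)))) N x0 y0 (fun=> 4 / N%:R * (- (`|tau| * (del - zeta)))) N0 C0 T1 T2 px0 py0
    (fun i => le_lt_trans (xM0 i) MB) (fun i => le_lt_trans (yM0 i) MB) c1B c2B
    (fun i => le_trans (xs i) s_le_L) (fun i => le_trans (ys i) s_le_L) mE.
  rewrite normr1 lexx => /(_ isT) h.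
  have {}h : wfun Q1 Q2 N x0 y0 <= - (2 * (`|tau| * (del - zeta))) / 2 + 2 * L * C * m ^+ 2 / N%:R.
    rewrite -[wfun _ _ _ _ _]mul1r; apply: h.
      move=> i q /andP[q0 q1]; rewrite mul1r mom0.
      set u := c1 + _; set v := c2 + _.
      have sqle (a : R) : (q * a) ^+ 2 <= a ^+ 2.
        by rewrite exprMn ler_piMl ?sqr_ge0// exprn_ile1.
      have uv : (u - c1) ^+ 2 + (v - c2) ^+ 2 <= `|tau|.
        apply: le_trans (r0 i.+1); rewrite /u /v ![_ + _ * _ - _]addrC !addrA !addNr !add0r.
        by apply: lerD; exact: sqle.
      have uB : `|u| <= B.
        apply: le_trans (ltW MB); apply: le_trans cM1; rewrite -[u](subrK c1) addrC.
        apply: le_trans (ler_normD _ _) _; rewrite lerD2l; exact: coord uv.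
      have vB : `|v| <= B.
        apply: le_trans (ltW MB); apply: le_trans cM2; rewrite -[v](subrK c2) addrC.
        apply: le_trans (ler_normD _ _) _; rewrite lerD2l; apply: (coord _ (u - c1)).
        by rewrite addrC.
      rewrite [_ * (4 * tau / _)]mulrC -mulrA [4 / _]mulrC -mulrA.
      have -> : 4 * (tau / N%:R * (Q1x u v + Q2y u v)) = N%:R^-1 * (4 * (tau * (Q1x u v + Q2y u v))) by ring.
      rewrite -[N%:R^-1 * 4 * _]mulrA.
      rewrite ler_pM2l ?invr_gt0// ler_pM2l//.
      have h1 := Hdisc _ _ uv; have h2 := Hdiv _ _ uB vB.
      have h3 : tau * (Q1x u v + Q2y u v - H (u, v)) <= `|tau| * zeta.
        by apply: le_trans (ler_norm _) _; rewrite normrM ler_wpM2l.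
      rewrite mulrBr in h3; rewrite mulrBr; move: h1 h3; clear; lra.
    rewrite sumr_const card_ord -[_ *+ N]mulr_natl.
    have -> : 1 / 2 * (N%:R * (4 / N%:R * - (`|tau| * (del - zeta)))) = - (2 * (`|tau| * (del - zeta))).
      by field; rewrite gt_eqF.
    exact: lexx.
  have e := err _ (introT andP (conj (sqr_ge0 m) mL)).
  have : `|tau| * zeta <= `|tau| * (del / 4) by rewrite ler_pM2l.
  move: h e; rewrite !mulrBr; set w := wfun _ _ _ _ _; set z := _ / N%:R; clear; lra.
have cc1 : c11 Q1 Q1x Q1y B by exists C.
have cc2 : c11 Q2 Q2x Q2y B by exists C.
have [|x [y [[[px py] xM yM ar] Hmin]]] := @discrete_minimizer R Q1 Q1x Q1y Q2 Q2x Q2y B M tau (37/38) N x0 y0 cc1 cc2 (ltW MB) _ Qk (And4 (conj px0 py0) xM0 yM0 ar0).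
  by apply/andP; clear; split; lra.
pose d := Num.sqrt (dirichlet N x y).
have D : 0 <= dirichlet N x y.
  by rewrite mulr_ge0// sumr_ge0// => i _; rewrite addr_ge0 ?sqr_ge0.
have dE : dirichlet N x y = d ^+ 2 by rewrite sqr_sqrtr.
have d0 : 0 <= d by exact: sqrtr_ge0.
have E1 : d + wfun Q1 Q2 N x y <= m + wfun Q1 Q2 N x0 y0.
  by apply: Hmin.
have K0' : (0 : R) <= 37 / 38 by clear; lra.
have := wfun_bound d0 dE px py K0' Qk; rewrite ler_norml => /andP[W1 W2].
have g0 : 0 < `|tau| * del by rewrite mulr_gt0.
(* The energy of the minimizer is at least [d - 37/38 d], and at most [m] because the competitor has
   negative flux. *)
have d38 : d <= 38 * m.
  move: E1 W0 W1 g0; set w := wfun _ _ _ _ _; set w' := wfun _ _ _ _ _; clear; lra.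
have dL : d <= L by move: d38 m6 sL; clear; lra.
(* The regular polygon attains equality in the isoperimetric inequality for the same area. *)
have md : m <= d.
  rewrite -(@ler_pXn2r _ 2%N) ?nnegrE// -mE dE0 -dE.
  have -> : N = (2 * k).*2 by rewrite /N -mul2n mulnA.
  rewrite -ar; have -> : N = (2 * k).*2 by rewrite /N -mul2n mulnA.
  apply: isoperimetric; first by rewrite mul2n -addnn -[2%N]/(1 + 1)%N leq_add.
    by have -> : (2 * k).*2 = N by rewrite /N -mul2n mulnA.
  by have -> : (2 * k).*2 = N by rewrite /N -mul2n mulnA.
have WN : 5 / 8 * (`|tau| * del) <= - wfun Q1 Q2 N x y.
  move: E1 W0 md; set w := wfun _ _ _ _ _; set w' := wfun _ _ _ _ _; clear; lra.
have sd : 2 * s <= d.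
  apply: le_trans md; rewrite -(@ler_pXn2r _ 2%N) ?nnegrE ?mulr_ge0 ?(ltW s0)// -mE exprMn ss.
  apply: le_trans dl; rewrite ler_pM2r// expr2; clear; lra.
have xd i j : `|x i - x j| <= d by exact: (periodic_diam N0 px (sum_dx_le d0 dE)).
have yd i j : `|y i - y j| <= d by exact: (periodic_diam N0 py (sum_dy_le d0 dE)).
have xB i : `|x i| < B by exact: le_lt_trans (xM i) MB.
have yB i : `|y i| < B by exact: le_lt_trans (yM i) MB.
(* A polygon reaching the boundary varies by at most [d <= L] in each coordinate, so [K0 + L <= M]
   keeps it and its contractions to vertex 0 where [|H| <= del1]. Minus its flux is then at most
   [d^2 (del1 + zeta)] plus the Taylor error, in all 3/8 of [|tau| del], against the 5/8 of [WN]. *)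
have inside : ~ (exists i, M <= `|x i| \/ M <= `|y i|).
  move=> [i0 far].
  have := @wfun_homotopy R Q1 Q1x Q1y Q2 Q2x Q2y B C (x 0%N) (y 0%N) L d (- 1)
    (2 * d ^+ 2 * (del1 + zeta)) N x y (fun i => (del1 + zeta) * `|moment (x 0%N) (y 0%N) x y i|) N0 C0 T1 T2 px py
    xB yB (xB _) (yB _)
    (fun i => le_trans (xd i 0%N) dL) (fun i => le_trans (yd i 0%N) dL) dE.
  rewrite normrN1 lexx => /(_ isT) h.
  have {}h : - wfun Q1 Q2 N x y <= 2 * d ^+ 2 * (del1 + zeta) / 2 + 2 * L * C * d ^+ 2 / N%:R.
    rewrite -mulN1r; apply: h.
      move=> i q /andP[q0 q1]; set u := x 0%N + _; set v := y 0%N + _.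
      have cvx (z : nat -> R) (S : R) : (forall i j, `|z i - z j| <= d) -> (forall i, `|z i| <= S) ->
          `|z 0%N + q * (z i.+1 - z 0%N) - z i0| <= d /\ `|z 0%N + q * (z i.+1 - z 0%N)| <= S.
        move=> z1 zS; have q1' : 0 <= 1 - q by rewrite subr_ge0.
        have -> : z 0%N + q * (z i.+1 - z 0%N) - z i0 = (1 - q) * (z 0%N - z i0) + q * (z i.+1 - z i0) by ring.
        have -> : z 0%N + q * (z i.+1 - z 0%N) = (1 - q) * z 0%N + q * z i.+1 by ring.
        have a1 (a b S' : R) : `|a| <= S' -> `|b| <= S' -> `|(1 - q) * a + q * b| <= S'.
          move=> aS bS; apply: le_trans (ler_normD _ _) _; rewrite !normrM (ger0_norm q0) (ger0_norm q1').
          by have := ler_wpM2l q1' aS; have := ler_wpM2l q0 bS; clear; lra.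
        by split; apply: a1.
      have [u1 u2] := cvx x M xd xM; have [v1 v2] := cvx y M yd yM.
      rewrite -/u in u1 u2; rewrite -/v in v1 v2.
      have Huv : `|H (u, v)| <= del1.
        have near (a b : R) : M <= `|a| -> `|b - a| <= d -> K0 <= `|b|.
          move=> Ma ba; have : `|a| <= `|b| + `|b - a|.
            by rewrite -{1}[a](subKr b); apply: ler_normB.
          by move: Ma ba dL KL; clear; lra.
        apply: Hfar; case: far => far; [left|right]; exact: near far _.
      have h2 := Hdiv u v (le_trans u2 (ltW MB)) (le_trans v2 (ltW MB)).
      have h3 : `|Q1x u v + Q2y u v| <= del1 + zeta.
        rewrite -[X in `|X|](subrK (H (u, v))); apply: le_trans (ler_normD _ _) _.
        by rewrite addrC lerD.
      apply: le_trans (ler_norm _) _; rewrite mulN1r normrM normrN ler_wpM2r//.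
    rewrite -mulr_sumr.
    have : \sum_(i < N) `|moment (x 0%N) (y 0%N) x y i| <=
       \sum_(i < N) (d * (`|x i.+2 - x i.+1| + `|x i.+1 - x i|) + d * (`|y i.+2 - y i.+1| + `|y i.+1 - y i|)).
      apply: ler_sum => i _; rewrite /moment; apply: le_trans (ler_normB _ _) _.
      rewrite !normrM; apply: lerD; apply: ler_pM => //.
        exact: ler_distD.
      exact: ler_distD.
    rewrite big_split/= -!mulr_sumr !big_split/=.
    rewrite (sum_shift (f := fun i => `|x i.+1 - x i|)); last by move=> i; rewrite -!addSn !px.
    rewrite (sum_shift (f := fun i => `|y i.+1 - y i|)); last by move=> i; rewrite -!addSn !py.
    have := sum_dx_le d0 dE; have := sum_dy_le d0 dE.
    set X := \sum_(i < N) _; set Y := \sum_(i < N) _; set Z := \sum_(i < N) _ => hx hy hm.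
    have hX := ler_wpM2l d0 hx; have hY := ler_wpM2l d0 hy.
    have hZ : Z <= 4 * d ^+ 2 by rewrite expr2; move: hm hX hY; clear; lra.
    have := ler_wpM2l (addr_ge0 del10 z0) hZ; clear; lra.
  have dL2 : d ^+ 2 <= L ^+ 2 by rewrite ler_pXn2r ?nnegrE ?(ltW L0)//.
  have e := err _ (introT andP (conj (sqr_ge0 d) dL2)).
  have e1 := ler_wpM2r del10 dL2; have e2 := ler_wpM2r z0 dL2.
  move: h e e1 e2 Ld Lz WN g0; set w := wfun _ _ _ _ _; set z := 2 * L * C * d ^+ 2 / N%:R.
  clear; lra.
exists x, y, d; split=> //.
- by split=> i; rewrite ltNge; apply/negP => h; apply: inside; exists i; [left|right].
- by rewrite sd dL.
Qed.

(** * Bounds uniform in the number of vertices *)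

Lemma periodic_mean (R : realType) (N : nat) (f : nat -> R) (S : R) : (0 < N)%N ->
  nperiodic N f -> \sum_(i < N) `|f i.+1 - f i| <= S ->
  forall i, `|N%:R * f i - \sum_(j < N) f j| <= N%:R * S.
Proof.
move=> N0 pf H i; have D := periodic_diam N0 pf H.
have -> : N%:R * f i - \sum_(j < N) f j = \sum_(j < N) (f i - f j).
  by rewrite sumrB sumr_const card_ord mulr_natl.
apply: le_trans (ler_norm_sum _ _ _) _.
have -> : N%:R * S = \sum_(j < N) S by rewrite sumr_const card_ord mulr_natl.
exact: ler_sum.
Qed.

(** The velocities [N (z i.+1 - z i)] have mean zero over a period, and the difference equation
    bounds their total variation; each velocity is therefore bounded by that variation. *)
Lemma discrete_velocity_bound (R : realType) (N : nat) (x y z : nat -> R) (C d a b L : R) :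
  (0 < N)%N -> nperiodic N x -> nperiodic N y ->
  nperiodic N z -> 0 <= C -> 0 <= a -> 0 <= b ->
  0 <= d <= L -> dirichlet N x y = d ^+ 2 -> 2 * C * L ^+ 2 / N%:R <= b ->
  (forall i, `|N%:R * (z i.+2 - 2 * z i.+1 + z i)| <=
     d / 2 * (a * (`|x i.+1 - x i| + `|y i.+1 - y i| + (`|x i.+2 - x i.+1| + `|y i.+2 - y i.+1|))
              + C * (esq x y i + esq x y i.+1))) ->
  forall i, N%:R * `|z i.+1 - z i| <= L / 2 * (4 * a * L + b).
Proof.
move=> N0 px py pz C0 a0 b0 /andP[d0 dL] dE Cb H.
have N0R : 0 < N%:R :> R by rewrite ltr0n.
have L0 : 0 <= L := le_trans d0 dL.
pose v i := N%:R * (z i.+1 - z i).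
have pv i : v (i + N)%N = v i by rewrite /v -!addSn !pz.
have S : \sum_(i < N) `|v i.+1 - v i| <= L / 2 * (4 * a * L + b).
  apply: (@le_trans _ _ (\sum_(i < N) (d / 2 * (a * (`|x i.+1 - x i| + `|y i.+1 - y i| + (`|x i.+2 - x i.+1| + `|y i.+2 - y i.+1|))
              + C * (esq x y i + esq x y i.+1))))).
    apply: ler_sum => i _; have -> : v i.+1 - v i = N%:R * (z i.+2 - 2 * z i.+1 + z i) by rewrite /v; ring.
    exact: H.
  rewrite -mulr_sumr big_split/= -!mulr_sumr sum_esq2// dE.
  rewrite big_split/= (sum_shift (f := fun i => `|x i.+1 - x i| + `|y i.+1 - y i|)); last first.
    by move=> i; rewrite -!addSn !px !py.
  rewrite big_split/=; have := sum_dx_le d0 dE; have := sum_dy_le d0 dE.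
  set X := \sum_(i < N) _; set Y := \sum_(i < N) _ => hx hy.
  have h1 : a * (Y + X + (Y + X)) <= 4 * a * L.
    rewrite -mulrA mulrCA ler_wpM2l//; move: hx hy dL; clear; lra.
  have h2 : C * (2 * d ^+ 2 / N%:R) <= b.
    apply: le_trans Cb; have -> : C * (2 * d ^+ 2 / N%:R) = 2 * C * d ^+ 2 / N%:R by ring.
    rewrite ler_pM2r ?invr_gt0//; apply: ler_wpM2l; first by rewrite mulr_ge0.
    by rewrite ler_pXn2r ?nnegrE.
  apply: ler_pM; [by rewrite divr_ge0| |by rewrite ler_pM2r ?invr_gt0|exact: lerD].
  apply: addr_ge0; first by rewrite mulr_ge0// !addr_ge0// sumr_ge0.
  by rewrite mulr_ge0// divr_ge0// ?mulr_ge0 ?sqr_ge0// ltW.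
move=> i; have := periodic_mean N0 pv S i.
have -> : \sum_(j < N) v j = 0.
  rewrite -mulr_sumr sum_telescope; have -> : z N = z 0%N by rewrite -[N]add0n pz.
  by rewrite subrr mulr0.
rewrite subr0 normrM ger0_norm// ler_pM2l// /v normrM ger0_norm//.
Qed.

(** [V1] and [V] contain neither [C] nor [zeta] nor [N]. The multiplier is estimated through [lamE]:
    after summation by parts the second differences contribute a nonnegative quantity that is at
    most [d]. *)
Lemma discrete_curve_estimates (R : realType) (Q1 Q1x Q1y Q2 Q2x Q2y : R -> R -> R)
    (H : R * R -> R) (B C B0 M L tau zeta d lam : R) (N : nat) (x y : nat -> R) :
  taylor2 Q1 Q1x Q1y B C -> taylor2 Q2 Q2x Q2y B C -> 0 <= C ->
  (forall u v, `|u| <= B -> `|v| <= B -> `|Q1x u v + Q2y u v - H (u, v)| <= zeta) ->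
  (forall p, `|H p| <= B0) -> M <= B ->
  tau != 0 -> 0 <= zeta <= 1 -> (0 < N)%N -> 2 * C * L ^+ 2 / N%:R <= 1 ->
  nperiodic N x -> nperiodic N y ->
  (forall i, `|x i| <= M) -> (forall i, `|y i| <= M) ->
  dirichlet N x y = d ^+ 2 -> 0 < d <= L ->
  let Gx i := N%:R / d * (2 * x i.+1 - x i - x i.+2) + 1 / 2 * wgx Q1x Q2 Q2x x y i in
  let Gy i := N%:R / d * (2 * y i.+1 - y i - y i.+2) + 1 / 2 * wgy Q1 Q1y Q2y x y i in
  lam * tau = \sum_(i < N) x i.+1 * Gx i ->
  (forall i, Gx i + lam / 2 * (y i.+2 - y i) = 0 /\ Gy i - lam / 2 * (x i.+2 - x i) = 0) ->
  let V1 := (L + M / 2 * (4 * (B0 + 1) * L + 1)) / `|tau| in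
  let V := L / 2 * (4 * (B0 + 1 + V1) * L + 1) in
  let er := L / 2 * (zeta * (2 * V) + C * (4 * V ^+ 2) / N%:R) / N%:R in
  [/\ `|lam| <= V1,
      forall i, N%:R * `|x i.+1 - x i| <= V, forall i, N%:R * `|y i.+1 - y i| <= V,
      forall i, `|N%:R * (x i.+2 - 2 * x i.+1 + x i)
                  + d / 2 * (H (x i.+1, y i.+1) - lam) * (y i.+2 - y i)| <= er &
      forall i, `|N%:R * (y i.+2 - 2 * y i.+1 + y i)
                  - d / 2 * (H (x i.+1, y i.+1) - lam) * (x i.+2 - x i)| <= er].
Proof.
move=> T1 T2 C0 Hdiv HB0 MB tau0 /andP[z0 z1] N0 CN px py xM yM dE /andP[d0 dL] Gx Gy lamE EL V1 V er.
have t0 : 0 < `|tau| by rewrite normr_gt0.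
have N0R : 0 < N%:R :> R by rewrite ltr0n.
have L0 : 0 < L := lt_le_trans d0 dL.
have B00 : 0 <= B0 := le_trans (normr_ge0 _) (HB0 (0, 0)).
have M0 : 0 <= M := le_trans (normr_ge0 _) (xM 0%N).
have V10 : 0 <= V1.
  rewrite divr_ge0// addr_ge0 ?(ltW L0)// mulr_ge0 ?divr_ge0// addr_ge0// mulr_ge0 ?(ltW L0)//.
  by rewrite mulr_ge0// addr_ge0.
have V0 : 0 <= V.
  rewrite mulr_ge0 ?divr_ge0 ?(ltW L0)// addr_ge0// mulr_ge0 ?(ltW L0)//.
  by rewrite mulr_ge0// !addr_ge0.
pose dv i := Q1x (x i.+1) (y i.+1) + Q2y (x i.+1) (y i.+1).
pose h i := H (x i.+1, y i.+1).
have xB i : `|x i| <= B := le_trans (xM i) MB.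
have yB i : `|y i| <= B := le_trans (yM i) MB.
have dvh i : `|dv i - h i| <= zeta by exact: Hdiv.
have dvB i : `|dv i| <= B0 + 1.
  rewrite -[dv i](subrK (h i)) addrC; apply: le_trans (ler_normD _ _) _.
  by apply: lerD; [exact: HB0|exact: le_trans (dvh i) z1].
have gxB i := wgx_bound Q1x i T2 xB yB.
have gyB i := wgy_bound Q2y i T1 xB yB.
have D2 (z : nat -> R) i : `|z i.+2 - z i| <= `|z i.+1 - z i| + `|z i.+2 - z i.+1|.
  by rewrite [leRHS]addrC; exact: ler_distD.
pose s i := `|x i.+1 - x i| + `|y i.+1 - y i| + (`|x i.+2 - x i.+1| + `|y i.+2 - y i.+1|).
have sx i : `|x i.+2 - x i| <= s i.
  apply: le_trans (D2 x i) _; rewrite /s; have := normr_ge0 (y i.+1 - y i); have := normr_ge0 (y i.+2 - y i.+1).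
  by clear; lra.
have sy i : `|y i.+2 - y i| <= s i.
  apply: le_trans (D2 y i) _; rewrite /s; have := normr_ge0 (x i.+1 - x i); have := normr_ge0 (x i.+2 - x i.+1).
  by clear; lra.
have EX i : N%:R * (x i.+2 - 2 * x i.+1 + x i) = d / 2 * (wgx Q1x Q2 Q2x x y i + lam * (y i.+2 - y i)).
  have [E _] := EL i; apply/eqP; rewrite -subr_eq0; apply/eqP.
  by rewrite -[RHS](mulr0 (- d)) -E /Gx; field; rewrite gt_eqF.
have EY i : N%:R * (y i.+2 - 2 * y i.+1 + y i) = d / 2 * (wgy Q1 Q1y Q2y x y i - lam * (x i.+2 - x i)).
  have [_ E] := EL i; apply/eqP; rewrite -subr_eq0; apply/eqP.
  by rewrite -[RHS](mulr0 (- d)) -E /Gy; field; rewrite gt_eqF.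
have nx i : `|wgx Q1x Q2 Q2x x y i| <= (B0 + 1) * s i + C * (esq x y i + esq x y i.+1).
  have -> : wgx Q1x Q2 Q2x x y i = (wgx Q1x Q2 Q2x x y i + dv i * (y i.+2 - y i)) - dv i * (y i.+2 - y i).
    by rewrite addrK.
  apply: le_trans (ler_normB _ _) _; rewrite addrC; apply: lerD; last exact: gxB.
  by rewrite normrM; apply: ler_pM.
have ny i : `|wgy Q1 Q1y Q2y x y i| <= (B0 + 1) * s i + C * (esq x y i + esq x y i.+1).
  have -> : wgy Q1 Q1y Q2y x y i = (wgy Q1 Q1y Q2y x y i - dv i * (x i.+2 - x i)) + dv i * (x i.+2 - x i).
    by rewrite subrK.
  apply: le_trans (ler_normD _ _) _; rewrite addrC; apply: lerD; last exact: gyB.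
  by rewrite normrM; apply: ler_pM.
have ss : \sum_(i < N) s i <= 4 * L.
  rewrite big_split/= (sum_shift (f := fun i => `|x i.+1 - x i| + `|y i.+1 - y i|)); last first.
    by move=> i; rewrite -!addSn !px !py.
  rewrite big_split/=; have := sum_dx_le (ltW d0) dE; have := sum_dy_le (ltW d0) dE.
  by move: dL; clear; lra.
have lamV : `|lam| <= V1.
  rewrite /V1 ler_pdivlMr// -normrM lamE.
  have S1 : \sum_(i < N) x i.+1 * (2 * x i.+1 - x i - x i.+2) = \sum_(i < N) (x i.+1 - x i) ^+ 2.
    pose g i := x i * (x i.+1 - x i).
    apply/eqP; rewrite -subr_eq0 -sumrB.
    rewrite (eq_bigr (fun i : 'I_N => - (g i.+1 - g i))); last by move=> i _; rewrite /g; ring.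
    by rewrite sumrN sum_telescope oppr_eq0 -[N]add0n /g -addSn !px subrr.
  have S2 : N%:R / d * \sum_(i < N) (x i.+1 - x i) ^+ 2 <= d.
    rewrite mulrAC ler_pdivrMr// -expr2 -dE ler_wpM2l//; apply: ler_sum => i _.
    by rewrite lerDl sqr_ge0.
  have S3 : \sum_(i < N) x i.+1 * Gx i = N%:R / d * \sum_(i < N) (x i.+1 - x i) ^+ 2
      + 1 / 2 * \sum_(i < N) x i.+1 * wgx Q1x Q2 Q2x x y i.
    rewrite -S1 !mulr_sumr -big_split/=; apply: eq_bigr => i _; rewrite /Gx; ring.
  rewrite S3; apply: le_trans (ler_normD _ _) _; apply: lerD.
    rewrite ger0_norm; first exact: le_trans S2 dL.
    by rewrite mulr_ge0 ?divr_ge0 ?(ltW d0)// sumr_ge0// => i _; rewrite sqr_ge0.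
  rewrite normrM ger0_norm//.
  have -> : M / 2 * (4 * (B0 + 1) * L + 1) = 1 / 2 * (M * (4 * (B0 + 1) * L + 1)) by ring.
  apply: ler_wpM2l => //; apply: le_trans (ler_norm_sum _ _ _) _.
  apply: (@le_trans _ _ (\sum_(i < N) M * ((B0 + 1) * s i + C * (esq x y i + esq x y i.+1)))).
    by apply: ler_sum => i _; rewrite normrM; apply: ler_pM.
  rewrite -mulr_sumr ler_wpM2l// big_split/= -!mulr_sumr sum_esq2// dE; apply: lerD.
    rewrite [4 * _]mulrC -mulrA; apply: ler_wpM2l ss; exact: addr_ge0.
  apply: le_trans CN; have -> : C * (2 * d ^+ 2 / N%:R) = 2 * C * d ^+ 2 / N%:R by ring.
  rewrite ler_pM2r ?invr_gt0//; apply: ler_wpM2l; first by rewrite mulr_ge0.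
  by rewrite ler_pXn2r ?nnegrE ?(ltW d0) ?(ltW L0).
have vx : forall i, N%:R * `|x i.+1 - x i| <= V.
  apply: (@discrete_velocity_bound R N x y x C d (B0 + 1 + V1) 1 L) => //.
  - by rewrite !addr_ge0.
  - by rewrite (ltW d0).
  move=> i; rewrite EX normrM ger0_norm ?divr_ge0 ?(ltW d0)// ler_pM2l ?divr_gt0//.
  apply: le_trans (ler_normD _ _) _; rewrite mulrDl addrAC; apply: lerD; first exact: nx.
  by rewrite normrM; apply: ler_pM.
have vy : forall i, N%:R * `|y i.+1 - y i| <= V.
  apply: (@discrete_velocity_bound R N x y y C d (B0 + 1 + V1) 1 L) => //.
  - by rewrite !addr_ge0.
  - by rewrite (ltW d0).
  move=> i; rewrite EY normrM ger0_norm ?divr_ge0 ?(ltW d0)// ler_pM2l ?divr_gt0//.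
  apply: le_trans (ler_normB _ _) _; rewrite mulrDl addrAC; apply: lerD; first exact: ny.
  by rewrite normrM; apply: ler_pM.
clearbody V V1.
have D2' (z : nat -> R) i : (forall i, N%:R * `|z i.+1 - z i| <= V) -> `|z i.+2 - z i| <= 2 * V / N%:R.
  move=> hz; apply: le_trans (D2 z i) _; rewrite ler_pdivlMr//.
  by have := hz i; have := hz i.+1; rewrite ![N%:R * _]mulrC; clear; lra.
have esqV i : esq x y i <= 2 * V ^+ 2 / N%:R ^+ 2.
  rewrite ler_pdivlMr ?exprn_gt0// /esq mulrDl -!exprMn.
  have sq (z : nat -> R) : N%:R * `|z i.+1 - z i| <= V -> ((z i.+1 - z i) * N%:R) ^+ 2 <= V ^+ 2.
    move=> hz; rewrite -real_normK ?num_real// ler_pXn2r ?nnegrE//.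
    by rewrite normrM mulrC [`|N%:R|]ger0_norm.
  by have := sq x (vx i); have := sq y (vy i); clear; lra.
have CV i : C * (esq x y i + esq x y i.+1) <= C * (4 * V ^+ 2) / N%:R / N%:R.
  rewrite -!mulrA ler_wpM2l//; have := esqV i; have := esqV i.+1.
  have -> : 2 * V ^+ 2 / N%:R ^+ 2 = 2 * (V ^+ 2 * (N%:R^-1 * N%:R^-1)) by field; rewrite gt_eqF.
  by clear; lra.
have fin a b c (e : R) : `|a| <= zeta -> `|b| <= 2 * V / N%:R -> `|c| <= C * (4 * V ^+ 2) / N%:R / N%:R ->
    e = d / 2 * (a * b + c) -> `|e| <= er.
  move=> ha hb hc ->; rewrite normrM ger0_norm ?divr_ge0 ?(ltW d0)//.
  have -> : er = L / 2 * (zeta * (2 * V / N%:R) + C * (4 * V ^+ 2) / N%:R / N%:R).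
    by rewrite /er; field; rewrite gt_eqF.
  apply: ler_pM => //; rewrite ?divr_ge0 ?(ltW d0)//; first by rewrite ler_pM2r ?invr_gt0.
  by apply: le_trans (ler_normD _ _) _; apply: lerD => //; rewrite normrM; apply: ler_pM.
split=> // i.
- apply: (fin (h i - dv i) (y i.+2 - y i) _ _ _ (D2' y i vy) (le_trans (gxB i) (CV i))).
    by rewrite distrC.
  by rewrite EX /h /dv; field.
- apply: (fin (dv i - h i) (x i.+2 - x i) _ _ _ (D2' x i vx) (le_trans (gyB i) (CV i))).
    exact: dvh.
  by rewrite EY /h /dv; field.
Qed.

Lemma taylor2_le (R : realType) (f fx fy : R -> R -> R) (B C D : R) : C <= D ->
  taylor2 f fx fy B C -> taylor2 f fx fy B D.
Proof.
move=> CD T x y x' y' h1 h2 h3 h4; apply: le_trans (T _ _ _ _ h1 h2 h3 h4) _.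
by rewrite ler_wpM2r// addr_ge0 ?sqr_ge0.
Qed.

(** A discrete conservation law: pairing the two equations with the central differences cancels the
    rotation terms exactly, so the squared speed changes only through the error; its mean is
    [d ^+ 2]. *)
Lemma speed_almost_constant (R : realType) (N : nat) (x y : nat -> R) (a : nat -> R) (d V er : R) :
  (0 < N)%N -> nperiodic N x -> nperiodic N y ->
  dirichlet N x y = d ^+ 2 ->
  (forall i, N%:R * `|x i.+1 - x i| <= V) -> (forall i, N%:R * `|y i.+1 - y i| <= V) ->
  (forall i, `|N%:R * (x i.+2 - 2 * x i.+1 + x i) + a i * (y i.+2 - y i)| <= er) ->
  (forall i, `|N%:R * (y i.+2 - 2 * y i.+1 + y i) - a i * (x i.+2 - x i)| <= er) ->
  forall i, `|N%:R ^+ 2 * esq x y i - d ^+ 2| <= 4 * V * (N%:R * er).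
Proof.
move=> N0 px py dE vx vy ex ey i; have N0R : 0 < N%:R :> R by rewrite ltr0n.
pose w i := N%:R ^+ 2 * esq x y i.
have pw j : w (j + N)%N = w j by rewrite /w /esq -!addSn !px !py.
have D (z : nat -> R) j : (forall j, N%:R * `|z j.+1 - z j| <= V) -> `|N%:R * (z j.+2 - z j)| <= 2 * V.
  move=> hz; have -> : N%:R * (z j.+2 - z j) = N%:R * (z j.+2 - z j.+1) + N%:R * (z j.+1 - z j) by ring.
  apply: le_trans (ler_normD _ _) _; rewrite !normrM ger0_norm//.
  by have := hz j; have := hz j.+1; clear; lra.
have S : \sum_(j < N) `|w j.+1 - w j| <= 4 * V * (N%:R * er).
  have -> : 4 * V * (N%:R * er) = \sum_(j < N) 4 * V * er.
    by rewrite sumr_const card_ord -[_ *+ N]mulr_natl; ring.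
  apply: ler_sum => j _.
  set e1 := N%:R * (x j.+2 - 2 * x j.+1 + x j) + a j * (y j.+2 - y j).
  set e2 := N%:R * (y j.+2 - 2 * y j.+1 + y j) - a j * (x j.+2 - x j).
  have -> : w j.+1 - w j = e1 * (N%:R * (x j.+2 - x j)) + e2 * (N%:R * (y j.+2 - y j)).
    by rewrite /w /esq /e1 /e2; ring.
  have -> : 4 * V * er = er * (2 * V) + er * (2 * V) by ring.
  apply: le_trans (ler_normD _ _) _; rewrite [X in X + _]normrM [X in _ + X]normrM.
  by apply: lerD; apply: ler_pM => //; [exact: ex|exact: D|exact: ey|exact: D].
have := periodic_mean N0 pw S i.
have -> : \sum_(j < N) w j = N%:R * d ^+ 2 by rewrite -mulr_sumr -dE /dirichlet; ring.
by rewrite -mulrBr normrM ger0_norm// ler_pM2l.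
Qed.

(* The last clause is the discretization of x'' = - d (H - lam) y' and
   y'' = d (H - lam) x', with step 1 / N. *)
Definition discrete_solution (R : realType) (H : R * R -> R) (tau s L V z : R) :=
  exists N x y d lam,
   [/\ (0 < N)%N /\ z^-1 <= N%:R,
       nperiodic N x /\ nperiodic N y,
       [/\ s <= d <= L, `|lam| <= V, darea N x y = tau &
         forall i, `|N%:R ^+ 2 * esq x y i - d ^+ 2| <= z],
       (forall i, `|x i| <= V) /\ (forall i, `|y i| <= V) /\
       (forall i, N%:R * `|x i.+1 - x i| <= V) /\ (forall i, N%:R * `|y i.+1 - y i| <= V) &
       (forall i, `|N%:R * (x i.+2 - 2 * x i.+1 + x i)
                  + d / 2 * (H (x i.+1, y i.+1) - lam) * (y i.+2 - y i)| <= z / N%:R) /\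
       (forall i, `|N%:R * (y i.+2 - 2 * y i.+1 + y i)
                  - d / 2 * (H (x i.+1, y i.+1) - lam) * (x i.+2 - x i)| <= z / N%:R)].

Lemma discrete_curve (R : realType) (H : R * R -> R) (B B0 M L K0 c1 c2 tau del del1 : R) :
  has_potential H B ->
  (forall p, `|H p| <= B0) ->
  tau != 0 -> 38 * (6 * Num.sqrt `|tau|) <= L -> 0 < del -> 0 <= del1 ->
  (forall u v, (u - c1) ^+ 2 + (v - c2) ^+ 2 <= `|tau| -> tau * H (u, v) <= - (`|tau| * del)) ->
  (forall u v, K0 <= `|u| \/ K0 <= `|v| -> `|H (u, v)| <= del1) ->
  K0 + L <= M -> `|c1| + Num.sqrt `|tau| <= M -> `|c2| + Num.sqrt `|tau| <= M -> M < B ->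
  L ^+ 2 * del1 <= `|tau| * del / 8 ->
  exists2 V, 0 <= V & forall z, 0 < z -> discrete_solution H tau (2 * Num.sqrt `|tau|) L V z.
Proof.
move=> Hfield HB0 tau0 sL del0 del10 Hdisc Hfar KL cM1 cM2 MB Ld.
have t0 : 0 < `|tau| by rewrite normr_gt0.
have s0 : 0 < Num.sqrt `|tau| by rewrite sqrtr_gt0.
have L0 : 0 < L by apply: lt_le_trans sL; rewrite !mulr_gt0.
have B00 : 0 <= B0 := le_trans (normr_ge0 _) (HB0 (0, 0)).
have M0 : 0 <= M by apply: le_trans cM1; rewrite addr_ge0// ltW.
have [V1 V1E] : {v | v = (L + M / 2 * (4 * (B0 + 1) * L + 1)) / `|tau|} by eexists.
have [V VE] : {v | v = L / 2 * (4 * (B0 + 1 + V1) * L + 1)} by eexists.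
have V10 : 0 <= V1.
  rewrite V1E divr_ge0// addr_ge0 ?(ltW L0)// mulr_ge0 ?divr_ge0// addr_ge0// mulr_ge0 ?(ltW L0)//.
  by rewrite mulr_ge0// addr_ge0.
have V0 : 0 <= V.
  rewrite VE mulr_ge0 ?divr_ge0 ?(ltW L0)// addr_ge0// mulr_ge0 ?(ltW L0)//.
  by rewrite mulr_ge0// !addr_ge0.
exists (V + V1 + M); first by rewrite !addr_ge0.
move=> z z0.
have V41 : 0 < 4 * V + 1 by rewrite ltr_wpDl// mulr_ge0.
(* [speed_almost_constant] multiplies the error by [4 V], hence the stricter accuracy [z']. *)
pose z' := z / (4 * V + 1).
have z'0 : 0 < z' by rewrite divr_gt0.
have z'z : z' <= z by rewrite ler_pdivrMr// ler_peMr ?(ltW z0)// lerDr mulr_ge0.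
have Vz' : 4 * V * z' <= z.
  rewrite mulrA ler_pdivrMr// mulrC ler_wpM2l ?(ltW z0)//; clear; lra.
have g0 : 0 < `|tau| * del / 8 by rewrite divr_gt0// mulr_gt0.
have LV0 : 0 <= L * V by rewrite mulr_ge0// ltW.
(* The first three bounds are conditions of [discrete_curve_estimates] and [minimizer_interior]; the
   last makes the consistency error [L V zeta] at most [z' / 2]. *)
pose zeta := Num.min (Num.min 1 (del / 4)) (Num.min (`|tau| * del / 8 / L ^+ 2) (z' / 2 / (L * V + 1))).
have zeta0 : 0 < zeta.
  rewrite !lt_min ltr01 !divr_gt0 ?exprn_gt0 ?mulr_gt0//.
  by rewrite ltr_wpDl.
have := lexx zeta; rewrite {2}/zeta !le_min => /andP[/andP[zt1 zt2] /andP[zt3 zt4]].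
rewrite ler_pdivlMr ?exprn_gt0// mulrC in zt3.
rewrite ler_pdivlMr ?ltr_wpDl// in zt4.
have [Q1 [Q1x [Q1y [Q2 [Q2x [Q2y [[Ca Ca0 Ta] [Cb Cb0 Tb] Qk Hdiv]]]]]]] := Hfield _ zeta0.
pose C := Num.max Ca Cb.
have T1 : taylor2 Q1 Q1x Q1y B C by apply: taylor2_le Ta; rewrite le_max lexx.
have T2 : taylor2 Q2 Q2x Q2y B C by apply: taylor2_le Tb; rewrite le_max lexx orbT.
have C0 : 0 <= C by rewrite le_max Ca0.
(* [C] is known only once [zeta] is fixed; [N] is now taken large enough for each error containing
   [C] to fall below its threshold. *)
pose a1 := 2 * L * C * L ^+ 2 / (`|tau| * del / 8).
pose a2 := 2 * C * L ^+ 2.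
pose a3 := 2 * L * C * V ^+ 2 / (z' / 2).
have a10 : 0 <= a1 by rewrite divr_ge0 ?(ltW g0)// !mulr_ge0 ?sqr_ge0 ?(ltW L0).
have a20 : 0 <= a2 by apply: mulr_ge0; [exact: mulr_ge0|exact: sqr_ge0].
have a30 : 0 <= a3.
  apply: divr_ge0; last by rewrite divr_ge0 ?(ltW z'0).
  by apply: mulr_ge0; [rewrite !mulr_ge0 ?(ltW L0)|exact: sqr_ge0].
have [k [k0 kN]] := ex_nat_ge 1 (z^-1 + a1 + a2 + a3).
pose N := (4 * k)%N.
have N0 : (0 < N)%N by rewrite muln_gt0.
have N0R : 0 < N%:R :> R by rewrite ltr0n.
have NN : z^-1 + a1 + a2 + a3 <= N%:R.
  by apply: le_trans kN _; rewrite ler_nat leq_pmull.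
have zi0 : 0 < z^-1 by rewrite invr_gt0.
have zN : z^-1 <= N%:R by move: NN a10 a20 a30; clear; lra.
have frac (A a : R) : 0 < a -> A / a <= N%:R -> A / N%:R <= a.
  by move=> a0; rewrite !ler_pdivrMr// mulrC.
have a1N : 2 * L * C * L ^+ 2 / N%:R <= `|tau| * del / 8.
  by apply: frac => //; rewrite -/a1; move: NN zi0 a20 a30; clear; lra.
have a2N : 2 * C * L ^+ 2 / N%:R <= 1.
  by apply: frac => //; rewrite divr1 -/a2; move: NN zi0 a10 a30; clear; lra.
have a3N : 2 * L * C * V ^+ 2 / N%:R <= z' / 2.
  by apply: frac; [exact: divr_gt0|rewrite -/a3; move: NN zi0 a10 a20; clear; lra].
clearbody C a1 a2 a3.
have [x [y [d [[px py] [xM yM] [ar dE] /andP[sd dL] Hmin]]]] :=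
  minimizer_interior T1 T2 C0 Qk Hdiv tau0 sL del0 (ltW zeta0) del10 Hdisc Hfar KL cM1 cM2 MB zt2 Ld zt3 k0 a1N.
have d0 : 0 < d by apply: lt_le_trans sd; rewrite mulr_gt0.
have cc1 : c11 Q1 Q1x Q1y B by exists C.
have cc2 : c11 Q2 Q2x Q2y B by exists C.
have [lam lamE EL] := discrete_euler_lagrange cc1 cc2 (ltW MB) tau0 d0 N0 px py xM yM ar dE Hmin.
have zt01 : 0 <= zeta <= 1 by rewrite (ltW zeta0).
have dd : 0 < d <= L by rewrite d0.
have := discrete_curve_estimates T1 T2 C0 Hdiv HB0 (ltW MB) tau0 zt01 N0 a2N px py
   (fun i => ltW (xM i)) (fun i => ltW (yM i)) dE dd lamE EL.
rewrite /= -V1E -VE; set er := _ / N%:R; move=> [lV vx vy ex ey].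
have erz : er <= z' / N%:R.
  rewrite /er ler_pM2r ?invr_gt0//.
  have -> : L / 2 * (zeta * (2 * V) + C * (4 * V ^+ 2) / N%:R) = L * V * zeta + 2 * L * C * V ^+ 2 / N%:R by field; rewrite gt_eqF.
  have : L * V * zeta <= z' / 2 by move: zt4; rewrite mulrDr mulr1 mulrC; move: zeta0; clear; lra.
  by move: a3N; clear; lra.
have erz' : er <= z / N%:R by apply: le_trans erz _; rewrite ler_pM2r ?invr_gt0.
have VV : V <= V + V1 + M by move: V10 M0; clear; lra.
exists N, x, y, d, lam; split=> //.
- split=> //; first by rewrite sd.
    by apply: le_trans lV _; move: V0 M0; clear; lra.
  move=> i; apply: le_trans (speed_almost_constant N0 px py dE vx vy ex ey i) _.
  apply: le_trans Vz'; rewrite ler_wpM2l ?mulr_ge0// mulrC -ler_pdivlMr//.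
- split; first by move=> i; apply: le_trans (ltW (xM i)) _; move: V0 V10; clear; lra.
  split; first by move=> i; apply: le_trans (ltW (yM i)) _; move: V0 V10; clear; lra.
  by split=> i; [exact: le_trans (vx i) VV|exact: le_trans (vy i) VV].
- by split=> i; [exact: le_trans (ex i) erz'|exact: le_trans (ey i) erz'].
Qed.

(** * Passage to the limit *)

(* The [j]-th sequence consists of samples taken with step [1 / N j]. *)
Definition equicont (R : realType) (N : nat -> nat) (B : nat -> nat -> R) :=
  (exists K : R, forall j i, `|B j i| <= K) /\
  forall e : R, 0 < e -> exists2 d : R, 0 < d & forall j i i', (i <= i')%N ->
    (i' - i)%:R <= d * (N j)%:R -> `|B j i - B j i'| <= e.

Lemma equicont_cst (R : realType) (N : nat -> nat) (u : nat -> R) (K : R) :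
  (forall j, `|u j| <= K) -> equicont N (fun j _ => u j).
Proof.
move=> uK; split; first by exists K => j _.
by move=> e e0; exists 1 => // j i i' _ _; rewrite subrr normr0 ltW.
Qed.

Lemma equicontD (R : realType) (N : nat -> nat) (A B : nat -> nat -> R) :
  equicont N A -> equicont N B -> equicont N (fun j i => A j i + B j i).
Proof.
move=> [[K HK] HA] [[L HL] HB]; split.
  by exists (K + L) => j i; apply: le_trans (ler_normD _ _) _; exact: lerD.
move=> e e0; have e2 : 0 < e / 2 by rewrite divr_gt0.
have [d d0 Hd] := HA _ e2; have [d' d0' Hd'] := HB _ e2.
exists (Num.min d d'); first by rewrite lt_min d0.
move=> j i i' ii'; rewrite minr_pMl// le_min => /andP[h h'].
have := Hd _ _ _ ii' h; have := Hd' _ _ _ ii' h'.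
have -> : A j i + B j i - (A j i' + B j i') = (A j i - A j i') + (B j i - B j i') by ring.
by have := ler_normD (A j i - A j i') (B j i - B j i'); clear; lra.
Qed.

Lemma equicontM (R : realType) (N : nat -> nat) (A B : nat -> nat -> R) :
  equicont N A -> equicont N B -> equicont N (fun j i => A j i * B j i).
Proof.
move=> [[K HK] HA] [[L HL] HB].
have K0 : 0 <= K := le_trans (normr_ge0 _) (HK 0%N 0%N).
have L0 : 0 <= L := le_trans (normr_ge0 _) (HL 0%N 0%N).
split; first by exists (K * L) => j i; rewrite normrM; exact: ler_pM.
move=> e e0; pose e2 := e / (K + L + 1).
have KL : 0 < K + L + 1 by rewrite ltr_wpDl// addr_ge0.
have e20 : 0 < e2 by rewrite divr_gt0.
have [d d0 Hd] := HA _ e20; have [d' d0' Hd'] := HB _ e20.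
exists (Num.min d d'); first by rewrite lt_min d0.
move=> j i i' ii'; rewrite minr_pMl// le_min => /andP[h h'].
have := Hd _ _ _ ii' h; have := Hd' _ _ _ ii' h' => hB hA.
have -> : A j i * B j i - A j i' * B j i' = A j i * (B j i - B j i') + (A j i - A j i') * B j i' by ring.
apply: le_trans (ler_normD _ _) _; rewrite !normrM.
have h1 : `|A j i| * `|B j i - B j i'| <= K * e2 by exact: ler_pM.
have h2 : `|A j i - A j i'| * `|B j i'| <= e2 * L by exact: ler_pM.
have : e2 * (K + L + 1) = e by rewrite /e2 divfK ?gt_eqF.
by move: h1 h2 e20; clear; lra.
Qed.

Lemma equicont_lip (R : realType) (N : nat -> nat) (B : nat -> nat -> R) (K L : R) :
  (forall j, (0 < N j)%N) -> (forall j i, `|B j i| <= K) ->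
  (forall j i, (N j)%:R * `|B j i.+1 - B j i| <= L) -> equicont N B.
Proof.
move=> N0 BK BL; split; first by exists K.
have L0 : 0 <= L by apply: le_trans (BL 0%N 0%N); rewrite mulr_ge0.
have L1 : 0 < L + 1 by rewrite ltr_wpDl.
move=> e e0; exists (e / (L + 1)); first by rewrite divr_gt0.
have H j i n : (N j)%:R * `|B j i - B j (i + n)%N| <= n%:R * L.
  elim: n => [|n IH]; first by rewrite addn0 subrr normr0 mulr0 mul0r.
  have := BL j (i + n)%N; rewrite -addnS => h.
  have := ler_wpM2l (ler0n R (N j)) (ler_distD (B j (i + n)%N) (B j i) (B j (i + n.+1)%N)).
  rewrite [`|B j (i + n)%N - _|]distrC -natr1; move: h IH; clear; lra.
move=> j i i' ii' h; have := H j i (i' - i)%N; rewrite subnKC// => h'.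
have Nj : 0 < (N j)%:R :> R by rewrite ltr0n.
rewrite -(ler_pM2l Nj); apply: le_trans h' _.
have : e / (L + 1) * (N j)%:R * L <= (N j)%:R * e.
  rewrite mulrAC mulrC ler_wpM2l// mulrAC ler_pdivrMr// ler_pM2l//; clear; lra.
by apply: le_trans; rewrite ler_wpM2r.
Qed.

Lemma equicont_comp (R : realType) (N : nat -> nat) (f : R * R -> R) (x y : nat -> nat -> R) (K : R) :
  unif_cont f -> (forall p, `|f p| <= K) -> equicont N x -> equicont N y ->
  equicont N (fun j i => f (x j i, y j i)).
Proof.
move=> fu fK [_ Hx] [_ Hy]; split; first by exists K.
move=> e /fu[d d0 Hd]; have [d1 d10 H1] := Hx _ d0; have [d2 d20 H2] := Hy _ d0.
exists (Num.min d1 d2); first by rewrite lt_min d10.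
move=> j i i' ii'; rewrite minr_pMl// le_min => /andP[h h'].
by apply: Hd => /=; [exact: H1|exact: H2].
Qed.

Lemma equicont_shift (R : realType) (N : nat -> nat) (B : nat -> nat -> R) (U : set_system nat) :
  Filter U -> \oo `<=` U -> (forall j, (j < N j)%N) -> equicont N B ->
  forall e, 0 < e -> \forall j \near U, forall i, `|B j i.+1 - B j i| <= e.
Proof.
move=> FU Uoo jN [_ HB] e /HB[d d0 Hd]; apply: Uoo; near=> j => i.
rewrite distrC; apply: Hd => //; rewrite subSnn -ler_pdivrMl// mulr1.
apply: (@le_trans _ _ j%:R); last by rewrite ler_nat ltnW.
by near: j; apply: nbhs_infty_ger.
Unshelve. all: by end_near.
Qed.

(* The shift by [j] periods makes every real [t] eventually admissible, since
   truncation sends negative numbers to [0]. *)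
Definition sample (R : realType) (N : nat -> nat) (j : nat) (t : R) : nat :=
  Num.truncn ((N j)%:R * (t + j%:R)).

Lemma sample_itv (R : realType) (N : nat -> nat) (j : nat) (t : R) : 0 <= t + j%:R ->
  (sample N j t)%:R <= (N j)%:R * (t + j%:R) < (sample N j t)%:R + 1.
Proof. by move=> t0; have := truncn_itv (mulr_ge0 (ler0n R (N j)) t0); rewrite -natr1. Qed.

Lemma sample_period (R : realType) (N : nat -> nat) (j : nat) (t : R) : 0 <= t + j%:R ->
  sample N j (t + 1) = (sample N j t + N j)%N.
Proof.
move=> t0; apply: truncn_def; rewrite -natr1 natrD.
have := sample_itv N t0; have -> : t + 1 + j%:R = (t + j%:R) + 1 by ring.
have -> : (N j)%:R * (t + j%:R + 1) = (N j)%:R * (t + j%:R) + (N j)%:R by ring.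
by clear; lra.
Qed.

Lemma increment_bound (R : realType) (N : nat) (A B : nat -> R) (b e : R) (i n : nat) : (0 < N)%N ->
  (forall k, (k < n)%N -> `|N%:R * (A (i + k).+1 - A (i + k)%N) - b| <= e) ->
  `|A (i + n)%N - A i - n%:R / N%:R * b| <= n%:R / N%:R * e.
Proof.
move=> N0; have N0R : 0 < N%:R :> R by rewrite ltr0n.
elim: n => [|n IH] H; first by rewrite addn0 subrr !mul0r subr0 normr0.
have {}IH := IH (fun k kn => H k (ltnW kn)); have h := H n (ltnSn n).
have -> : A (i + n.+1)%N - A i - n.+1%:R / N%:R * b =
  (A (i + n)%N - A i - n%:R / N%:R * b) + (N%:R * (A (i + n).+1 - A (i + n)%N) - b) / N%:R.
  by rewrite addnS -natr1; field; rewrite gt_eqF.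
have -> : n.+1%:R / N%:R * e = n%:R / N%:R * e + N%:R^-1 * e by rewrite -natr1; ring.
apply: le_trans (ler_normD _ _) _; apply: lerD => //.
by rewrite normrM normfV [`|N%:R|]ger0_norm// mulrC ler_pM2l// invr_gt0.
Qed.

(** Between the samples of [t] and [t + s] the difference quotients of [A] follow [B], and
    equicontinuity keeps [B] within a fraction of [e] of its value at [t], uniformly in [j]. The
    uniformity matters, since [a] and [b] are only pointwise limits. *)
Lemma discrete_ftc (R : realType) (U : set_system nat) (N : nat -> nat)
    (A B : nat -> nat -> R) (a b : R -> R) :
  ProperFilter U -> \oo `<=` U -> (forall j, (j < N j)%N) -> equicont N B ->
  (forall e, 0 < e -> \forall j \near U, forall i, `|(N j)%:R * (A j i.+1 - A j i) - B j i| <= e) ->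
  (forall t, (fun j => A j (sample N j t)) @ U --> a t) ->
  (forall t, (fun j => B j (sample N j t)) @ U --> b t) ->
  forall t : R, is_derive t 1 a (b t).
Proof.
move=> FU Uoo jN [[K BK] HB] HA la lb t; apply: is_derive_of_small_o => e e0.
have K0 : 0 <= K := le_trans (normr_ge0 _) (BK 0%N 0%N).
have e4 : 0 < e / 4 by rewrite divr_gt0.
have [d d0 Hd] := HB _ e4.
exists (d / 2) => [|s sd]; first by rewrite divr_gt0.
have [->|s0] := eqVneq s 0; first by rewrite addr0 mulr0 subrr subr0 normr0 mulr0.
have s0' : 0 < `|s| by rewrite normr_gt0.
have cv : (fun j => A j (sample N j (t + s)) - A j (sample N j t) - B j (sample N j t) * s) @ U
    --> a (t + s) - a t - b t * s.
  by apply: cvgB; [apply: cvgB; exact: la|apply: cvgM => //; exact: cvg_cst].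
apply: (cvgr_to_le (cvg_norm cv)) => /=.
have h1 := HA _ e4.
have h2 : \forall j \near U, (`|t| + `|s| <= j%:R) /\ (2 / d + (e / 2 + K) / (e / 2 * `|s|) <= j%:R :> R).
  by apply: Uoo; near=> j; split; near: j; exact: nbhs_infty_ger.
near=> j.
have [j1 j2] : (`|t| + `|s| <= j%:R) /\ (2 / d + (e / 2 + K) / (e / 2 * `|s|) <= j%:R :> R) by near: j; exact: h2.
have Hj : forall i, `|(N j)%:R * (A j i.+1 - A j i) - B j i| <= e / 4 by near: j; exact: h1.
have N0 : (0 < N j)%N by exact: leq_ltn_trans (jN j).
have N0R : 0 < (N j)%:R :> R by rewrite ltr0n.
have jNR : j%:R <= (N j)%:R :> R by rewrite ler_nat ltnW.
have tj : 0 <= t + j%:R.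
  by have := ler_norm (- t); rewrite normrN; move: j1 s0'; clear; lra.
have tsj : 0 <= t + s + j%:R.
  have := ler_norm (- t); have := ler_norm (- s); rewrite !normrN; move: j1; clear; lra.
have := sample_itv N tj; have := sample_itv N tsj.
set I' := sample N j (t + s); set I := sample N j t => /andP[I1' I2'] /andP[I1 I2].
(* Both samples are rounded down, so the index gap differs from [N j * s] by at most one; [N1] and
   [N2] make this negligible against [d] and against [e |s|]. *)
have IN : `|I'%:R - I%:R - (N j)%:R * s| <= 1.
  by rewrite ler_norml; move: I1 I1' I2 I2'; rewrite !mulrDr; clear; lra.
have e2s : 0 < e / 2 * `|s| by rewrite mulr_gt0 ?divr_gt0.
have eK : 0 <= (e / 2 + K) / (e / 2 * `|s|) by rewrite divr_ge0 ?(ltW e2s)// addr_ge0// divr_ge0// ltW.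
have N1 : 2 <= d * (N j)%:R.
  rewrite mulrC -ler_pdivrMr//; apply: le_trans jNR; move: j2 eK; clear; lra.
have N2 : e / 2 + K <= (N j)%:R * (e / 2 * `|s|).
  rewrite -ler_pdivrMr//; apply: le_trans jNR; have : 0 < 2 / d by rewrite divr_gt0.
  by move: j2; clear; lra.
have sN : `|(N j)%:R * s| <= (N j)%:R * (d / 2) by rewrite normrM ger0_norm// ler_pM2l.
have near_idx (i i' : nat) : (i <= i')%N -> `|i'%:R - i%:R - (N j)%:R * s| <= 1 \/ `|i%:R - i'%:R - (N j)%:R * s| <= 1 ->
    (i' - i)%:R <= d * (N j)%:R.
  move=> ii' h; rewrite natrB//.
  have : i'%:R - i%:R <= 1 + `|(N j)%:R * s|.
    case: h; rewrite ler_norml => /andP[l u].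
      by have := ler_norm ((N j)%:R * s); move: u; clear; lra.
    by have := ler_norm (- ((N j)%:R * s)); rewrite normrN; move: l; clear; lra.
  by move: sN N1; clear; lra.
(* For negative [s] the indices run backwards, so the reference value [b'] is allowed at either end
   of the interval. *)
have main (i i' : nat) : (i <= i')%N -> (i' - i)%:R <= d * (N j)%:R ->
   forall b', (b' = B j i \/ b' = B j i') ->
   `|A j i' - A j i - (i' - i)%:R / (N j)%:R * b'| <= (i' - i)%:R / (N j)%:R * (e / 2).
  move=> ii' h b' hb'; rewrite -{1}(subnKC ii').
  apply: increment_bound => // k kn.
  have -> : (N j)%:R * (A j (i + k).+1 - A j (i + k)%N) - b' =
    ((N j)%:R * (A j (i + k).+1 - A j (i + k)%N) - B j (i + k)%N) + (B j (i + k)%N - b') by ring.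
  apply: le_trans (ler_normD _ _) _; have := Hj (i + k)%N.
  suff : `|B j (i + k)%N - b'| <= e / 4 by clear; lra.
  case: hb' => ->.
    rewrite distrC; apply: Hd; first exact: leq_addr.
    by apply: le_trans h; rewrite ler_nat addKn ltnW.
  have iki : (i + k <= i')%N by rewrite -(subnKC ii') leq_add2l ltnW.
  by apply: Hd => //; apply: le_trans h; rewrite ler_nat leq_sub2l// leq_addr.
have key : `|A j I' - A j I - (I'%:R - I%:R) / (N j)%:R * B j I| <= `|I'%:R - I%:R| / (N j)%:R * (e / 2).
  have [le|/ltnW le] := leqP I I'.
    have := main _ _ le (near_idx _ _ le (or_introl IN)) (B j I) (or_introl erefl).
    by rewrite natrB// [`|I'%:R - I%:R|]ger0_norm ?subr_ge0 ?ler_nat.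
  have := main _ _ le (near_idx _ _ le (or_intror IN)) (B j I) (or_intror erefl).
  rewrite natrB// [`|I'%:R - _|]distrC [`|I%:R - I'%:R|]ger0_norm ?subr_ge0 ?ler_nat//.
  by apply: le_trans; rewrite -normrN le_eqVlt; apply/orP; left; apply/eqP; congr `|_|; ring.
have -> : A j I' - A j I - B j I * s = (A j I' - A j I - (I'%:R - I%:R) / (N j)%:R * B j I) +
   (I'%:R - I%:R - (N j)%:R * s) / (N j)%:R * B j I by field; rewrite gt_eqF.
apply: le_trans (ler_normD _ _) _.
have k2 : `|(I'%:R - I%:R - (N j)%:R * s) / (N j)%:R * B j I| <= 1 / (N j)%:R * K.
  rewrite normrM; apply: ler_pM => //; rewrite normrM normfV [`|(N j)%:R|]ger0_norm//.
  by rewrite ler_pM2r ?invr_gt0.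
have k3 : `|I'%:R - I%:R| <= 1 + (N j)%:R * `|s| :> R.
  have := ler_normD (I'%:R - I%:R - (N j)%:R * s) ((N j)%:R * s); rewrite subrK normrM [`|(N j)%:R|]ger0_norm//.
  by move: IN; clear; lra.
rewrite -(ler_pM2l N0R).
have := ler_wpM2l (ltW N0R) key; have := ler_wpM2l (ltW N0R) k2; rewrite mul1r.
have -> : (N j)%:R * (`|I'%:R - I%:R| / (N j)%:R * (e / 2)) = `|I'%:R - I%:R| * (e / 2) by field; rewrite gt_eqF.
have -> : (N j)%:R * ((N j)%:R^-1 * K) = K by field; rewrite gt_eqF.
have := ler_wpM2r (ltW (divr_gt0 e0 (ltr0n R 2))) k3.
move: N2; clear; lra.
Unshelve. all: by end_near.
Qed.

Lemma unif_cont_cvg (R : realType) (T : Type) (F : set_system T) (H : R * R -> R)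
    (x y : T -> R) (a b : R) : Filter F -> unif_cont H -> x @ F --> a -> y @ F --> b ->
  (fun s => H (x s, y s)) @ F --> H (a, b).
Proof.
move=> FF uH xa yb; apply/cvgrPdist_le => e /uH[d d0 Hd].
move/cvgrPdist_le: xa => /(_ d d0) xa; move/cvgrPdist_le: yb => /(_ d d0) yb.
by near=> s; apply: Hd => /=; near: s.
Unshelve. all: by end_near.
Qed.

Lemma is_derive_derive1 (R : realType) (f g : R -> R) :
  (forall t : R, is_derive t 1 f (g t)) -> derive1 f = g.
Proof. by move=> H; apply/funext => t; rewrite derive1E; exact: derive_val. Qed.

Lemma is_derive_continuous (R : realType) (f g : R -> R) :
  (forall t : R, is_derive t 1 f (g t)) -> continuous f.
Proof.
move=> H t; apply: differentiable_continuous; apply/derivable1_diffP.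
exact: ex_derive.
Qed.

(** [a] is, up to a constant, the area swept until time [t] minus [tau t]; [a 1 = a 0] thus
    expresses the area constraint, which the fundamental theorem of calculus turns into the
    integral. *)
Lemma curve_of_ode (R : realType) (H : R * R -> R) (x y v w a : R -> R) (d lam tau : R) :
  unif_cont H -> 0 < d -> periodic1 x -> periodic1 y ->
  (forall t : R, is_derive t 1 x (v t)) -> (forall t : R, is_derive t 1 y (w t)) ->
  (forall t : R, is_derive t 1 v (- (d * (H (x t, y t) - lam) * w t))) ->
  (forall t : R, is_derive t 1 w (d * (H (x t, y t) - lam) * v t)) ->
  (forall t, v t ^+ 2 + w t ^+ 2 = d ^+ 2) ->
  (forall t : R, is_derive t 1 a (1 / 2 * (y t * v t - x t * w t) - tau)) -> a 1 = a 0 ->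
  [/\ C2 x /\ C2 y, periodic1 x /\ periodic1 y,
      (forall t, (derive1 x t, derive1 y t) <> (0, 0)),
      area x y = tau & forall t, curv x y t = H (x t, y t) - lam].
Proof.
move=> uH d0 px py dx dy dv dw sp da a01.
have xE := is_derive_derive1 dx; have yE := is_derive_derive1 dy.
have vE := is_derive_derive1 dv; have wE := is_derive_derive1 dw.
have cx := is_derive_continuous dx; have cy := is_derive_continuous dy.
have cv := is_derive_continuous dv; have cw := is_derive_continuous dw.
have x2 : derive1n 2 x = (fun t => - (d * (H (x t, y t) - lam) * w t)).
  by rewrite /derive1n /= xE vE.
have y2 : derive1n 2 y = (fun t => d * (H (x t, y t) - lam) * v t).
  by rewrite /derive1n /= yE wE.
have cH : continuous (fun t => d * (H (x t, y t) - lam)).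
  move=> t; apply: cvgM; first exact: cvg_cst.
  apply: cvgB; last exact: cvg_cst.
  by apply: unif_cont_cvg => //; [exact: cx|exact: cy].
split.
- split; split.
  + by move=> t; exact: (@ex_derive _ _ _ _ _ _ _ (dx t)).
  + split; first by rewrite xE => t; exact: (@ex_derive _ _ _ _ _ _ _ (dv t)).
    by rewrite x2 => t; apply: cvgN; apply: cvgM; [exact: cH|exact: cw].
  + by move=> t; exact: (@ex_derive _ _ _ _ _ _ _ (dy t)).
  + split; first by rewrite yE => t; exact: (@ex_derive _ _ _ _ _ _ _ (dw t)).
    by rewrite y2 => t; apply: cvgM; [exact: cH|exact: cv].
- by [].
- move=> t; rewrite xE yE => -[vt wt]; have := sp t; rewrite vt wt !expr0n addr0 => /esym/eqP.
  by rewrite expf_eq0/= gt_eqF.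
- rewrite /area xE yE; pose f t := x t * - w t + y t * v t.
  have cf : continuous f.
    move=> t; apply: cvgD; first by apply: cvgM; [exact: cx|apply: cvgN; exact: cw].
    by apply: cvgM; [exact: cy|exact: cv].
  pose F t := 2 * (a t + tau * t).
  have dF (t : R) : is_derive t 1 F (f t).
    have -> : f t = 2 *: ((1 / 2 * (y t * v t - x t * w t) - tau) + tau *: 1).
      by rewrite /f /GRing.scale /=; field.
    apply: is_deriveZ; apply: is_deriveD; exact: is_deriveZ.
  have cF := is_derive_continuous dF.
  have I : (\int[lebesgue_measure]_(t in `[0%R, 1%R]%classic) (f t)%:E = (F 1)%:E - (F 0)%:E)%E.
    apply: continuous_FTC2; first exact: ltr01.
    - exact: continuous_subspaceT.
    - split.
      + by move=> t _; exact: ex_derive.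
      + exact: cvg_at_right_filter (cF 0).
      + exact: cvg_at_left_filter (cF 1).
    - by move=> t _; rewrite (is_derive_derive1 dF).
  by rewrite /Rintegral I /F a01 -EFinB /=; field.
- move=> t; rewrite /curv xE yE x2 y2.
  have -> : enorm (v t, w t) = d by rewrite /enorm /= sp sqrtr_sqr gtr0_norm.
  set h := H _ - lam.
  have -> : - w t * - (d * h * w t) + v t * (d * h * v t) = d * h * (v t ^+ 2 + w t ^+ 2) by ring.
  by rewrite sp; field; rewrite gt_eqF.
Qed.

Lemma equicont_limit (R : realType) (U : set_system nat) (N : nat -> nat) (B : nat -> nat -> R) :
  UltraFilter U -> equicont N B ->
  exists b : R -> R, forall t, (fun j => B j (sample N j t)) @ U --> b t.
Proof.
move=> UU [[K BK] _].
have H (t : R) : exists l : R, (fun j => B j (sample N j t)) @ U --> l.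
  by apply: (@ultra_cvg_bounded R U UU _ K); apply: filterS filterT => j _ /=.
by have [b Hb] := choice H; exists b.
Qed.

Lemma sample_limit_periodic (R : realType) (U : set_system nat) (N : nat -> nat)
    (B : nat -> nat -> R) (b : R -> R) : ProperFilter U -> \oo `<=` U ->
  (forall j i, B j (i + N j)%N = B j i) ->
  (forall t, (fun j => B j (sample N j t)) @ U --> b t) -> forall t, b (t + 1) = b t.
Proof.
move=> FU Uoo pB Hb t; apply: (cvg_real_unique FU (Hb (t + 1))).
apply: cvg_trans (Hb t); apply: near_eq_cvg.
have : \forall j \near U, `|t| <= j%:R by apply: Uoo; exact: nbhs_infty_ger.
apply: filterS => j tj; rewrite sample_period ?pB//.
by have := ler_norm (- t); rewrite normrN; move: tj; clear; lra.
Qed.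

(** The discrete equation sits at the middle vertex and averages two velocities; equicontinuity of
    [G] and [w] replaces this by the value at a single index, as [discrete_ftc] expects. With [w]
    and [- v] for [v] and [w] it serves the second equation. *)
Lemma velocity_increment (R : realType) (U : set_system nat) (N : nat -> nat)
    (G v w : nat -> nat -> R) : ProperFilter U -> \oo `<=` U -> (forall j, (j < N j)%N) ->
  equicont N G -> equicont N w ->
  (forall j i, `|(N j)%:R * (v j i.+1 - v j i) + 1 / 2 * G j i.+1 * (w j i + w j i.+1)| <= j.+1%:R^-1) ->
  forall e, 0 < e -> \forall j \near U, forall i,
    `|(N j)%:R * (v j i.+1 - v j i) - - (G j i * w j i)| <= e.
Proof.
move=> FU Uoo jN eG ew H e e0.
have [[K wK] _] := ew.
have K0 : 0 <= K := le_trans (normr_ge0 _) (wK 0%N 0%N).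
have e2 : 0 < e / 2 by rewrite divr_gt0.
have eK : 0 < e / 2 / (K + 1) by rewrite divr_gt0// ltr_wpDl.
have h1 := equicont_shift FU Uoo jN (equicontM eG ew) e2.
have h2 := equicont_shift FU Uoo jN eG eK.
have h3 : \forall j \near U, (e / 2)^-1 <= j%:R by apply: Uoo; exact: nbhs_infty_ger.
near=> j => i.
have g1 : `|G j i.+1 * w j i.+1 - G j i * w j i| <= e / 2 by move: i; near: j; exact: h1.
have g2 : `|G j i.+1 - G j i| <= e / 2 / (K + 1) by move: i {g1}; near: j; exact: h2.
have g3 : j.+1%:R^-1 <= e / 2.
  rewrite -[e / 2]invrK lef_pV2 ?posrE ?invr_gt0//.
  apply: (@le_trans _ _ j%:R); last by rewrite ler_nat.
  by near: j; exact: h3.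
have g4 : `|(G j i.+1 - G j i) * w j i| <= e / 2.
  rewrite normrM; apply: (@le_trans _ _ (e / 2 / (K + 1) * K)); first exact: ler_pM.
  by rewrite mulrAC ler_pdivrMr ?ltr_wpDl// ler_pM2l// lerDl.
have -> : (N j)%:R * (v j i.+1 - v j i) - - (G j i * w j i) =
  ((N j)%:R * (v j i.+1 - v j i) + 1 / 2 * G j i.+1 * (w j i + w j i.+1))
  - 1 / 2 * ((G j i.+1 * w j i.+1 - G j i * w j i) + (G j i.+1 - G j i) * w j i) by field.
apply: le_trans (ler_normB _ _) _; rewrite [X in _ + X]normrM ger0_norm//.
have := H j i; have := ler_normD (G j i.+1 * w j i.+1 - G j i * w j i) ((G j i.+1 - G j i) * w j i).
move: g1 g3 g4; set a := `|_ - _|; set b := `|_ * _|; set c := `|_ + _|; set c' := `|_ + _|.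
by set z := (j.+1%:R)^-1; clear; lra.
Unshelve. all: by end_near.
Qed.

Lemma inv_succ_cvg0 (R : realType) (U : set_system nat) : \oo `<=` U ->
  (fun j : nat => j.+1%:R^-1 : R) @ U --> (0 : R).
Proof. by move=> Uoo; apply: cvg_trans (@cvg_harmonic R); exact: cvg_app. Qed.

Lemma curve_of_discrete (R : realType) (H : R * R -> R) (B0 V L s tau : R) :
  unif_cont H -> (forall p, `|H p| <= B0) -> 0 < s -> 0 <= V ->
  (forall z, 0 < z -> discrete_solution H tau s L V z) ->
  exists (x y : R -> R) lam,
  [/\ C2 x /\ C2 y, periodic1 x /\ periodic1 y,
      (forall t, (derive1 x t, derive1 y t) <> (0, 0)),
      area x y = tau & forall t, curv x y t = H (x t, y t) - lam].
Proof.
move=> uH HB0 s0 V0 Hd.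
have zpos (j : nat) : 0 < j.+1%:R^-1 :> R by rewrite invr_gt0.
have [N HN] := choice (fun j : nat => Hd _ (zpos j)).
have [x {}HN] := choice HN; have [y {}HN] := choice HN.
have [d {}HN] := choice HN; have [lam {}HN] := choice HN.
have jN j : (j < N j)%N.
  by have [[_ +] _ _ _ _] := HN j; rewrite invrK ler_nat.
have N0 j : (0 < N j)%N by exact: leq_ltn_trans (jN j).
have N0R j : 0 < (N j)%:R :> R by rewrite ltr0n.
have px j i : x j (i + N j)%N = x j i by have [_ [+ _] _ _ _] := HN j; apply.
have py j i : y j (i + N j)%N = y j i by have [_ [_ +] _ _ _] := HN j; apply.
have sd j : s <= d j by have [_ _ [/andP[]]] := HN j.
have dL j : d j <= L by have [_ _ [/andP[]]] := HN j.
have lV j : `|lam j| <= V by have [_ _ []] := HN j.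
have ar j : darea (N j) (x j) (y j) = tau by have [_ _ []] := HN j.
have sp j i : `|(N j)%:R ^+ 2 * esq (x j) (y j) i - d j ^+ 2| <= j.+1%:R^-1.
  by have [_ _ [_ _ _ h] _ _] := HN j; apply: h.
have xV j i : `|x j i| <= V by have [_ _ _ [+ _] _] := HN j; apply.
have yV j i : `|y j i| <= V by have [_ _ _ [_ [+ _]] _] := HN j; apply.
have dxV j i : (N j)%:R * `|x j i.+1 - x j i| <= V by have [_ _ _ [_ [_ [+ _]]] _] := HN j; apply.
have dyV j i : (N j)%:R * `|y j i.+1 - y j i| <= V by have [_ _ _ [_ [_ [_ +]]] _] := HN j; apply.
have ELx j i : `|(N j)%:R * (x j i.+2 - 2 * x j i.+1 + x j i) + d j / 2 * (H (x j i.+1, y j i.+1) - lam j) * (y j i.+2 - y j i)|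
    <= j.+1%:R^-1 / (N j)%:R by have [_ _ _ _ [+ _]] := HN j; apply.
have ELy j i : `|(N j)%:R * (y j i.+2 - 2 * y j i.+1 + y j i) - d j / 2 * (H (x j i.+1, y j i.+1) - lam j) * (x j i.+2 - x j i)|
    <= j.+1%:R^-1 / (N j)%:R by have [_ _ _ _ [_ +]] := HN j; apply.
clear Hd HN.
have d0 j : 0 <= d j by apply: le_trans (sd j); exact: ltW.
have dnL j : `|d j| <= L by rewrite ger0_norm.
pose v j i := (N j)%:R * (x j i.+1 - x j i).
pose w j i := (N j)%:R * (y j i.+1 - y j i).
have vV j i : `|v j i| <= V by rewrite normrM ger0_norm.
have wV j i : `|w j i| <= V by rewrite normrM ger0_norm.
pose G j i := d j * (H (x j i, y j i) - lam j).
have GB j i : `|G j i| <= L * (B0 + V).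
  rewrite normrM; apply: ler_pM => //; apply: le_trans (ler_normB _ _) _; exact: lerD.
have ELv j i : `|(N j)%:R * (v j i.+1 - v j i) + 1 / 2 * G j i.+1 * (w j i + w j i.+1)| <= j.+1%:R^-1.
  have := ELx j i; rewrite ler_pdivlMr// -{2}[(N j)%:R]gtr0_norm// -normrM.
  by congr (`|_| <= _); rewrite /v /w /G; field.
have ELw j i : `|(N j)%:R * (w j i.+1 - w j i) + 1 / 2 * G j i.+1 * (- v j i + - v j i.+1)| <= j.+1%:R^-1.
  have := ELy j i; rewrite ler_pdivlMr// -{2}[(N j)%:R]gtr0_norm// -normrM.
  by congr (`|_| <= _); rewrite /v /w /G; field.
have z1 j : j.+1%:R^-1 <= 1 :> R by rewrite invf_le1// ler1n.
(* The equation bounds the second differences, so the velocities are themselves Lipschitz sequences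
   and hence equicontinuous. *)
have lip (f g : nat -> nat -> R) : (forall j i, `|g j i| <= V) ->
   (forall j i, `|(N j)%:R * (f j i.+1 - f j i) + 1 / 2 * G j i.+1 * (g j i + g j i.+1)| <= j.+1%:R^-1) ->
   forall j i, (N j)%:R * `|f j i.+1 - f j i| <= 1 + L * (B0 + V) * V.
  move=> gV EL j i; rewrite -{1}[(N j)%:R]gtr0_norm// -normrM.
  have -> : (N j)%:R * (f j i.+1 - f j i) = ((N j)%:R * (f j i.+1 - f j i) + 1 / 2 * G j i.+1 * (g j i + g j i.+1))
      - G j i.+1 * (1 / 2 * (g j i + g j i.+1)) by field.
  apply: le_trans (ler_normB _ _) _; apply: lerD; first exact: le_trans (EL j i) (z1 j).
  rewrite [X in X <= _]normrM; apply: ler_pM => //; rewrite normrM ger0_norm//.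
  by have := ler_normD (g j i) (g j i.+1); have := gV j i; have := gV j i.+1; clear; lra.
have ev : equicont N v by exact: equicont_lip N0 vV (lip v w wV ELv).
have ew : equicont N w.
  apply: equicont_lip N0 wV (lip w (fun j i => - v j i) _ ELw).
  by move=> j i; rewrite normrN.
have ex : equicont N x by exact: equicont_lip N0 xV dxV.
have ey : equicont N y by exact: equicont_lip N0 yV dyV.
have ed : equicont N (fun j _ => d j) by exact: equicont_cst dnL.
have el : equicont N (fun j _ => - lam j).
  by apply: (@equicont_cst _ _ _ V) => j; rewrite normrN.
have eG : equicont N G by exact: equicontM ed (equicontD (equicont_comp uH HB0 ex ey) el).
have em : equicont N (fun _ _ => -1 : R) by apply: (@equicont_cst _ _ _ 1) => j; rewrite normrN1.
have eGw : equicont N (fun j i => - (G j i * w j i)).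
  have -> : (fun j i => - (G j i * w j i)) = (fun j i => -1 * (G j i * w j i)).
    by apply/funext => j; apply/funext => i; rewrite mulN1r.
  exact: equicontM em (equicontM eG ew).
have emv : equicont N (fun j i => - v j i).
  have -> : (fun j i => - v j i) = (fun j i => -1 * v j i).
    by apply/funext => j; apply/funext => i; rewrite mulN1r.
  exact: equicontM em ev.
have eGv : equicont N (fun j i => - (G j i * - v j i)).
  have -> : (fun j i => - (G j i * - v j i)) = (fun j i => G j i * v j i).
    by apply/funext => j; apply/funext => i; rewrite mulrN opprK.
  exact: equicontM eG ev.
(* Partial area sums, corrected by the linear drift so as to be periodic. *)
pose b j i := 1 / 2 * (y j i * v j i - x j i * w j i) - tau.
pose S j i := \sum_(k < i) b j k / (N j)%:R.
have eb : equicont N b.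
  have -> : b = (fun j i => 1 / 2 * (y j i * v j i + -1 * (x j i * w j i)) + - tau).
    by apply/funext => j; apply/funext => i; rewrite /b; ring.
  apply: equicontD; last exact: equicont_cst (fun=> lexx `|- tau|).
  apply: equicontM; first exact: equicont_cst (fun=> lexx `|1 / 2|).
  apply: equicontD; first exact: equicontM.
  exact: equicontM em (equicontM ex ew).
have pv j i : v j (i + N j)%N = v j i by rewrite /v -addSn !px.
have pw j i : w j (i + N j)%N = w j i by rewrite /w -addSn !py.
have Sb j i : (N j)%:R * (S j i.+1 - S j i) = b j i.
  by rewrite /S big_ord_recr/= addrAC subrr add0r mulrC divfK ?gt_eqF.
have SN j : S j (N j) = 0.
  rewrite /S -mulr_suml /b sumrB sumr_const card_ord -[_ *+ N j]mulr_natl -mulr_sumr.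
  have -> : \sum_(i < N j) (y j i * v j i - x j i * w j i) = (N j)%:R * \sum_(i < N j) (y j i * x j i.+1 - x j i * y j i.+1).
    by rewrite mulr_sumr; apply: eq_bigr => i _; rewrite /v /w; ring.
  by rewrite mulrCA -mulrBr -/(darea _ _ _) ar subrr mulr0 mul0r.
have pS j i : S j (i + N j)%N = S j i.
  elim: i => [|i IH]; first by rewrite add0n SN /S big_ord0.
  rewrite addSn; have := Sb j (i + N j)%N; have -> : b j (i + N j)%N = b j i by rewrite /b px py pv pw.
  rewrite -(Sb j i) IH => /(mulfI (negbT (gt_eqF (N0R j)))).
  by move/(canRL (subrK _)); rewrite subrK.
have [[Kb bK] _] := eb.
have SL j i : (N j)%:R * `|S j i.+1 - S j i| <= Kb.
  by rewrite -{1}[(N j)%:R]gtr0_norm// -normrM Sb.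
have SB j i : `|S j i| <= Kb.
  have := @periodic_diam R (N j) (S j) Kb (N0 j) (pS j) _ i 0%N.
  have -> : S j 0%N = 0 by rewrite /S big_ord0.
  rewrite subr0; apply.
  apply: (@le_trans _ _ (\sum_(i < N j) Kb / (N j)%:R)).
    by apply: ler_sum => k _; rewrite ler_pdivlMr// mulrC.
  by rewrite sumr_const card_ord -[_ *+ N j]mulr_natl mulrC divfK ?gt_eqF.
have eS : equicont N S by exact: equicont_lip N0 SB SL.
have [U UU Uoo] := ultra_nat.
have FU : ProperFilter U by exact: ultra_proper.
have [X HX] := equicont_limit UU ex; have [Y HY] := equicont_limit UU ey.
have [VX HVX] := equicont_limit UU ev; have [VY HVY] := equicont_limit UU ew.
have [A HA] := equicont_limit UU eS.
have [D HD] := equicont_limit UU ed.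
have [La HLa] := equicont_limit UU el.
(* The sequences [d] and [lam] do not depend on the sample index, so their limit functions are
   constant and may be evaluated at 0. *)
have {}HD : d @ U --> D 0 by exact: HD.
have HL : lam @ U --> - La 0.
  have -> : lam = (fun j => - - lam j) by apply/funext => j; rewrite opprK.
  by apply: cvgN; exact: HLa.
have D0 : 0 < D 0.
  apply: lt_le_trans s0 _; apply: (cvgr_to_ge HD); exact: nearW.
have HG t : (fun j => G j (sample N j t)) @ U --> D 0 * (H (X t, Y t) - - La 0).
  apply: cvgM => //; apply: cvgB => //.
  exact: (@unif_cont_cvg R nat U H (fun j => x j (sample N j t)) (fun j => y j (sample N j t)) _ _ _ uH (HX t) (HY t)).
have exact0 (f g : nat -> nat -> R) : (forall j i, (N j)%:R * (f j i.+1 - f j i) = g j i) ->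
    forall e, 0 < e -> \forall j \near U, forall i, `|(N j)%:R * (f j i.+1 - f j i) - g j i| <= e.
  by move=> fg e e0; apply: nearW => j i; rewrite fg subrr normr0 ltW.
exists X, Y, (- La 0).
apply: (@curve_of_ode R H X Y VX VY A (D 0) (- La 0) tau uH D0).
- exact: sample_limit_periodic FU Uoo px HX.
- exact: sample_limit_periodic FU Uoo py HY.
- exact: discrete_ftc FU Uoo jN ev (exact0 x v (fun _ _ => erefl)) HX HVX.
- exact: discrete_ftc FU Uoo jN ew (exact0 y w (fun _ _ => erefl)) HY HVY.
- apply: (discrete_ftc FU Uoo jN eGw (velocity_increment FU Uoo jN eG ew ELv) HVX) => t.
  by apply: cvgN; apply: cvgM; [exact: HG|exact: HVY].
- apply: (discrete_ftc FU Uoo jN eGv (velocity_increment FU Uoo jN eG emv ELw) HVY) => t.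
  rewrite -[_ * VX t]opprK -mulrN; apply: cvgN; apply: cvgM; [exact: HG|apply: cvgN; exact: HVX].
- move=> t; apply/eqP; rewrite -subr_eq0 -normr_le0.
  have c1 : (fun j => v j (sample N j t) ^+ 2 + w j (sample N j t) ^+ 2 - d j ^+ 2) @ U
      --> VX t ^+ 2 + VY t ^+ 2 - D 0 ^+ 2.
    apply: cvgB; last exact: cvgM.
    by apply: cvgD; apply: cvgM; [exact: HVX|exact: HVX|exact: HVY|exact: HVY].
  apply: (ler_cvg_to (cvg_norm c1) (inv_succ_cvg0 (R := R) Uoo)); apply: nearW => j.
  have := sp j (sample N j t); congr (`|_| <= _); rewrite /v /w /esq; ring.
- apply: (discrete_ftc FU Uoo jN eb (exact0 S b Sb) HA) => t.
  apply: cvgB; last exact: cvg_cst.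
  apply: cvgM; first exact: cvg_cst.
  by apply: cvgB; apply: cvgM; [exact: HY|exact: HVX|exact: HX|exact: HVY].
- by rewrite -[1]add0r (sample_limit_periodic FU Uoo pS HA).
Qed.

(** * From the hypotheses on the two functions to the data of the construction *)

Lemma enorm_le_sum (R : realType) (a b : R) : enorm (a, b) <= `|a| + `|b|.
Proof.
rewrite -(@ler_pXn2r _ 2%N) ?nnegrE ?addr_ge0 ?sqrtr_ge0//.
rewrite sqr_sqrtr ?addr_ge0 ?sqr_ge0// sqrrD !real_normK ?num_real//=.
by rewrite [X in _ <= X]addrAC lerDl mulrn_wge0 ?mulr_ge0.
Qed.

Lemma holder_unif_cont (R : realType) (H : R * R -> R) : holder_some H -> unif_cont H.
Proof.
move=> [_ [al [/andP[al0 _] [C HC]]]] e e0.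
pose r := e / (`|C| + 1).
have r0 : 0 < r by rewrite divr_gt0.
have d0 : 0 < powR r al^-1 / 2 by rewrite divr_gt0// powR_gt0.
exists (powR r al^-1 / 2) => // p q h1 h2; apply: le_trans (HC p q) _.
have le1 : enorm (psub p q) <= powR r al^-1.
  apply: le_trans (enorm_le_sum _ _) _; rewrite [leRHS](splitr _); exact: lerD.
have le2 : powR (enorm (psub p q)) al <= r.
  rewrite -[leRHS](powRr1 (ltW r0)) -(@mulVf _ al) ?gt_eqF// powRrM.
  by apply: ge0_ler_powR => //; rewrite ?nnegrE ?sqrtr_ge0 ?powR_ge0 ?(ltW al0).
apply: (@le_trans _ _ ((`|C| + 1) * powR (enorm (psub p q)) al)).
  rewrite ler_wpM2r ?powR_ge0//; have := ler_norm C; clear; lra.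
by rewrite mulrC -ler_pdivlMr.
Qed.

Lemma unif_cont_lin (R : realType) (H1 H2 : R * R -> R) (a : R) :
  unif_cont H1 -> unif_cont H2 -> unif_cont (fun p => a * H1 p + H2 p).
Proof.
move=> u1 u2 e e0; have a1 : 0 < `|a| + 1 by rewrite ltr_wpDl.
have [d1 d10 h1] := u1 _ (divr_gt0 (divr_gt0 e0 (ltr0n R 2)) a1).
have [d2 d20 h2] := u2 _ (divr_gt0 e0 (ltr0n R 2)).
exists (Num.min d1 d2); first by rewrite lt_min d10.
move=> p q; rewrite !le_min => /andP[p1 p2] /andP[q1 q2].
have -> : a * H1 p + H2 p - (a * H1 q + H2 q) = a * (H1 p - H1 q) + (H2 p - H2 q) by ring.
apply: le_trans (ler_normD _ _) _; rewrite [leRHS](splitr e); apply: lerD; last exact: h2.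
have := h1 _ _ p1 q1; rewrite ler_pdivlMr// normrM => h; apply: le_trans h.
by rewrite mulrDr mulr1 mulrC lerDl.
Qed.

(* A far translate of a ball fits into the cone over an open arc; compactness
   makes the sign of [f] on it uniform. *)
Lemma cone_ball_neg (R : realType) (w : set (R * R)) (f : R * R -> R) (r : R) :
  open_arc w -> unif_cont f -> (forall p s, w p -> 0 < s -> f (pscale s p) < 0) -> 0 < r ->
  exists c1 c2 del, 0 < del /\ forall u v, (u - c1) ^+ 2 + (v - c2) ^+ 2 <= r ^+ 2 -> f (u, v) <= - del.
Proof.
move=> [wc [[[p1 p2] wp] wo]] uf fneg r0.
have [d [d0 Hd]] := wo _ wp.
have p12 : p1 ^+ 2 + p2 ^+ 2 = 1.
  have /(congr1 (fun z => z ^+ 2)) := wc _ wp; rewrite sqr_sqrtr ?expr1n//.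
  by rewrite addr_ge0 ?sqr_ge0.
(* The centre of the ball is [t p]: [r < t] keeps the ball away from the origin, and [2 r < d t]
   keeps the directions of its points within [d] of [p]. *)
pose t := 2 * r / d + 2 * r.
have rd : 0 < 2 * r / d by rewrite divr_gt0// mulr_gt0.
have t0 : 0 < t by rewrite addr_gt0// mulr_gt0.
have tr : r < t by rewrite /t; move: rd r0; clear; lra.
have td : 2 * r < d * t.
  by rewrite /t mulrDr [d * (_ / d)]mulrC divfK ?gt_eqF// ltrDl !mulr_gt0.
have neg u v : (u - t * p1) ^+ 2 + (v - t * p2) ^+ 2 <= r ^+ 2 -> f (u, v) < 0.
  move=> h; pose n := enorm (u, v).
  have zr : enorm (u - t * p1, v - t * p2) <= r.
    rewrite -(@ler_pXn2r _ 2%N) ?nnegrE ?sqrtr_ge0 ?(ltW r0)//.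
    by rewrite sqr_sqrtr// addr_ge0 ?sqr_ge0.
  have tp : enorm (t * p1, t * p2) = t.
    rewrite /enorm /=; have -> : (t * p1) ^+ 2 + (t * p2) ^+ 2 = t ^+ 2 * (p1 ^+ 2 + p2 ^+ 2) by ring.
    by rewrite p12 mulr1 sqrtr_sqr gtr0_norm.
  have nt : `|n - t| <= r.
    rewrite ler_norml; apply/andP; split.
      have := enorm_triangle u v (t * p1 - u) (t * p2 - v).
      rewrite addrC subrK [v + _]addrC subrK tp.
      have -> : enorm (t * p1 - u, t * p2 - v) = enorm (u - t * p1, v - t * p2).
        by rewrite /enorm /=; congr Num.sqrt; ring.
      by rewrite -/n; move: zr; clear; lra.
    have := enorm_triangle (t * p1) (t * p2) (u - t * p1) (v - t * p2).
    by rewrite addrC subrK [_ + (v - _)]addrC subrK tp -/n; move: zr; clear; lra.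
  have n0 : 0 < n by move: nt tr; rewrite ler_norml => /andP[+ _]; clear; lra.
  have n2 : n ^+ 2 = u ^+ 2 + v ^+ 2 by rewrite sqr_sqrtr// addr_ge0 ?sqr_ge0.
  pose q := (u / n, v / n).
  have cq : circle q.
    rewrite /circle /= /enorm /= !exprMn -mulrDl -n2 -exprMn divff ?gt_eqF// expr1n sqrtr1//.
  have -> : (u, v) = pscale n q by rewrite /pscale /q /= ![n * (_ / n)]mulrC !divfK ?gt_eqF//.
  apply: fneg => //; apply: Hd => //; rewrite /psub /q /=.
  have hz (a b k : R) : enorm (k * a, k * b) = `|k| * enorm (a, b).
    rewrite /enorm /= !exprMn -mulrDr sqrtrM ?sqr_ge0// sqrtr_sqr//.
  (* Normalizing displaces a point in two ways, radially by [t - n] and by its offset from the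
     centre; after division by [t] each contributes at most [r / t]. *)
  have -> : u / n - p1 = (t^-1 * (u / n)) * (t - n) + t^-1 * (u - t * p1).
    by field; rewrite !gt_eqF.
  have -> : v / n - p2 = (t^-1 * (v / n)) * (t - n) + t^-1 * (v - t * p2).
    by field; rewrite !gt_eqF.
  apply: le_lt_trans (enorm_triangle _ _ _ _) _; rewrite hz.
  have -> : enorm (t^-1 * (u / n) * (t - n), t^-1 * (v / n) * (t - n)) = `|t^-1| * `|t - n|.
    rewrite -normrM -[RHS]mulr1 -[in RHS]cq -hz; congr (enorm (_, _)); rewrite /q /=; ring.
  rewrite -mulrDr gtr0_norm ?invr_gt0// mulrC ltr_pdivrMr//; apply: le_lt_trans td.
  by rewrite distrC; move: nt zr; clear; lra.
exists (t * p1), (t * p2); apply: contrapT => Hno.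
have H n : exists q : R * R, (q.1 - t * p1) ^+ 2 + (q.2 - t * p2) ^+ 2 <= r ^+ 2 /\ - n.+1%:R^-1 <= f q.
  apply: contrapT => Hn; apply: Hno; exists n.+1%:R^-1; split; first by rewrite invr_gt0.
  move=> u v h; rewrite leNgt; apply/negP => h'; apply: Hn; exists (u, v); split=> //; exact: ltW.
have [q Hq] := choice H.
have [U UU Uoo] := ultra_nat.
have coord a b c : (a - c) ^+ 2 + b ^+ 2 <= r ^+ 2 -> `|a| <= `|c| + r.
  move=> h; have : `|a - c| <= r.
    rewrite -(@ler_pXn2r _ 2%N) ?nnegrE ?(ltW r0)// real_normK ?num_real//.
    by apply: le_trans h; rewrite lerDl sqr_ge0.
  by have := ler_normD (a - c) c; rewrite subrK; clear; lra.
have [u Hu] : exists l : R, (fun n => (q n).1) @ U --> l.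
  apply: (@ultra_cvg_bounded R U UU _ (`|t * p1| + r)); apply: filterS filterT => n _ /=.
  exact: coord (Hq n).1.
have [v Hv] : exists l : R, (fun n => (q n).2) @ U --> l.
  apply: (@ultra_cvg_bounded R U UU _ (`|t * p2| + r)); apply: filterS filterT => n _ /=.
  by apply: (coord _ ((q n).1 - t * p1)); rewrite addrC; exact: (Hq n).1.
have : f (u, v) < 0.
  apply: neg.
  have c : (fun n => ((q n).1 - t * p1) ^+ 2 + ((q n).2 - t * p2) ^+ 2) @ U
      --> (u - t * p1) ^+ 2 + (v - t * p2) ^+ 2.
    by apply: cvgD; apply: cvgM; apply: cvgB => //; exact: cvg_cst.
  by apply: (cvgr_to_le c); apply: nearW => n; exact: (Hq n).1.
apply/negP; rewrite -leNgt.
have cf : (fun n => f (q n)) @ U --> f (u, v).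
  have -> : (fun n => f (q n)) = (fun n => f ((q n).1, (q n).2)).
    by apply/funext => n; case: (q n).
  exact: (@unif_cont_cvg R nat U f (fun n => (q n).1) (fun n => (q n).2) _ _ _ uf Hu Hv).
have ch : (fun n => - n.+1%:R^-1 : R) @ U --> (0 : R).
  by rewrite -oppr0; apply: cvgN; exact: inv_succ_cvg0.
by apply: (ler_cvg_to ch cf); apply: nearW => n; exact: (Hq n).2.
Qed.

Unset Implicit Arguments. Set Strict Implicit. Set Printing Implicit Defensive.

Theorem theorem1p1p3 (R : realType) (H1 H2 : R * R -> R) (H2inf : R)
  (wp wm : set (R * R)) :
  holder_some H1 -> Z2_periodic H1 ->
  (sup_dev H1 (mean_square H1) < (2 * Num.sqrt 2)%:E)%E ->
  holder_some H2 -> tends_at_infty H2 H2inf ->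
  (lorentz21 (fun p => (H2 p - H2inf)%R) < (powR (2 / pi) (3 / 2))%:E)%E ->
  open_arc wp -> open_arc wm ->
  (forall p s, wp p -> 0 < s -> H2 (pscale s p) - H2inf < 0) ->
  (forall p s, wm p -> 0 < s -> - (H2 (pscale s p) - H2inf) < 0) ->
  ((Num.sqrt 2 / 4)%:E * sup_dev H1 (mean_square H1)
     + (powR (pi / 2) (3 / 2))%:E * lorentz21 (fun p => (H2 p - H2inf)%R) < 1%:E)%E ->
  forall tau0 tau1 : R, 0 < tau0 -> tau0 < tau1 ->
  exists eps0 : R, 0 < eps0 <= 1 /\
  forall eps tau : R, 0 < eps <= eps0 -> tau0 <= `|tau| <= tau1 ->
  exists (x y : R -> R) (lam : R),
    C2 x /\ C2 y /\ periodic1 x /\ periodic1 y /\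
    (forall t, (derive1 x t, derive1 y t) <> (0, 0)) /\
    area x y = tau /\
    forall t, curv x y t = eps * H1 (x t, y t) + H2 (x t, y t) - lam.
Proof.
move=> hH1 _ _ hH2 hinf hlo owp owm Hp Hm _ tau0 tau1 t00 t01.
pose G p := H2 p - H2inf.
have uH1 := holder_unif_cont hH1; have uH2 := holder_unif_cont hH2.
have uG : unif_cont G.
  move=> e /uH2[d d0 Hd]; exists d => // p q h1 h2.
  by rewrite /G opprB addrA subrK; exact: Hd.
have [[B1 HB1] _] := hH1; have [[B2 HB2] _] := hH2.
have B10 : 0 <= B1 := le_trans (normr_ge0 _) (HB1 (0, 0)).
have GB p : `|G p| <= B2 + `|H2inf|.
  by apply: le_trans (ler_normB _ _) _; rewrite lerD2r.
(* Since [2 / pi <= 1], the Lorentz norm is below 1, which is what the constants 9/4 and 19/8 are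
   matched to. *)
have lo : (lorentz21 G < 1%:E)%E.
  apply: lt_le_trans hlo _; have p1 : powR 1 (3 / 2) = 1 :> R by rewrite powR1.
  rewrite lee_fin -[leRHS]p1.
  have pi0 := pi_gt0 R; apply: ge0_ler_powR => //.
  - by rewrite nnegrE divr_ge0// ltW.
  - by rewrite nnegrE.
  - by rewrite ler_pdivrMr// mul1r pi_ge2.
have t10 : 0 < tau1 by exact: lt_trans t01.
(* One radius for all areas: the competitor for [tau] lies in a ball of squared radius
   [|tau| <= tau1]. *)
pose r := Num.sqrt tau1.
have r0 : 0 < r by rewrite sqrtr_gt0.
have rr : r ^+ 2 = tau1 by rewrite sqr_sqrtr// ltW.
have [cp1 [cp2 [dp [dp0 Hcp]]]] := cone_ball_neg owp uG Hp r0.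
have uGm : unif_cont (fun p => - G p).
  move=> e /uG[d d0 Hd]; exists d => // p q h1 h2.
  by rewrite -opprD normrN; exact: Hd.
have [cm1 [cm2 [dm [dm0 Hcm]]]] := cone_ball_neg owm uGm Hm r0.
have [del [del0 delp delm]] : exists del, [/\ 0 < del, 2 * del <= dp & 2 * del <= dm].
  exists (Num.min dp dm / 2); rewrite divr_gt0 ?lt_min ?dp0//.
  by rewrite mulrC divfK//; split=> //; rewrite ge_min lexx ?orbT.
(* A minimizer satisfies [d <= 38 m], where [m <= 6 sqrt |tau|] for the regular polygon. *)
pose L := 38 * (6 * r).
have L0 : 0 < L by rewrite !mulr_gt0.
(* With the smallest value [tau0] in place of [|tau|], the same [del1] serves every [tau] in the
   range. *)
have [del1 [del10 Ldel1]] : exists del1, 0 < del1 /\ L ^+ 2 * del1 = tau0 * del / 8.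
  exists (tau0 * del / 8 / L ^+ 2); split; first by rewrite !divr_gt0 ?mulr_gt0 ?exprn_gt0.
  by rewrite mulrC divfK// expf_neq0// gt_eqF.
have [K HK] := hinf _ (divr_gt0 del10 (ltr0n R 2)).
pose K0 := `|K| + 1.
have far u v : K0 <= `|u| \/ K0 <= `|v| -> `|G (u, v)| <= del1 / 2.
  move=> h; apply: ltW; apply: HK; have := ler_norm K; have [nu nv] := norm_le_enorm u v.
  by case: h; rewrite /K0; move: nu nv; clear; lra.
have [M [KL cM]] : exists M, K0 + L <= M /\
    [/\ `|cp1| + r <= M, `|cp2| + r <= M, `|cm1| + r <= M & `|cm2| + r <= M].
  exists (K0 + L + (`|cp1| + r) + (`|cp2| + r) + (`|cm1| + r) + (`|cm2| + r)).
  have := normr_ge0 cp1; have := normr_ge0 cp2; have := normr_ge0 cm1; have := normr_ge0 cm2.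
  have K00 : 0 <= K0 by rewrite addr_ge0.
  move: K00 r0 (ltW L0); clearbody K0 L r; clear; move=> *; split; last split; lra.
have M10 : 0 < M + 1.
  by case: cM => + _ _ _; have := normr_ge0 cp1; move: r0; clearbody r; clear; lra.
have [eps1 eps10 Hfield] := field_approx uH1 uG HB1 GB lo M10.
have B11 : 0 < B1 + 1 by rewrite ltr_wpDl.
(* [eps1] keeps the field below 37/38, [del1 / 2] keeps [H] small far away, and [del] preserves its
   sign in the two balls. *)
exists (Num.min (Num.min 1 eps1) (Num.min (del1 / 2) del / (B1 + 1))); split.
  by rewrite !lt_min ltr01 eps10 divr_gt0 ?lt_min ?divr_gt0 ?del0//= !ge_min lexx.
move=> eps tau /andP[e0]; rewrite !le_min ler_pdivlMr// le_min.
move=> /andP[/andP[_ ee1] /andP[eB1 eB2]] /andP[ta tb].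
have eH p : `|eps * H1 p| <= eps * (B1 + 1).
  rewrite normrM gtr0_norm// ler_pM2l//; apply: le_trans (HB1 p) _; by rewrite lerDl.
have at0 : 0 < `|tau| := lt_le_trans t00 ta.
have tau0' : tau != 0 by rewrite -normr_gt0.
have sr : Num.sqrt `|tau| <= r by rewrite ler_wsqrtr.
have s0 : 0 < Num.sqrt `|tau| by rewrite sqrtr_gt0.
pose H p := eps * H1 p + G p.
have uH : unif_cont H by exact: unif_cont_lin.
have HB p : `|H p| <= eps * (B1 + 1) + (B2 + `|H2inf|).
  by apply: le_trans (ler_normD _ _) _; exact: lerD.
(* The favourable cone depends on the sign of [tau]; half of the margin [2 del] pays for
   [eps * H1]. *)
have [c1 [c2 [cM1 cM2 Hdisc]]] : exists c1 c2, [/\ `|c1| + r <= M, `|c2| + r <= M &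
    forall u v, (u - c1) ^+ 2 + (v - c2) ^+ 2 <= `|tau| -> tau * H (u, v) <= - (`|tau| * del)].
  have [cMp1 cMp2 cMm1 cMm2] := cM.
  have [tp|tn] := ltP 0 tau.
    exists cp1, cp2; split=> // u v h; have := Hcp u v; rewrite rr => /(_ (le_trans h tb)) g.
    rewrite gtr0_norm// -mulrN ler_pM2l//.
    have := eH (u, v); rewrite ler_norml /H => /andP[_]; move: g eB2 delp; clear; lra.
  exists cm1, cm2; split=> // u v h; have := Hcm u v; rewrite rr => /(_ (le_trans h tb)) g.
  rewrite ler0_norm// mulNr opprK; apply: ler_wnM2l => //.
  have := eH (u, v); rewrite ler_norml /H => /andP[+ _]; move: g eB2 delm; clear; lra.
have Hfar u v : K0 <= `|u| \/ K0 <= `|v| -> `|H (u, v)| <= del1.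
  move=> /far g; apply: le_trans (ler_normD _ _) _; have := eH (u, v).
  by move: g eB1; clear; lra.
have field : has_potential H (M + 1) by apply: Hfield; rewrite (ltW e0).
have sL : 38 * (6 * Num.sqrt `|tau|) <= L by rewrite !ler_pM2l.
have cs1 : `|c1| + Num.sqrt `|tau| <= M by apply: le_trans cM1; rewrite lerD2l.
have cs2 : `|c2| + Num.sqrt `|tau| <= M by apply: le_trans cM2; rewrite lerD2l.
have MM : M < M + 1 by rewrite ltrDl.
have Ld : L ^+ 2 * del1 <= `|tau| * del / 8.
  by rewrite Ldel1 ler_pM2r ?invr_gt0// ler_pM2r.
have [V V0 HV] := discrete_curve field HB tau0' sL del0 (ltW del10) Hdisc Hfar KL cs1 cs2 MM Ld.
have s20 : 0 < 2 * Num.sqrt `|tau| by rewrite mulr_gt0.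
have [x [y [lam [[C2x C2y] [px py] reg ar cur]]]] := curve_of_discrete uH HB s20 V0 HV.
exists x, y, (lam + H2inf); do !split=> //.
by move=> t; rewrite cur /H /G; ring.
Qed.
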